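(* Let $X$ be a compact Riemann surface of genus $g\ge2$, $n\ge1$, and let $(E,\Phi,\omega)\in\mathcal{M}_{\mathrm{Sp}(2n,\mathbb{C})}(X,K_X)$ with irreducible and reduced spectral curve $\Sigma$ of $\mathfrak{sl}(2)$-type. Let $(E_2,\Phi_2)\in\mathcal{M}_{\mathrm{SL}(2,\mathbb{C})}(\Sigma/\sigma,\pi_n^*K_X)$ be the $\mathrm{SL}(2,\mathbb{C})$-Higgs bundle corresponding to $(E,\Phi,\omega)$, so that $(E,\Phi)=\pi_{n*}(E_2\otimes\pi_n^*K_X^{n-1},\Phi_2)$, and let $h_2$ be the solution to the decoupled Hitchin equation on $(E_2,\Phi_2)$ constructed from its eigen line bundle. Then $h_2$ induces (by pushforward along $\pi_n$) a Hermitian metric $h_{dc}$ on $(E,\Phi,\omega)|_{X\setminus Z(\mathrm{disc}(E,\Phi,\omega))}$ solving the decoupled Hitchin equation.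
   Context: **Higgs bundles.** $\mathcal{M}_{\mathrm{Sp}(2n,\mathbb{C})}(X,K_X)$: moduli space of stable triples $(E,\Phi,\omega)$, $E$ of rank $2n$, $\omega$ a holomorphic symplectic form on $E$, $\Phi\in H^0(X,\mathrm{End}(E)\otimes K_X)$ with $\omega(\Phi\cdot,\cdot)=-\omega(\cdot,\Phi\cdot)$ (stable: isotropic $\Phi$-invariant proper non-zero subbundles have negative degree). For rank 2 these are $\mathrm{SL}(2,\mathbb{C})$-Higgs bundles; $\mathcal{M}_{\mathrm{SL}(2,\mathbb{C})}(Y,N)$ denotes the analogous moduli space on a Riemann surface $Y$ with Higgs fields twisted by $N$ instead of the canonical bundle. **Spectral curves.** If $\lambda^{2n}+a_2\lambda^{2n-2}+\dots+a_{2n}$ is the characteristic polynomial of $\Phi$, $\Sigma\subset\mathrm{Tot}(K_X)$ is its zero divisor, $\sigma:\lambda\mapsto-\lambda$, $\pi_n:\Sigma/\sigma\to X$ the induced projection; $\Sigma$ is of $\mathfrak{sl}(2)$-type if $\Sigma/\sigma$ is smooth. $-\lambda^2$ descends to $b_2\in H^0(\Sigma/\sigma,\pi_n^*K_X^2)$. The corresponding $\mathrm{SL}(2,\mathbb{C})$-Higgs bundle is $E_2=\ker(\pi_n^*\Phi^2+b_2\mathrm{id})\otimes\pi_n^*K_X^{n-1}$, $\Phi_2=\pi_n^*\Phi|$, with $\det\Phi_2=b_2$; conversely $E=\pi_{n*}(E_2\otimes\pi_n^*K_X^{n-1})$, $\Phi=\pi_{n*}\Phi_2$. The ramification divisor satisfies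 $\mathcal{O}(\mathrm{div}(\partial\pi_n))\cong\pi_n^*K_X^{2n-2}$, so $|\partial\pi_n|^{-1}$ is a singular flat Hermitian metric on $\pi_n^*K_X^{n-1}$; the symplectic form on $E$ is the pushforward of $(\partial\pi_n)^{-1}$ times that of $E_2$. **Discriminant.** $\mathrm{disc}(E,\Phi,\omega)\in H^0(X,K_X^{2n^2})$ is, up to a non-zero constant, $a_{2n}\prod_{i<j}(\lambda_i^2-\lambda_j^2)^2$, where $\pm\lambda_1,\dots,\pm\lambda_n$ are the eigenvalues of $\Phi$. $Z(\cdot)$ denotes the zero set. **Decoupled Hitchin equation.** A Hermitian metric $h$ compatible with the $G$-structure (i.e. a reduction of structure group to a maximal compact subgroup of $G$) solves the decoupled Hitchin equation if its Chern connection is flat, $F_h=0$, and the Higgs field is normal, $[\Phi,\Phi^{*_h}]=0$ (for $K_X$-twisted Higgs fields, $[\Phi\wedge\Phi^{*_h}]=0$). **Construction of $h_2$.** Let $\tilde\Sigma$ be the normalisation of $\Sigma$, $\tilde\pi_2:\tilde\Sigma\to\Sigma/\sigma$, $\lambda$ the tautological section on $\tilde\Sigma$, $\Lambda=\mathrm{div}(\lambda)$, $D$ the divisor on $\Sigma/\sigma$ whose coefficient at $y\in Z(b_2)$ is the vanishing order of $\Phi_2$ at $y$. Let $L=\ker(\tilde\pi_2^*\Phi_2-\lambda\,\mathrm{id})$ be the eigen line bundle, equipped with parabolic weights $\alpha_p=\frac12(\Lambda-\tilde\pi_2^*D)_p$ at $p\in Z(\tilde\pi_2^*b_2)$; its parabolic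 degree is 0. Let $h_L$ be the flat (Hermitian–Einstein) metric on $L$ adapted to this parabolic structure, i.e. of the form $|z|^{2\alpha_p}$ in a suitable local frame at $p$; it is unique up to a constant. Away from $Z(\tilde\pi_2^*b_2)$ one has $\tilde\pi_2^*E_2=L\oplus\sigma^*L$, and $h_L\oplus\sigma^*h_L$ descends to a metric $h_2$ on $E_2|_{(\Sigma/\sigma)\setminus Z(b_2)}$, which solves the decoupled Hitchin equation and induces a non-singular metric on $\det E_2$ (the constant is chosen compatibly with the trivialisation of $\det E_2$). The induced metric is $h_{dc}=\pi_{n*}(h_2|\partial\pi_n|^{-1})$. *)

(* Defs.v *)
From HB Require Import structures.
From mathcomp Require Import all_boot all_order all_algebra.
From mathcomp Require Import complex spectral.
From mathcomp Require Import mathcomp_extra boolp classical_sets functions.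
From mathcomp Require Import cardinality fsbigop reals topology normedtype derive.
Set Implicit Arguments.
Unset Strict Implicit.
Unset Printing Implicit Defensive.
Import Order.TTheory GRing.Theory Num.Theory.
Import numFieldNormedType.Exports.
Local Open Scope classical_set_scope.
Local Open Scope sesquilinear_scope.
Local Open Scope ring_scope.

(* The ascription gives R[i] the topology and the normed-module structure that
   every numFieldType carries in the library. *)
Definition Cplx (R : realType) : numClosedFieldType := R[i].

Section Calculus.
Variable R : realType.
Local Notation C := (Cplx R).

Definition part_re (z : C) : R := complex.Re z.
Definition part_im (z : C) : R := complex.Im z.
Definition of_real (t : R) : C := (t%:C)%C.

Variable V : normedModType C.

(* Derivative of f at z along v, for a *real* parameter t. *)
Definition dir_derivable (f : V -> C) (v z : V) : Prop :=
  derivable (fun t : R => part_re (f (z + of_real t *: v))) 0 1 /\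
  derivable (fun t : R => part_im (f (z + of_real t *: v))) 0 1.

Definition dir_deriv (v : V) (f : V -> C) (z : V) : C :=
  of_real (derive1 (fun t : R => part_re (f (z + of_real t *: v))) 0) +
  'i * of_real (derive1 (fun t : R => part_im (f (z + of_real t *: v))) 0).

Fixpoint Ck (k : nat) (U : set V) (f : V -> C) : Prop :=
  match k with
  | 0%N => forall z, U z -> {for z, continuous f}
  | k'.+1 => (forall z, U z -> {for z, continuous f}) /\
             forall v, (forall z, U z -> dir_derivable f v z) /\
                       Ck k' U (dir_deriv v f)
  end.

Definition smooth (U : set V) (f : V -> C) : Prop := forall k, Ck k U f.

(* U is meant to be open.  C^infinity in the real sense follows from complex
   differentiability by Cauchy's theorem; it is recorded because the library
   does not have that theorem. *)
Definition holo (U : set V) (f : V -> C) : Prop :=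
  smooth U f /\ forall z, U z -> differentiable (f : V -> C^o) z.

End Calculus.

Section Wirtinger.
Variable R : realType.
Local Notation C := (Cplx R).

Definition ddz (f : C -> C) (z : C) : C :=
  2^-1 * (dir_deriv (1 : C^o) f z - 'i * dir_deriv ('i : C^o) f z).

Definition ddzbar (f : C -> C) (z : C) : C :=
  2^-1 * (dir_deriv (1 : C^o) f z + 'i * dir_deriv ('i : C^o) f z).

End Wirtinger.

(* cmap and cinv are total functions; only their values on cdom and on
   cmap @` cdom matter. *)
Record chart (R : realType) (T : topologicalType) := Chart {
  cdom : set T;
  cmap : T -> Cplx R;
  cinv : Cplx R -> T;
  cdom_open : open cdom;
  cimg_open : open (cmap @` cdom);
  cmapK : forall x, cdom x -> cinv (cmap x) = x;
  cmap_continuous : forall x, cdom x -> {for x, continuous cmap};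
  cinv_continuous : forall x, cdom x -> {for cmap x, continuous cinv}
}.

Record riemann_surface (R : realType) := RiemannSurface {
  rs_sort :> topologicalType;
  rs_ix : Type;
  rs_chart : rs_ix -> chart R rs_sort;
  rs_nonempty : [set: rs_sort] !=set0;
  rs_hausdorff : hausdorff_space rs_sort;
  rs_connected : connected [set: rs_sort];
  rs_cover : forall x, exists c, cdom (rs_chart c) x;
  rs_trans : forall c d,
    holo (V := (Cplx R)^o)
      (cmap (rs_chart c) @` (cdom (rs_chart c) `&` cdom (rs_chart d)))
      (cmap (rs_chart d) \o cinv (rs_chart c))
}.

Section OnSurface.
Variables (R : realType) (X : riemann_surface R).
Local Notation C := (Cplx R).

Definition dom (c : rs_ix X) : set X := cdom (rs_chart c).
Definition coord (c : rs_ix X) : X -> C := cmap (rs_chart c).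
Definition param (c : rs_ix X) : C -> X := cinv (rs_chart c).

Definition hol_on (U : set X) (f : X -> C) : Prop :=
  forall c, holo (V := C^o) (coord c @` (U `&` dom c)) (f \o param c).
Definition smooth_on (U : set X) (f : X -> C) : Prop :=
  forall c, smooth (V := C^o) (coord c @` (U `&` dom c)) (f \o param c).
Definition hol_mx_on r s (U : set X) (f : X -> 'M[C]_(r, s)) : Prop :=
  forall a b, hol_on U (fun x => f x a b).

Definition cder (c : rs_ix X) (f : X -> C) (x : X) : C :=
  ddz (f \o param c) (coord c x).
Definition cderbar (c : rs_ix X) (f : X -> C) (x : X) : C :=
  ddzbar (f \o param c) (coord c x).

(* f = z^m u with z a coordinate centred at p and u holomorphic, u(p) <> 0; for
   a matrix-valued f, m is the minimum of the orders of the entries.  For m < 0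
   this is a pole, and then f p is the junk value 0. *)
Definition vanish_order r s (f : X -> 'M[C]_(r, s)) (p : X) (m : int) : Prop :=
  exists (c : rs_ix X) (V : set X) (u : X -> 'M[C]_(r, s)),
    [/\ open V, V p, V `<=` dom c, hol_mx_on V u & u p != 0] /\
    forall x, V x -> f x = (coord c x - coord c p) ^ m *: u x.

Definition vanish_order_fun (f : X -> C) (p : X) (m : int) : Prop :=
  vanish_order (fun x => (f x)%:M : 'M[C]_1) p m.

(* Bundles of rank r are given by cocycles: a vector with coordinates v_j in the
   j-th trivialisation has coordinates v_i = btr i j x *m v_j in the i-th. *)
Record cocycle (r : nat) := Cocycle {
  bix : Type;
  bdom : bix -> set X;
  btr : bix -> bix -> X -> 'M[C]_r
}.

Definition is_bundle r (E : cocycle r) : Prop :=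
  [/\ forall i, open (bdom (c := E) i),
      forall x, exists i, bdom (c := E) i x,
      forall i j, hol_mx_on (bdom (c := E) i `&` bdom j) (btr i j),
      forall i x, bdom (c := E) i x -> btr i i x = 1%:M &
      forall i j k x, bdom (c := E) i x -> bdom j x -> bdom k x ->
        btr i j x *m btr j k x = btr i k x].

(* f dz_c = f' dz_d means f = (dz_d / dz_c) f'. *)
Definition canonical_bundle : cocycle 1 :=
  @Cocycle 1 (rs_ix X) dom (fun c d x => (cder c (coord d) x)%:M).

Definition twist r (E : cocycle r) (N : cocycle 1) (m : nat) : cocycle r :=
  @Cocycle r (bix E * bix N)%type
    (fun i => bdom i.1 `&` bdom i.2)
    (fun i j x => (btr i.2 j.2 x 0 0) ^+ m *: btr i.1 j.1 x).

Definition section_on r (E : cocycle r) (U : set X)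
    (s : bix E -> X -> 'cV[C]_r) : Prop :=
  (forall i, hol_mx_on (U `&` bdom i) (s i)) /\
  (forall i j x, U x -> bdom i x -> bdom j x -> s i x = btr i j x *m s j x).

Definition line_section (N : cocycle 1) (m : nat) (b : bix N -> X -> C) : Prop :=
  (forall c, hol_on (bdom c) (b c)) /\
  (forall c d x, bdom c x -> bdom d x ->
     b c x = (btr c d x 0 0) ^+ m * b d x).

Definition bundle_map r s (E : cocycle r) (F : cocycle s)
    (phi : bix F -> bix E -> X -> 'M[C]_(s, r)) : Prop :=
  (forall a i, hol_mx_on (bdom a `&` bdom i) (phi a i)) /\
  (forall a b i j x, bdom a x -> bdom b x -> bdom i x -> bdom j x ->
     phi a i x *m btr i j x = btr a b x *m phi b j x).

Definition fibre_injective r s (E : cocycle r) (F : cocycle s)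
    (phi : bix F -> bix E -> X -> 'M[C]_(s, r)) : Prop :=
  forall a i x, bdom a x -> bdom i x -> \rank (phi a i x) = r.

(* phi identifies E with the kernel bundle of A, i.e. the holomorphic subbundle
   whose fibre is ker A(x) except at the finitely many points where the rank of
   A drops.  A is given in the trivialisations of the target F. *)
Definition kernel_bundle r s (E : cocycle r) (F : cocycle s)
    (phi : bix F -> bix E -> X -> 'M[C]_(s, r))
    (A : bix F -> X -> 'M[C]_s) : Prop :=
  [/\ bundle_map phi, fibre_injective phi &
      exists B : set X, finite_set B /\
        forall a i x, ~ B x -> bdom a x -> bdom i x ->
          forall v : 'cV[C]_s,
            A a x *m v = 0 <-> exists w, v = phi a i x *m w].

(* Degree of the divisor of a meromorphic section of det W. *)
Definition is_degree r (W : cocycle r) (d : int) : Prop :=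
  exists (s : bix W -> X -> C) (ord : X -> int) (ps : seq X),
    [/\ forall i j x, bdom i x -> bdom j x -> s i x = \det (btr i j x) * s j x,
        forall i x, bdom i x -> vanish_order_fun (s i) x (ord x),
        uniq ps, forall x, x \notin ps -> ord x = 0 &
        d = \sum_(p <- ps) ord p].

Definition genus (g : nat) : Prop :=
  exists th : 'I_g -> rs_ix X -> X -> C,
    [/\ forall k, @line_section canonical_bundle 1 (th k),
        forall a : 'I_g -> C,
          (forall c x, dom c x -> \sum_k a k * th k c x = 0) ->
          forall k, a k = 0 &
        forall s, @line_section canonical_bundle 1 s ->
          exists a : 'I_g -> C,
            forall c x, dom c x -> s c x = \sum_k a k * th k c x].

(* N-twisted Sp(2n)-Higgs bundles; for n = 1 these are SL(2)-Higgs bundles.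
   Phi goes from E to the twist of E by N, so Phi (i, c) i x is its matrix in
   the trivialisation i of E and c of N. *)
Record higgs (N : cocycle 1) (n : nat) := Higgs {
  hE : cocycle (n + n);
  hPhi : bix (twist hE N 1) -> bix hE -> X -> 'M[C]_(n + n);
  hOmega : bix hE -> X -> 'M[C]_(n + n)
}.

Definition sp_higgs (N : cocycle 1) n (H : higgs N n) : Prop :=
  [/\ is_bundle (hE H),
      bundle_map (@hPhi _ _ H),
      forall i, hol_mx_on (bdom i) (@hOmega _ _ H i),
      forall i j x, bdom i x -> bdom j x ->
        hOmega (h := H) j x = (btr i j x)^T *m hOmega i x *m btr i j x &
      forall i x, bdom i x ->
        [/\ (hOmega (h := H) i x)^T = - hOmega i x, hOmega (h := H) i x \in unitmx &
            forall c, bdom c x ->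
              (hPhi (h := H) (i, c) i x)^T *m hOmega i x =
              - (hOmega i x *m hPhi (i, c) i x)]].

Definition stable (N : cocycle 1) n (H : higgs N n) : Prop :=
  forall k (W : cocycle k) (j : bix (hE H) -> bix W -> X -> 'M[C]_(n + n, k)),
    (0 < k < n + n)%N -> is_bundle W -> bundle_map j -> fibre_injective j ->
    (forall i a x, bdom i x -> bdom a x ->
       (j i a x)^T *m hOmega i x *m j i a x = 0) ->
    (forall i a c x, bdom i x -> bdom a x -> bdom c x ->
       exists M, hPhi (i, c) i x *m j i a x = j i a x *m M) ->
    exists d, is_degree W d /\ d < 0.

Definition in_moduli (N : cocycle 1) n (H : higgs N n) : Prop :=
  sp_higgs H /\ stable H.

(* h(v, w) = w^* H v, with H the Gram matrix in the i-th trivialisation. *)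
Definition hermitian_metric r (E : cocycle r) (U : set X)
    (h : bix E -> X -> 'M[C]_r) : Prop :=
  [/\ forall i a b, smooth_on (U `&` bdom i) (fun x => h i x a b),
      forall i j x, U x -> bdom i x -> bdom j x ->
        h j x = (btr i j x)^t* *m h i x *m btr i j x,
      forall i x, U x -> bdom i x -> (h i x)^t* = h i x &
      forall i x, U x -> bdom i x -> forall v : 'cV[C]_r, v != 0 ->
        0 < (v^t* *m h i x *m v) 0 0].

(* Connection matrix h^-1 d'h of the Chern connection, curvature its d''. *)
Definition chern_flat r (E : cocycle r) (U : set X)
    (h : bix E -> X -> 'M[C]_r) : Prop :=
  forall i c x, U x -> bdom i x -> dom c x -> forall a b,
    cderbar c
      (fun y => (invmx (h i y) *m
                 \matrix_(k, l) cder c (fun z => h i z k l) y) a b) x = 0.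

Definition adjoint_wrt r (h A : 'M[C]_r) : 'M[C]_r := invmx h *m A^t* *m h.

Definition std_symplectic n : 'M[C]_(n + n) := block_mx 0 1%:M (- 1%:M) 0.

(* Reduction of the structure group to Sp(2n, C) /\ U(2n): at each point there
   is a frame which is both a Darboux basis and unitary. *)
Definition sp_compatible (N : cocycle 1) n (H : higgs N n) (U : set X)
    (h : bix (hE H) -> X -> 'M[C]_(n + n)) : Prop :=
  forall i x, U x -> bdom i x ->
    exists B : 'M[C]_(n + n),
      B^T *m hOmega i x *m B = std_symplectic n /\ B^t* *m h i x *m B = 1%:M.

Definition decoupled_hitchin (N : cocycle 1) n (H : higgs N n) (U : set X)
    (h : bix (hE H) -> X -> 'M[C]_(n + n)) : Prop :=
  [/\ hermitian_metric U h, sp_compatible U h, chern_flat U h &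
      forall i c x, U x -> bdom i x -> bdom c x ->
        let A := hPhi (i, c) i x in
        A *m adjoint_wrt (h i x) A = adjoint_wrt (h i x) A *m A].

End OnSurface.

Arguments vanish_order {R X r s}.
Arguments line_section {R X} N m b.
Arguments canonical_bundle {R} X.

Section Pullback.
Variables (R : realType) (Y X : riemann_surface R) (f : Y -> X).
Local Notation C := (Cplx R).

Definition holomorphic_map : Prop :=
  continuous f /\ forall c, hol_on (f @^-1` dom c) (coord c \o f).

Definition pullback r (E : cocycle X r) : cocycle Y r :=
  @Cocycle R Y r (bix E) (fun i => f @^-1` bdom i) (fun i j y => btr i j (f y)).

(* E = f_* V: adjunction turns the isomorphism into eps : f^*E -> V, and over
   every open U the map s |-> eps (f^* s) is a bijection from the sections of E
   over U to the sections of V over the preimage of U. *)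
Definition pushforward_iso r s (E : cocycle X r) (V : cocycle Y s)
    (eps : bix V -> bix (pullback E) -> Y -> 'M[C]_(s, r)) : Prop :=
  bundle_map eps /\
  forall (U : set X) (t : bix V -> Y -> 'cV[C]_s),
    open U -> section_on (f @^-1` U) t ->
    let represents (e : bix E -> X -> 'cV[C]_r) :=
      section_on U e /\
      forall y a i, U (f y) -> bdom a y -> bdom i (f y) ->
        t a y = eps a i y *m e i (f y) in
    (exists e, represents e) /\
    forall e e', represents e -> represents e' ->
      forall i x, U x -> bdom i x -> e i x = e' i x.

End Pullback.

Section Spectral.
Variables (R : realType) (X : riemann_surface R) (n : nat).
Local Notation C := (Cplx R).
Local Notation K := (canonical_bundle X).
Variable H : higgs K n.
Local Notation E := (hE H).

Definition spec_poly (i : bix E) (c : rs_ix X) (x : X) : {poly C} :=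
  char_poly (hPhi (h := H) (i, c) i x).

(* The char. polynomial is even in lambda; this is
   eta^n + a_2 eta^(n-1) + ... + a_2n, the equation of Sigma/sigma in the
   total space of K^2, with eta = lambda^2. *)
Definition quot_poly (i : bix E) (c : rs_ix X) (x : X) : {poly C} :=
  even_poly (spec_poly i c x).

(* The roots of quot_poly are the lambda_i^2. *)
Definition disc_at (i : bix E) (c : rs_ix X) (x : X) : C :=
  let P := quot_poly i c x in
  let r := sval (closed_field_poly_normal P) in
  P`_0 * \prod_(k < size r) \prod_(l < size r | (k < l)%N) (r`_k - r`_l) ^+ 2.

Definition disc_zero : set X :=
  [set x | exists i c, [/\ bdom i x, dom c x & disc_at i c x = 0]].

(* Points of the total space of K over dom c are pairs (x, l), l standing for
   the cotangent vector l dz_c. *)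
Definition on_sigma (c : rs_ix X) (x : X) (l : C) : Prop :=
  dom c x /\ exists i, bdom i x /\ root (spec_poly i c x) l.

Definition analytic_subset (A : rs_ix X -> X -> C -> Prop) : Prop :=
  (forall c d x l, dom c x -> dom d x ->
     A c x (btr (c := K) c d x 0 0 * l) <-> A d x l) /\
  (forall c x l, dom c x ->
     exists (W : set (C^o * C^o)) (m : nat) (F : 'I_m -> C^o * C^o -> C),
       [/\ open W, W (coord c x, l),
           forall w, W w -> (coord c @` dom c) w.1,
           forall k, holo W (F k) &
           forall w, W w -> A c (param c w.1) w.2 <-> forall k, F k w = 0]).

Definition sigma_irreducible : Prop :=
  forall A B, analytic_subset A -> analytic_subset B ->
    (forall c x l, on_sigma c x l -> A c x l \/ B c x l) ->
    (forall c x l, on_sigma c x l -> A c x l) \/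
    (forall c x l, on_sigma c x l -> B c x l).

(* The structure sheaf O/(p) of the zero divisor has no nilpotents: locally,
   p | q^2 implies p | q. *)
Definition sigma_reduced : Prop :=
  forall (i : bix E) (c : rs_ix X) (W : set (C^o * C^o)) (q r : C^o * C^o -> C),
    let p (w : C^o * C^o) := (spec_poly i c (param c w.1)).[w.2] in
    open W -> (forall w, W w -> (coord c @` (bdom i `&` dom c)) w.1) ->
    holo W q -> holo W r -> (forall w, W w -> q w ^+ 2 = p w * r w) ->
    forall w, W w -> exists (W' : set (C^o * C^o)) (r' : C^o * C^o -> C),
      [/\ open W', W' w, W' `<=` W, holo W' r' &
          forall w', W' w' -> q w' = p w' * r' w'].

(* Sigma/sigma is smooth: the differential of its equation has no zero on it. *)
Definition sl2_type : Prop :=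
  forall i c x (eta : C), bdom i x -> dom c x -> root (quot_poly i c x) eta ->
    (deriv (quot_poly i c x)).[eta] != 0 \/
    cder c (fun x' => (quot_poly i c x').[eta]) x != 0.

(* Y, with pi and b2, is the Riemann surface Sigma/sigma (when the latter is
   smooth): y |-> (pi y, b2 y) is an injective immersion into the total space of
   K^2, with image that of Sigma under lambda |-> - lambda^2. *)
Definition quotient_curve (Y : riemann_surface R) (pi : Y -> X)
    (b2 : rs_ix X -> Y -> C) : Prop :=
  [/\ compact [set: Y] /\ holomorphic_map pi,
      line_section (pullback pi K) 2 b2,
      forall c y y', dom c (pi y) -> pi y = pi y' -> b2 c y = b2 c y' -> y = y',
      forall c x b, dom c x ->
        (exists y, pi y = x /\ b2 c y = b) <->
        (exists l, on_sigma c x l /\ b = - l ^+ 2) &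
      forall c d y, dom c (pi y) -> dom d y ->
        cder d (coord c \o pi) y != 0 \/ cder d (b2 c) y != 0].

(* S, with q and lam, is the normalisation of Sigma: a compact Riemann surface
   with a holomorphic map s |-> (q s, lam s) onto Sigma, injective outside a
   finite set. *)
Definition normalisation (S : riemann_surface R) (q : S -> X)
    (lam : rs_ix X -> S -> C) : Prop :=
  [/\ compact [set: S] /\ holomorphic_map q,
      line_section (pullback q K) 1 lam,
      forall c s, dom c (q s) -> on_sigma c (q s) (lam c s),
      forall c x l, on_sigma c x l -> exists s, q s = x /\ lam c s = l &
      exists B : set S, finite_set B /\
        forall c s s', ~ B s -> ~ B s' -> dom c (q s) ->
          q s = q s' -> lam c s = lam c s' -> s = s'].

Section Quotient.
Variables (Y : riemann_surface R) (pi : Y -> X) (b2 : rs_ix X -> Y -> C).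
Local Notation N := (pullback pi K).

(* A section of pi^*K^(2n-2) whose divisor is the ramification divisor of pi;
   it is unique up to a constant. *)
Definition ramification_section (del : rs_ix X -> Y -> C) : Prop :=
  line_section N (2 * n - 2) del /\
  forall c d y, dom c (pi y) -> dom d y ->
    exists m : int,
      vanish_order_fun (del c) y m /\
      vanish_order_fun (cder d (coord c \o pi)) y m.

Variables (H2 : higgs N 1) (del : rs_ix X -> Y -> C).
Local Notation E2 := (hE H2).

(* iota exhibits E_2 as ker (pi^*Phi^2 + b_2) (x) pi^*K^(n-1). *)
Definition kernel_model
    (iota : bix (twist (pullback pi E) N (n - 1)) -> bix E2 -> Y ->
            'M[C]_(n + n, 1 + 1)) : Prop :=
  kernel_bundle iota
    (fun ic y => let A := hPhi (h := H) ic ic.1 (pi y) in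
                 A *m A + (b2 ic.2 y)%:M) /\
  forall i c a y, bdom i (pi y) -> dom c (pi y) -> bdom a y ->
    hPhi (h := H) (i, c) i (pi y) *m iota (i, c) a y =
    iota (i, c) a y *m hPhi (h := H2) (a, c) a y.

(* eps exhibits (E, Phi) as pi_* (E_2 (x) pi^*K^(n-1), Phi_2), with symplectic
   form the pushforward of del^-1 times that of E_2.  The map triv picks a
   trivialisation of E_2 at each point; the summands do not depend on it. *)
Definition pushforward_model
    (eps : bix (twist E2 N (n - 1)) -> bix (pullback pi E) -> Y ->
           'M[C]_(1 + 1, n + n)) : Prop :=
  [/\ pushforward_iso eps,
      forall a c i y, bdom a y -> dom c (pi y) -> bdom i (pi y) ->
        eps (a, c) i y *m hPhi (h := H) (i, c) i (pi y) =
        hPhi (h := H2) (a, c) a y *m eps (a, c) i y &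
      forall (triv : Y -> bix E2), (forall y, bdom (triv y) y) ->
      forall i c x, ~ disc_zero x -> bdom i x -> dom c x ->
        hOmega (h := H) i x =
        \sum_(y \in pi @^-1` [set x])
          (del c y)^-1 *: ((eps (triv y, c) i y)^T *m hOmega (h := H2) (triv y) y
                            *m eps (triv y, c) i y)].

(* h = pi_* (h2 |del|^-1). *)
Definition pushforward_metric
    (eps : bix (twist E2 N (n - 1)) -> bix (pullback pi E) -> Y ->
           'M[C]_(1 + 1, n + n))
    (h2 : bix E2 -> Y -> 'M[C]_(1 + 1)) (h : bix E -> X -> 'M[C]_(n + n)) :=
  forall (triv : Y -> bix E2), (forall y, bdom (triv y) y) ->
  forall i c x, ~ disc_zero x -> bdom i x -> dom c x ->
    h i x =
    \sum_(y \in pi @^-1` [set x])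
      `|del c y|^-1 *: ((eps (triv y, c) i y)^t* *m h2 (triv y) y
                         *m eps (triv y, c) i y).

Definition b2_zero : set Y :=
  [set y | exists c, dom c (pi y) /\ b2 c y = 0].

Variables (S : riemann_surface R) (q : S -> X) (lam : rs_ix X -> S -> C).

Definition lam_zero : set S :=
  [set s | exists c, dom c (q s) /\ lam c s = 0].

(* p2 is the map S -> Sigma -> Sigma/sigma, and sig the involution of S induced
   by lambda |-> - lambda. *)
Definition normalisation_maps (p2 : S -> Y) (sig : S -> S) : Prop :=
  [/\ holomorphic_map p2, forall s, pi (p2 s) = q s,
      forall c s, dom c (q s) -> b2 c (p2 s) = - lam c s ^+ 2 &
      [/\ holomorphic_map sig, forall s, q (sig s) = q s &
          forall c s, dom c (q s) -> lam c (sig s) = - lam c s]].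

Variables (p2 : S -> Y) (sig : S -> S).

(* The twist by the 0-th power leaves p2^*E_2 unchanged; it only makes the
   trivialisation of K, needed to write lambda, part of the index. *)
Definition eigen_line (L : cocycle S 1)
    (j : bix (twist (pullback p2 E2) (pullback q K) 0) -> bix L -> S ->
         'M[C]_(1 + 1, 1)) : Prop :=
  is_bundle L /\
  kernel_bundle j
    (fun ac s => hPhi (h := H2) ac ac.1 (p2 s) - (lam ac.2 s)%:M).

(* h_L is |z|^(2 alpha_p) in a local holomorphic frame at each p, where
   2 alpha_p = Lambda_p - e D_(p2 p): Lm is the order of lambda at p, D that of
   Phi_2 at p2 p, and e the ramification index of p2 at p.  The frame is the
   given one divided by u. *)
Definition parabolic_adapted (L : cocycle S 1) (hL : bix L -> S -> 'M[C]_1) :=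
  forall p c (a : bix E2) d i (Lm D e : int),
    lam_zero p -> dom c (q p) -> bdom a (p2 p) -> dom d (p2 p) -> bdom i p ->
    vanish_order_fun (lam c) p Lm ->
    vanish_order (hPhi (h := H2) (a, c) a) (p2 p) D ->
    vanish_order_fun (fun s => coord d (p2 s) - coord d (p2 p)) p e ->
    exists (k : rs_ix S) (V : set S) (u : S -> C),
      [/\ open V, V p, V `<=` dom k `&` bdom i, hol_on V u &
          forall s, V s -> u s != 0 /\
            (s != p -> hL i s 0 0 =
               `|u s| ^+ 2 * `|coord k s - coord k p| ^ (Lm - e * D))].

(* p2^* h2 = hL (+) sig^* hL on p2^* E_2 = L (+) sig^* L, off the zeros of
   lambda. *)
Definition descends (L : cocycle S 1)
    (j : bix (twist (pullback p2 E2) (pullback q K) 0) -> bix L -> S ->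
         'M[C]_(1 + 1, 1))
    (hL : bix L -> S -> 'M[C]_1) (h2 : bix E2 -> Y -> 'M[C]_(1 + 1)) : Prop :=
  forall s a c i i', ~ lam_zero s -> bdom a (p2 s) -> dom c (q s) ->
    bdom i s -> bdom i' (sig s) ->
    let v := j (a, c) i s in
    let w := j (a, c) i' (sig s) in
    let h := h2 a (p2 s) in
    [/\ v^t* *m h *m v = hL i s, w^t* *m h *m w = hL i' (sig s) &
        w^t* *m h *m v = 0].

(* h2 is the metric on E_2 off Z(b_2) constructed from the eigen line bundle
   L = ker (p2^*Phi_2 - lambda).  The constant in h_L is fixed by the
   compatibility of h2 with the symplectic form of E_2, i.e. with the
   trivialisation of det E_2. *)
Definition eigen_line_metric (h2 : bix E2 -> Y -> 'M[C]_(1 + 1)) : Prop :=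
  exists (L : cocycle S 1)
    (j : bix (twist (pullback p2 E2) (pullback q K) 0) -> bix L -> S ->
         'M[C]_(1 + 1, 1)) (hL : bix L -> S -> 'M[C]_1),
    [/\ eigen_line j,
        hermitian_metric (~` lam_zero) hL /\ chern_flat (~` lam_zero) hL,
        parabolic_adapted hL, descends j hL h2 &
        sp_compatible (~` b2_zero) h2].

End Quotient.
End Spectral.

(* Main.v *)
(* Off the discriminant, omega is a sum over the fibre of pi of forms of rank
   at most 2, while the fibre injects into the roots of a polynomial of degree
   n.  As omega has rank 2n, the fibre has exactly n points, del does not vanish
   on it (so that pi is unramified there), and eps identifies E_x with the
   direct sum of the fibres of E_2.  In the resulting frames the metric, the
   symplectic form and the Higgs field are block-diagonal, which gives the
   normality of the Higgs field and the symplectic compatibility: a square root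
   of del turns unitary Darboux frames of E_2 into such frames of E.

   For the curvature, pi has local holomorphic sections, and in their frames
   h = A^* K A with A holomorphic and K block-diagonal with blocks
   |del|^-1 h_2.  Then h^-1 dh = A^-1 (K^-1 dK) A + A^-1 dA, and the blocks of
   K^-1 dK are h_2^-1 dh_2 - (1/2) del'/del, so everything is killed by dbar. *)
From mathcomp Require Import all_boot all_order all_algebra.
From mathcomp Require Import perm complex spectral ring lra.
From mathcomp Require Import boolp classical_sets functions.
From mathcomp Require Import fsbigop reals topology normedtype derive realfun.
Require Import Defs.
Set Implicit Arguments.
Unset Strict Implicit.
Unset Printing Implicit Defensive.
Import Order.TTheory GRing.Theory Num.Theory.
Import numFieldNormedType.Exports.
Local Open Scope classical_set_scope.
Local Open Scope sesquilinear_scope.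
Local Open Scope ring_scope.

(** * Complex numbers as pairs of reals *)

(** A Hermitian metric is not holomorphic, so its curvature has to be computed in real calculus:
    real directional derivatives, C^k classes closed under the operations in use, and the two
    Wirtinger operators, with holomorphic meaning smooth and killed by d''. What is needed of
    complex analysis then has elementary proofs: d' of a holomorphic function is holomorphic because
    mixed derivatives commute, and local sections of [pi] come from an inverse function theorem.

    The weights fit together for one reason. A change of chart of X with derivative g multiplies
    [eps] by g^(n-1) and [del] by g^(2n-2), so that the factors cancel in each term of the sum over
    a fibre, with moduli for the metric.

    To pass from a point to a neighbourhood, note that [b2] separates the n local sections of [pi]
    at the centre, hence nearby. As no fibre has more than n points, the sections exhaust the nearby
    fibres, and the local formula for the metric holds on a whole neighbourhood without first
    showing that the discriminant locus is closed. *)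

Section ComplexNumbers.
Variable R : realType.
Local Notation C := (Cplx R).
Implicit Types z w : C.

Lemma part_ext z w : part_re z = part_re w -> part_im z = part_im w -> z = w.
Proof. by case: z w => a b [c d] /= -> ->. Qed.

Lemma part_reD z w : part_re (z + w) = part_re z + part_re w.
Proof. by case: z w => a b [c d]. Qed.
Lemma part_imD z w : part_im (z + w) = part_im z + part_im w.
Proof. by case: z w => a b [c d]. Qed.
Lemma part_reN z : part_re (- z) = - part_re z.
Proof. by case: z. Qed.
Lemma part_imN z : part_im (- z) = - part_im z.
Proof. by case: z. Qed.
Lemma part_reM z w :
  part_re (z * w) = part_re z * part_re w - part_im z * part_im w.
Proof. by case: z w => a b [c d]. Qed.
Lemma part_imM z w :
  part_im (z * w) = part_re z * part_im w + part_im z * part_re w.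
Proof. by case: z w => a b [c d]. Qed.
Lemma part_re_of (t : R) : part_re (of_real t) = t. Proof. by []. Qed.
Lemma part_im_of (t : R) : part_im (of_real t) = 0. Proof. by []. Qed.
Lemma part_re1 : part_re (1 : C) = 1. Proof. by []. Qed.
Lemma part_im1 : part_im (1 : C) = 0. Proof. by []. Qed.
Lemma part_re0 : part_re (0 : C) = 0. Proof. by []. Qed.
Lemma part_im0 : part_im (0 : C) = 0. Proof. by []. Qed.
Lemma imaginaryE : ('i : C) = (0 +i* 1)%C.
Proof. by []. Qed.
Lemma part_rei : part_re ('i : C) = 0. Proof. by rewrite imaginaryE. Qed.
Lemma part_imi : part_im ('i : C) = 1. Proof. by rewrite imaginaryE. Qed.
Lemma part_reJ z : part_re z^* = part_re z. Proof. by case: z. Qed.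
Lemma part_imJ z : part_im z^* = - part_im z. Proof. by case: z. Qed.

Definition partE := (part_reD, part_imD, part_reN, part_imN, part_reM, part_imM,
  part_re_of, part_im_of, part_re1, part_im1, part_re0, part_im0,
  part_rei, part_imi, part_reJ, part_imJ).

Lemma of_realD (s t : R) : of_real (s + t) = of_real s + of_real t.
Proof. by apply: part_ext; rewrite !partE //; lra. Qed.
Lemma of_realM (s t : R) : of_real (s * t) = of_real s * of_real t.
Proof. by apply: part_ext; rewrite !partE //; lra. Qed.
Lemma of_real0 : of_real (0 : R) = 0. Proof. by []. Qed.
Lemma of_real1 : of_real (1 : R) = 1. Proof. by []. Qed.
Lemma of_real2 : of_real (2 : R) = 2.
Proof. by apply: part_ext; rewrite //= addr0. Qed.
Lemma of_realV2 : of_real (2^-1 : R) = 2^-1.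
Proof.
have h : of_real (2^-1 : R) * 2 = 1 by rewrite -of_real2 -of_realM mulVf // pnatr_eq0.
by apply: (@mulIf _ 2); rewrite ?pnatr_eq0 // h mulVf // pnatr_eq0.
Qed.
Lemma partsK z : of_real (part_re z) + of_real (part_im z) * 'i = z.
Proof. by apply: part_ext; rewrite !partE; lra. Qed.

(* The l1 norm: equivalent to the modulus, but with values in R instead of C. *)
Definition nrm z : R := `|part_re z| + `|part_im z|.

Lemma nrm_ge0 z : 0 <= nrm z. Proof. by rewrite addr_ge0. Qed.
Lemma nrm0 : nrm 0 = 0. Proof. by rewrite /nrm !partE !normr0 addr0. Qed.
Lemma nrm_eq0 z : nrm z <= 0 -> z = 0.
Proof.
rewrite /nrm => h; have h1 := normr_ge0 (part_re z); have h2 := normr_ge0 (part_im z).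
by apply: part_ext; rewrite partE; apply/eqP; rewrite -normr_eq0; apply/eqP; lra.
Qed.
Lemma nrmD z w : nrm (z + w) <= nrm z + nrm w.
Proof.
rewrite /nrm !partE.
have := ler_normD (part_re z) (part_re w); have := ler_normD (part_im z) (part_im w); lra.
Qed.
Lemma nrmN z : nrm (- z) = nrm z.
Proof. by rewrite /nrm !partE !normrN. Qed.
Lemma nrmB z w : nrm (z - w) <= nrm z + nrm w.
Proof. by rewrite -(nrmN w) nrmD. Qed.
Lemma nrmC z w : nrm (z - w) = nrm (w - z).
Proof. by rewrite -nrmN opprB. Qed.
Lemma nrmM z w : nrm (z * w) <= nrm z * nrm w.
Proof.
rewrite /nrm !partE.
have h1 := ler_normB (part_re z * part_re w) (part_im z * part_im w).
have h2 := ler_normD (part_re z * part_im w) (part_im z * part_re w).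
rewrite !normrM in h1 h2; nra.
Qed.
Lemma nrm_of (t : R) : nrm (of_real t) = `|t|.
Proof. by rewrite /nrm !partE normr0 addr0. Qed.
Lemma nrm_ofM (t : R) z : nrm (of_real t * z) = `|t| * nrm z.
Proof. by rewrite /nrm !partE !mul0r subr0 addr0 !normrM mulrDr. Qed.
Lemma nrm_re z : `|part_re z| <= nrm z. Proof. by rewrite lerDl. Qed.
Lemma nrm_im z : `|part_im z| <= nrm z. Proof. by rewrite lerDr. Qed.
Lemma nrm_gt0 z : z != 0 -> 0 < nrm z.
Proof. by move=> z0; rewrite ltNge; apply: contraNN z0 => /nrm_eq0 ->. Qed.

Lemma normCE z : `|z| = of_real (Num.sqrt (part_re z ^+ 2 + part_im z ^+ 2)).
Proof. by case: z. Qed.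

Lemma lt_of_real (s t : R) : (of_real s < of_real t) = (s < t).
Proof. exact: ltcR. Qed.

Lemma norm_le_nrm z : `|z| <= of_real (nrm z).
Proof.
rewrite -{1}(partsK z) (le_trans (ler_normD _ _)) // of_realD normrM.
have -> : `|'i : C| = 1 by exact: normCi.
by rewrite mulr1 !normCE !partE expr0n /= !addr0 !sqrtr_sqr.
Qed.

Lemma nrm_le_norm z : of_real (nrm z) <= 2 * `|z|.
Proof.
rewrite normCE -of_real2.
rewrite -of_realM lecR /nrm.
set x := part_re z; set y := part_im z.
have hx : `|x| <= Num.sqrt (x ^+ 2 + y ^+ 2).
  by rewrite -sqrtr_sqr ler_wsqrtr // lerDl sqr_ge0.
have hy : `|y| <= Num.sqrt (x ^+ 2 + y ^+ 2).
  by rewrite -sqrtr_sqr ler_wsqrtr // lerDr sqr_ge0.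
lra.
Qed.

(** The balls of C have radii in C. Positivity forces such a radius to be real, and the two
    comparisons of [nrm] with the modulus then trade it for a real l1 radius, at the cost of a
    factor 2. *)
Lemma near_nrm (z : C) (P : C -> Prop) :
  (\forall w \near z, P w) <->
  exists2 d : R, 0 < d & forall w, nrm (w - z) < d -> P w.
Proof.
split.
  move=> /nbhs_ballP[e /= e0 he].
  have he' : e = of_real (part_re e).
    by apply: part_ext => //; rewrite partE; move: e0; rewrite ltcE /= => /andP[/eqP].
  exists (part_re e); first by rewrite he' -of_real0 lt_of_real in e0.
  move=> w hw; apply: he; rewrite /ball /= distrC.
  by rewrite (le_lt_trans (norm_le_nrm _)) // he' lt_of_real.
move=> [d d0 hd]; apply/nbhs_ballP; exists (of_real (d / 2)) => /=.
  by rewrite -of_real0 lt_of_real divr_gt0.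
move=> w; rewrite /ball /= distrC => hw; apply: hd.
rewrite -lt_of_real (le_lt_trans (nrm_le_norm _)) //.
have -> : of_real d = 2 * of_real (d / 2).
  rewrite -of_real2.
  by rewrite -of_realM mulrCA divff ?mulr1 // pnatr_eq0.
by rewrite ltr_pM2l.
Qed.

Lemma near0_normr (P : R -> Prop) :
  (\forall t \near (0 : R), P t) <->
  exists2 d : R, 0 < d & forall t, `|t| < d -> P t.
Proof.
split.
  move=> /nbhs_ballP[e /= e0 he]; exists e => // t ht; apply: he.
  by rewrite /ball /= sub0r normrN.
move=> [d d0 hd]; apply/nbhs_ballP; exists d => //= t.
by rewrite /ball /= sub0r normrN => /hd.
Qed.

Lemma continuous_nrm (f : C -> C) (z : C) :
  {for z, continuous f} <->
  forall e : R, 0 < e ->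
    exists2 d : R, 0 < d & forall w, nrm (w - z) < d -> nrm (f w - f z) < e.
Proof.
split=> [cf e e0|h].
  have hb : nbhs (f z) [set w | nrm (w - f z) < e] by apply/near_nrm; exists e.
  by have /near_nrm := cf _ hb.
move=> B /near_nrm[e e0 he]; apply/near_nrm.
by have [d d0 hd] := h _ e0; exists d => // w /hd /he.
Qed.

End ComplexNumbers.

(** * Directional derivatives and C^k functions *)

Section DirectionalDerivatives.
Variable R : realType.
Local Notation C := (Cplx R).
Implicit Types (f g : C -> C) (z v d : C).

(** The error is compared with [e * |t|] instead of dividing by t, so that t = 0 is not exceptional
    and later estimates are linear inequalities. *)
Lemma is_derive_epsP (phi : R -> R) (x l : R) :
  is_derive x 1 phi l <->
  forall e : R, 0 < e -> exists2 a : R, 0 < a &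
    forall t, `|t| < a -> `|phi (x + t) - phi x - t * l| <= e * `|t|.
Proof.
split.
  move=> [dphi <-] e e0.
  have /cvgrPdist_le/(_ e e0) := dphi.
  rewrite near_withinE => /near0_normr[a a0 ha]; exists a => // t ta.
  have [->|t0] := eqVneq t 0; first by rewrite addr0 subrr mul0r subr0 normr0 mulr0.
  have := ha t ta t0; rewrite /= -/(derive phi x 1) => h.
  have -> : phi (x + t) - phi x - t * 'D_1 phi x
      = - (t * ('D_1 phi x - t^-1 * (phi (t * 1 + x) - phi x))).
    by rewrite mulr1 (addrC t x); field.
  by rewrite normrN normrM mulrC ler_wpM2r.
move=> h.
have hl : (fun t => t^-1 *: ((phi \o shift x) (t *: 1) - phi x)) @ 0^' --> l.
  apply/cvgrPdist_le => e e0; rewrite near_withinE; apply/near0_normr.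
  have [a a0 ha] := h e e0; exists a => // t ta t0.
  rewrite -(ler_pM2l (_ : 0 < `|t|)) ?normr_gt0 // -normrM -normrN.
  have -> : - (t * (l - t^-1 *: ((phi \o shift x) (t *: 1) - phi x)))
      = phi (x + t) - phi x - t * l.
    by rewrite /= /GRing.scale /= mulr1 (addrC t x); field.
  by rewrite [leRHS]mulrC ha.
by apply: DeriveDef; [apply/cvg_ex; exists l | apply: cvg_lim hl; exact: norm_hausdorff].
Qed.

(** Relational form of [dir_derivable] and [dir_deriv] together: since the value d is explicit, the
    rules of calculus compose without separate differentiability conditions. *)
Definition is_dd f v z d : Prop :=
  is_derive (0 : R) (1 : R) (fun t : R => part_re (f (z + of_real t * v))) (part_re d) /\
  is_derive (0 : R) (1 : R) (fun t : R => part_im (f (z + of_real t * v))) (part_im d).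

Lemma is_ddP f v z d : is_dd f v z d <->
  forall e : R, 0 < e -> exists2 a : R, 0 < a & forall t, `|t| < a ->
    nrm (f (z + of_real t * v) - f z - of_real t * d) <= e * `|t|.
Proof.
split.
  move=> [/is_derive_epsP h1 /is_derive_epsP h2] e e0.
  have [a a0 ha] := h1 (e / 2) (divr_gt0 e0 (ltr0Sn R 1)).
  have [b b0 hb] := h2 (e / 2) (divr_gt0 e0 (ltr0Sn R 1)).
  exists (Order.min a b) => [|t]; first by rewrite lt_min a0.
  rewrite lt_min => /andP[/ha + /hb]; rewrite !add0r !of_real0 !mul0r !addr0 /nrm !partE.
  rewrite !mul0r !subr0 addr0; lra.
move=> h; split; apply/is_derive_epsP => e e0; have [a a0 ha] := h e e0;
  exists a => // t /ha; rewrite add0r of_real0 mul0r addr0; apply: le_trans.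
  by apply: le_trans (nrm_re _); rewrite !partE mul0r subr0.
by apply: le_trans (nrm_im _); rewrite !partE mul0r addr0.
Qed.

Lemma is_dd_dir_derivable f v z d : is_dd f v z d ->
  dir_derivable (V := C^o) f v z /\ dir_deriv (V := C^o) v f z = d.
Proof.
move=> [h1 h2]; split; first by split; apply: ex_derive.
rewrite /dir_deriv !derive1E; have [_ ->] := h1; have [_ ->] := h2.
by rewrite mulrC partsK.
Qed.

Lemma dir_derivable_is_dd f v z :
  dir_derivable (V := C^o) f v z -> is_dd f v z (dir_deriv (V := C^o) v f z).
Proof.
move=> [h1 h2]; rewrite /dir_deriv !derive1E; split.
  by apply: DeriveDef => //; rewrite !partE !mul0r mul1r subr0 addr0.
by apply: DeriveDef => //; rewrite !partE mul0r mul1r !add0r.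
Qed.

Lemma is_dd_eq f v z d d' : is_dd f v z d -> d = d' -> is_dd f v z d'.
Proof. by move=> h <-. Qed.

Lemma near_line (P : C -> Prop) z v : (\forall w \near z, P w) ->
  exists2 a : R, 0 < a & forall t, `|t| < a -> P (z + of_real t * v).
Proof.
move=> /near_nrm[e e0 he].
(* The + 1 keeps the denominator positive when v = 0; the same device recurs below. *)
have n0 : 0 < nrm v + 1 by rewrite ltr_wpDl // nrm_ge0.
exists (e / (nrm v + 1)) => [|t]; first exact: divr_gt0.
rewrite ltr_pdivlMr // => ht; apply: he; rewrite addrC addKr nrm_ofM.
apply: le_lt_trans ht; rewrite ler_wpM2l //; lra.
Qed.

Lemma is_dd_near f g v z d :
  (\forall w \near z, f w = g w) -> is_dd f v z d -> is_dd g v z d.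
Proof.
move=> fg /is_ddP h; apply/is_ddP => e e0.
have [a a0 ha] := h e e0; have [b b0 hb] := near_line v fg.
exists (Order.min a b) => [|t]; first by rewrite lt_min a0.
rewrite lt_min => /andP[/ha + /hb <-].
(* At t = 0 the agreement near z gives [f z = g z], the other term of the difference. *)
by have := hb 0; rewrite normr0 of_real0 mul0r addr0 => <-.
Qed.

Lemma is_dd_cst (c : C) v z : is_dd (fun=> c) v z 0.
Proof. by split; exact: is_derive_cst. Qed.

Lemma is_dd_id v z : is_dd id v z v.
Proof.
apply/is_ddP => e e0; exists 1 => // t _.
by rewrite /= (addrC z) addrK subrr nrm0 mulr_ge0 // ltW.
Qed.

Lemma is_ddD f g v z d d' :
  is_dd f v z d -> is_dd g v z d' -> is_dd (fun w => f w + g w) v z (d + d').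
Proof.
move=> [h1 h2] [h3 h4]; split; rewrite !partE.
  have := is_deriveD h1 h3; congr (is_derive _ _ _ _).
  by apply/funext => t /=; rewrite partE.
have := is_deriveD h2 h4; congr (is_derive _ _ _ _).
by apply/funext => t /=; rewrite partE.
Qed.

Lemma is_ddM f g v z d d' : is_dd f v z d -> is_dd g v z d' ->
  is_dd (fun w => f w * g w) v z (d * g z + f z * d').
Proof.
move=> [h1 h2] [h3 h4]; split.
  have := is_deriveB (is_deriveM h1 h3) (is_deriveM h2 h4).
  rewrite !of_real0 !mul0r !addr0 !partE => h.
  have -> : (fun t => part_re (f (z + of_real t * v) * g (z + of_real t * v)))
     = (fun t => part_re (f (z + of_real t * v))) * (fun t => part_re (g (z + of_real t * v)))
     - (fun t => part_im (f (z + of_real t * v))) * (fun t => part_im (g (z + of_real t * v))).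
    by apply/funext => t /=; rewrite partE.
  by apply: is_derive_eq h _; rewrite /GRing.scale /=; ring.
have := is_deriveD (is_deriveM h1 h4) (is_deriveM h2 h3).
rewrite !of_real0 !mul0r !addr0 !partE => h.
have -> : (fun t => part_im (f (z + of_real t * v) * g (z + of_real t * v)))
   = (fun t => part_re (f (z + of_real t * v))) * (fun t => part_im (g (z + of_real t * v)))
   + (fun t => part_im (f (z + of_real t * v))) * (fun t => part_re (g (z + of_real t * v))).
  by apply/funext => t /=; rewrite partE.
by apply: is_derive_eq h _; rewrite /GRing.scale /=; ring.
Qed.

Lemma is_dd_conj f v z d : is_dd f v z d -> is_dd (fun w => (f w)^*) v z d^*.
Proof.
move=> [h1 h2]; split; rewrite !partE.
  by congr (is_derive _ _ _ _): h1; apply/funext => t; rewrite partE.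
have := is_deriveN h2; congr (is_derive _ _ _ _).
by apply/funext => t /=; rewrite partE.
Qed.

Lemma is_ddV f v z d : f z != 0 -> is_dd f v z d ->
  is_dd (fun w => (f w)^-1) v z (- d / f z ^+ 2).
Proof.
move=> f0 [h1 h2].
apply: (@is_dd_eq _ _ _ (- d * (f z)^-1 * (f z)^-1)); last by rewrite expr2 invfM mulrA.
have sq0 : part_re (f z) ^+ 2 + part_im (f z) ^+ 2 != 0.
  rewrite paddr_eq0 ?sqr_ge0 // !sqrf_eq0; apply: contraNN f0 => /andP[/eqP a /eqP b].
  by apply/eqP/part_ext.
have h3 := is_deriveD (is_deriveM h1 h1) (is_deriveM h2 h2).
(* [N] is the squared modulus of f along the line, the common denominator of both parts of 1/f. *)
set N := (N in is_derive _ _ N _) in h3.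
have N0 : N 0 != 0.
  by rewrite /N /= !fctE of_real0 mul0r addr0 -!expr2.
have iV := is_deriveV N0 h3.
have reV (w : C) : part_re w^-1 = part_re w / (part_re w ^+ 2 + part_im w ^+ 2).
  by case: w.
have imV (w : C) : part_im w^-1 = - part_im w / (part_re w ^+ 2 + part_im w ^+ 2).
  by case: w => a b /=; rewrite mulNr.
have iN : N = fun t => part_re (f (z + of_real t * v)) ^+ 2 + part_im (f (z + of_real t *
    v)) ^+ 2.
  by apply/funext => t; rewrite /N !fctE -!expr2.
split.
  have h := is_deriveM h1 iV; rewrite iN in h.
  have -> : (fun t => part_re (f (z + of_real t * v))^-1)
     = (fun t => part_re (f (z + of_real t * v))) *
       (fun t => (part_re (f (z + of_real t * v)) ^+ 2 + part_im (f (z + of_real t * v)) ^+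
           2)^-1).
    by apply/funext => t /=; rewrite reV.
  apply: is_derive_eq h _; rewrite /= !of_real0 !mul0r !addr0 /GRing.scale /=.
  rewrite !(partE, reV, imV).
  by field.
have h := is_deriveM (is_deriveN h2) iV; rewrite iN in h.
have -> : (fun t => part_im (f (z + of_real t * v))^-1)
   = (- (fun t => part_im (f (z + of_real t * v)))) *
     (fun t => (part_re (f (z + of_real t * v)) ^+ 2 + part_im (f (z + of_real t * v)) ^+ 2)^-1).
  by apply/funext => t /=; rewrite imV.
apply: is_derive_eq h _; rewrite /= !fctE !of_real0 !mul0r !addr0 /GRing.scale /=.
rewrite !(partE, reV, imV).
by field.
Qed.

(** The modulus is the square root of re^2 + im^2, positive at z. The derivative is written with
    conjugates and an inverse only, so that the closure rules for C^k apply to it again. *)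
Lemma is_dd_norm f v z d : f z != 0 -> is_dd f v z d ->
  is_dd (fun w => `|f w|) v z ((d * (f z)^* + f z * d^*) / (2 * `|f z|)).
Proof.
move=> f0 [h1 h2].
have sq0 : 0 < part_re (f z) ^+ 2 + part_im (f z) ^+ 2.
  rewrite lt_def addr_ge0 ?sqr_ge0 // andbT.
  rewrite paddr_eq0 ?sqr_ge0 // !sqrf_eq0; apply: contraNN f0 => /andP[/eqP a /eqP b].
  by apply/eqP/part_ext.
have h3 := is_deriveD (is_deriveM h1 h1) (is_deriveM h2 h2).
set N := (N in is_derive _ _ N _) in h3.
have N0 : 0 < N 0.
  by rewrite /N /= !fctE of_real0 mul0r addr0 -!expr2.
have h4 := is_derive1_comp (is_derive1_sqrt N0) h3.
have -> : (d * (f z)^* + f z * d^*) / (2 * `|f z|) =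
   of_real ((part_re d * part_re (f z) + part_im d * part_im (f z)) / Num.sqrt (part_re (f
       z) ^+ 2 + part_im (f z) ^+ 2)).
  have s0 : `|f z| != 0 by rewrite normr_eq0.
  have s0' : Num.sqrt (part_re (f z) ^+ 2 + part_im (f z) ^+ 2) != 0.
    by rewrite sqrtr_eq0 -ltNge.
  apply: (@mulIf _ (2 * `|f z|)); first by rewrite mulf_neq0 // pnatr_eq0.
  rewrite divfK ?mulf_neq0 ?pnatr_eq0 // normCE.
  rewrite -of_real2.
  rewrite -!of_realM; apply: part_ext; rewrite !partE; last by ring.
  by field.
split; rewrite partE.
  have -> : (fun t => part_re `|f (z + of_real t * v)|) = Num.sqrt \o N.
    by apply/funext => t; rewrite normCE partE /= /N !fctE !expr2.
  apply: is_derive_eq h4 _; rewrite /= /N !fctE !of_real0 !mul0r !addr0 -!expr2 /GRing.scale /=.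
  by field; rewrite sqrtr_eq0 -ltNge.
have -> : (fun t => part_im `|f (z + of_real t * v)|) = cst 0.
  by apply/funext => t; rewrite normCE partE.
exact: is_derive_cst.
Qed.

Lemma is_dd_scale f v z d (s : R) :
  is_dd f v z d -> is_dd f (of_real s * v) z (of_real s * d).
Proof.
move=> /is_ddP h; apply/is_ddP => e e0.
have n0 : 0 < `|s| + 1 by rewrite ltr_wpDl.
have [a a0 ha] := h _ (divr_gt0 e0 n0); exists (a / (`|s| + 1)) => [|t]; first exact: divr_gt0.
rewrite ltr_pdivlMr // => ht.
have hts : `|t * s| < a by rewrite normrM; apply: le_lt_trans ht; rewrite ler_wpM2l //; lra.
have := ha _ hts; rewrite of_realM -2!(mulrA (of_real t)) => h1; apply: (le_trans h1).
rewrite mulrAC ler_pdivrMr // normrM -mulrA ler_wpM2l ?(ltW e0) // ler_wpM2l //; lra.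
Qed.

(** Recentring: a directional derivative at the point reached at time x is an ordinary derivative at
    time x of the two parts along the line. *)
Lemma path_derive f v z d (x : R) : is_dd f v (z + of_real x * v) d ->
  is_derive x (1 : R) (fun t : R => part_re (f (z + of_real t * v))) (part_re d) /\
  is_derive x (1 : R) (fun t : R => part_im (f (z + of_real t * v))) (part_im d).
Proof.
move=> /is_ddP h; split; apply/is_derive_epsP => e e0; have [a a0 ha] := h e e0;
  exists a => // t /ha; apply: le_trans; rewrite of_realD mulrDl addrA.
  by apply: le_trans (nrm_re _); rewrite !partE mul0r subr0.
by apply: le_trans (nrm_im _); rewrite !partE mul0r addr0.
Qed.

Lemma MVT_unit (phi dphi : R -> R) :
  (forall x : R, 0 <= x <= 1 -> is_derive x (1 : R) phi (dphi x)) ->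
  exists2 x : R, 0 <= x <= 1 & phi 1 - phi 0 = dphi x.
Proof.
move=> h.
have hd (x : R) : x \in `]0, 1[%R -> is_derive x (1 : R) phi (dphi x).
  by rewrite in_itv /= => /andP[x0 x1]; apply: h; rewrite !ltW.
have hc : {within `[(0:R), (1:R)]%classic, continuous phi}.
  apply: derivable_within_continuous => x; rewrite in_itv /= => x01.
  by have [] := h x x01.
have [x x01 e] := MVT_segment ler01 hd hc; exists x; first by rewrite in_itv in x01.
by rewrite e subr0 mulr1.
Qed.

(** The mean value theorem fails for complex values, so each part gets its own intermediate
    point. *)
Lemma path_MVT f v z (D : C -> C) :
  (forall x : R, 0 <= x <= 1 -> is_dd f v (z + of_real x * v) (D (z + of_real x * v))) ->
  (exists2 x : R, 0 <= x <= 1 &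
     part_re (f (z + v)) - part_re (f z) = part_re (D (z + of_real x * v))) /\
  (exists2 x : R, 0 <= x <= 1 &
     part_im (f (z + v)) - part_im (f z) = part_im (D (z + of_real x * v))).
Proof.
move=> h.
have h1 (x : R) (x01 : 0 <= x <= 1) := (path_derive (h x x01)).1.
have h2 (x : R) (x01 : 0 <= x <= 1) := (path_derive (h x x01)).2.
have [x x01 e1] := MVT_unit h1; have [y y01 e2] := MVT_unit h2.
rewrite of_real0 mul0r addr0 of_real1 mul1r in e1 e2.
by split; [exists x | exists y].
Qed.

End DirectionalDerivatives.

Section SmoothFunctions.
Variable R : realType.
Local Notation C := (Cplx R).
Local Notation Ck := (@Ck R (Cplx R)^o).
Local Notation dd := (@dir_deriv R (Cplx R)^o).
Implicit Types (f g : C -> C) (z v : C) (U W : set C) (k : nat).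

Lemma continuousD_at f g z : {for z, continuous f} -> {for z, continuous g} ->
  {for z, continuous (fun w => f w + g w)}.
Proof. move=> cf cg; exact: (@continuousD C C _ f g z cf cg). Qed.
Lemma continuousM_at f g z : {for z, continuous f} -> {for z, continuous g} ->
  {for z, continuous (fun w => f w * g w)}.
Proof. move=> cf cg; exact: (@continuousM C C f g z cf cg). Qed.
Lemma continuousV_at f z : f z != 0 -> {for z, continuous f} ->
  {for z, continuous (fun w => (f w)^-1)}.
Proof. move=> f0 cf; exact: (@continuousV C C f z f0 cf). Qed.
Lemma continuous_norm_at f z : {for z, continuous f} ->
  {for z, continuous (fun w => `|f w|)}.
Proof. move=> cf; exact: (@continuous_comp C C C f (@Num.norm C C) z cf (@norm_continuous C
    C^o _)). Qed.

Lemma Ck_continuous k U f z : Ck k U f -> U z -> {for z, continuous f}.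
Proof. by case: k => [h|k [h _]] /h. Qed.

Lemma Ck_is_dd k U f v z : Ck k.+1 U f -> U z -> is_dd f v z (dd v f z).
Proof. by move=> [_ /(_ v)[h _]] /h; exact: dir_derivable_is_dd. Qed.

Lemma Ck_dd k U f v : Ck k.+1 U f -> Ck k U (dd v f).
Proof. by move=> [_ /(_ v)[]]. Qed.

Lemma Ck_pred k U f : Ck k.+1 U f -> Ck k U f.
Proof.
elim: k f => [|k IH] f [h1 h2] //; split=> // v; have [h3 h4] := h2 v; split=> //.
exact: IH.
Qed.

(** As U is open, agreement on U is agreement near each of its points; continuity and directional
    derivatives then transfer, and so do the derivatives themselves by induction. *)
Lemma Ck_ext k U f g : open U -> (forall z, U z -> f z = g z) -> Ck k U f -> Ck k U g.
Proof.
move=> oU; have near_eq f' g' : (forall z, U z -> f' z = g' z) ->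
    forall z, U z -> \forall w \near z, f' w = g' w.
  move=> fg z Uz; have : \forall w \near z, U w by apply: open_nbhs_nbhs.
  by apply: filterS => w /fg.
have ct f' g' : (forall z, U z -> f' z = g' z) -> forall z, U z ->
    {for z, continuous f'} -> {for z, continuous g'}.
  move=> fg z Uz /continuous_nrm h; apply/continuous_nrm => e /h[d d0 hd].
  have /near_nrm[d' d'0 hd'] := near_eq _ _ fg z Uz.
  exists (Order.min d d') => [|w]; first by rewrite lt_min d0.
  by rewrite lt_min -(fg z Uz) => /andP[/hd ? /hd' <-].
elim: k f g => [|k IH] f g fg.
  by move=> h z Uz; apply: ct (h z Uz).
move=> [h1 h2]; split=> [z Uz|v]; first by apply: ct (h1 z Uz).
have [h3 h4] := h2 v.
have hd z : U z -> is_dd g v z (dd v f z).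
  move=> Uz; apply: is_dd_near (dir_derivable_is_dd (h3 z Uz)); exact: near_eq.
split=> [z /hd/is_dd_dir_derivable[]//|].
by apply: IH h4 => z /hd/is_dd_dir_derivable[].
Qed.

(** The induction step of all closure rules: regularity is checked on an explicit formula [D] for
    the derivatives instead of on [dir_deriv]. *)
Lemma CkS_intro k U f (D : C -> C -> C) : open U ->
  (forall z, U z -> {for z, continuous f}) ->
  (forall v z, U z -> is_dd f v z (D v z)) -> (forall v, Ck k U (D v)) ->
  Ck k.+1 U f.
Proof.
move=> oU h1 h2 h3; split=> // v; split=> [z /(h2 v)/is_dd_dir_derivable[]//|].
by apply: Ck_ext (h3 v) => // z /(h2 v)/is_dd_dir_derivable[].
Qed.

Lemma Ck_sub k U W f : W `<=` U -> Ck k U f -> Ck k W f.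
Proof.
move=> WU; elim: k f => [|k IH] f; first by move=> h z /WU /h.
move=> [h1 h2]; split=> [z /WU /h1//|v]; have [h3 h4] := h2 v.
by split=> [z /WU /h3//|]; exact: IH.
Qed.

(** All clauses of [Ck] are conditions at single points of the ambient plane, so they can be checked
    in a set that depends on the point. *)
Lemma Ck_local k U f :
  (forall z, U z -> exists2 W, W z & Ck k W f) -> Ck k U f.
Proof.
elim: k f => [|k IH] f h; first by move=> z /h[W Wz /(_ z Wz)].
split=> [z /h[W Wz [/(_ z Wz)]]//|v]; split=> [z /h[W Wz [_ /(_ v)[/(_ z Wz)]]]//|].
by apply: IH => z /h[W Wz [_ /(_ v)[_]]]; exists W.
Qed.

Lemma Ck_cst k U (c : C) : open U -> Ck k U (fun=> c).
Proof.
move=> oU; elim: k c => [|k IH] c; first by move=> z _; exact: cst_continuous.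
apply: (CkS_intro (D := fun _ _ => 0)) => // [z _|v z _]; first exact: cst_continuous.
exact: is_dd_cst.
Qed.

Lemma Ck_id k U : open U -> Ck k U id.
Proof.
move=> oU; case: k => [|k]; first by move=> z _; exact: cvg_id.
apply: (CkS_intro (D := fun v _ => v)) => // [z _|v z _|v]; first exact: cvg_id.
  exact: is_dd_id.
exact: Ck_cst.
Qed.

Lemma CkD k U f g : open U -> Ck k U f -> Ck k U g -> Ck k U (fun z => f z + g z).
Proof.
move=> oU; elim: k f g => [|k IH] f g hf hg.
  by move=> z Uz; apply: continuousD_at; [exact: hf|exact: hg].
apply: (CkS_intro (D := fun v z => dd v f z + dd v g z)) => // [z Uz|v z Uz|v].
- by apply: continuousD_at; [exact: (Ck_continuous hf)|exact: (Ck_continuous hg)].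
- by apply: is_ddD; [exact: (Ck_is_dd _ hf)|exact: (Ck_is_dd _ hg)].
- by apply: IH; exact: Ck_dd.
Qed.

Lemma CkM k U f g : open U -> Ck k U f -> Ck k U g -> Ck k U (fun z => f z * g z).
Proof.
move=> oU; elim: k f g => [|k IH] f g hf hg.
  by move=> z Uz; apply: continuousM_at; [exact: hf|exact: hg].
apply: (CkS_intro (D := fun v z => dd v f z * g z + f z * dd v g z)) => // [z Uz|v z Uz|v].
- by apply: continuousM_at; [exact: (Ck_continuous hf)|exact: (Ck_continuous hg)].
- by apply: is_ddM; [exact: (Ck_is_dd _ hf)|exact: (Ck_is_dd _ hg)].
- by apply: CkD => //; apply: IH; try exact: Ck_dd; exact: Ck_pred.
Qed.

Lemma CkN k U f : open U -> Ck k U f -> Ck k U (fun z => - f z).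
Proof.
move=> oU hf; apply: (Ck_ext (f := fun z => (-1) * f z)) => // [z _|]; first by rewrite mulN1r.
by apply: CkM => //; exact: Ck_cst.
Qed.

Lemma continuous_conj f z : {for z, continuous f} -> {for z, continuous (fun w => (f w)^*)}.
Proof.
move=> /continuous_nrm h; apply/continuous_nrm => e /h[d d0 hd]; exists d => // w /hd.
by rewrite /nrm !partE -opprD normrN.
Qed.

Lemma Ck_conj k U f : open U -> Ck k U f -> Ck k U (fun z => (f z)^*).
Proof.
move=> oU; elim: k f => [|k IH] f hf.
  by move=> z Uz; apply: continuous_conj; exact: hf.
apply: (CkS_intro (D := fun v z => (dd v f z)^*)) => // [z Uz|v z Uz|v].
- by apply: continuous_conj; exact: (Ck_continuous hf).
- by apply: is_dd_conj; exact: (Ck_is_dd _ hf).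
- by apply: IH; exact: Ck_dd.
Qed.

(** The derivative - f'/f^2 involves 1/f itself, but one order lower, which is what the induction
    provides. *)
Lemma CkV k U f : open U -> (forall z, U z -> f z != 0) -> Ck k U f ->
  Ck k U (fun z => (f z)^-1).
Proof.
move=> oU f0; elim: k => [|k IH] hf.
  by move=> z Uz; apply: continuousV_at; [exact: f0|exact: hf].
apply: (CkS_intro (D := fun v z => - dd v f z / f z ^+ 2)) => // [z Uz|v z Uz|v].
- by apply: continuousV_at; [exact: f0|exact: (Ck_continuous hf)].
- by apply: is_ddV; [exact: f0|exact: (Ck_is_dd _ hf)].
- apply: (Ck_ext (f := fun z => - dd v f z * ((f z)^-1 * (f z)^-1))) => // [z Uz|].
    by rewrite expr2 invfM.
  apply: CkM => //; first by apply: CkN => //; exact: Ck_dd.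
  by apply: CkM => //; apply: IH; exact: Ck_pred.
Qed.

Lemma Ck_norm k U f : open U -> (forall z, U z -> f z != 0) -> Ck k U f ->
  Ck k U (fun z => `|f z|).
Proof.
move=> oU f0; elim: k => [|k IH] hf.
  by move=> z Uz; apply: continuous_norm_at; exact: hf.
apply: (CkS_intro (D := fun v z => (dd v f z * (f z)^* + f z * (dd v f z)^*)
   * (2 * `|f z|)^-1)) => // [z Uz|v z Uz|v].
- by apply: continuous_norm_at; exact: (Ck_continuous hf).
- by apply: is_dd_norm; [exact: f0|exact: (Ck_is_dd _ hf)].
- have hf' := Ck_pred hf; have hd := Ck_dd v hf.
  apply: CkM => //; first by apply: CkD => //; apply: CkM => //; exact: Ck_conj.
  apply: CkV => // [z Uz|]; first by rewrite mulf_neq0 ?pnatr_eq0 ?normr_eq0 ?f0.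
  by apply: CkM => //; [exact: Ck_cst|exact: IH].
Qed.

Lemma Ck_sum k U (I : Type) (r : seq I) (P : pred I) (F : I -> C -> C) : open U ->
  (forall i, Ck k U (F i)) -> Ck k U (fun z => \sum_(i <- r | P i) F i z).
Proof.
move=> oU h; elim: r => [|i r IH].
  by apply: (Ck_ext (f := fun=> 0)) => // [z _|]; [rewrite big_nil|exact: Ck_cst].
apply: (Ck_ext (f := fun z => (if P i then F i z else 0) + \sum_(j <- r | P j) F j z)) => //.
  by move=> z _; rewrite big_cons; case: (P i); rewrite ?add0r.
by apply: CkD => //; case: (P i); [exact: h|exact: Ck_cst].
Qed.

Lemma Ck_prod k U (I : Type) (r : seq I) (P : pred I) (F : I -> C -> C) : open U ->
  (forall i, Ck k U (F i)) -> Ck k U (fun z => \prod_(i <- r | P i) F i z).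
Proof.
move=> oU h; elim: r => [|i r IH].
  by apply: (Ck_ext (f := fun=> 1)) => // [z _|]; [rewrite big_nil|exact: Ck_cst].
apply: (Ck_ext (f := fun z => (if P i then F i z else 1) * \prod_(j <- r | P j) F j z)) => //.
  by move=> z _; rewrite big_cons; case: (P i); rewrite ?mul1r.
by apply: CkM => //; case: (P i); [exact: h|exact: Ck_cst].
Qed.

Lemma of_part_reE (w : C) : of_real (part_re w) = (w + w^*) / 2.
Proof.
rewrite -of_realV2.
by apply: part_ext; rewrite !partE; field.
Qed.

Lemma of_part_imE (w : C) : of_real (part_im w) = (w^* - w) * ('i / 2).
Proof.
rewrite -of_realV2.
by apply: part_ext; rewrite !partE; field.
Qed.

Lemma Ck_re k U f : open U -> Ck k U f -> Ck k U (fun z => of_real (part_re (f z))).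
Proof.
move=> oU h; apply: (Ck_ext (f := fun z => (f z + (f z)^*) * 2^-1)) => // [z _|].
  by rewrite of_part_reE.
by apply: CkM; [|apply: CkD; [| |exact: Ck_conj]|exact: Ck_cst].
Qed.

Lemma Ck_im k U f : open U -> Ck k U f -> Ck k U (fun z => of_real (part_im (f z))).
Proof.
move=> oU h; apply: (Ck_ext (f := fun z => ((f z)^* + - f z) * ('i / 2))) => // [z _|].
  by rewrite of_part_imE.
by apply: CkM; [|apply: CkD; [|exact: Ck_conj|exact: CkN]|exact: Ck_cst].
Qed.

(** Mean value estimate along one segment. The factor 2 arises because the real and imaginary parts
    are bounded separately and [nrm] adds them. *)
Lemma leg_estimate f v (D : C -> C) z0 a (s eta : R) :
  (forall x : R, 0 <= x <= 1 ->
     is_dd f v (a + of_real x * (of_real s * v)) (D (a + of_real x * (of_real s * v))) /\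
     nrm (D (a + of_real x * (of_real s * v)) - D z0) <= eta) ->
  nrm (f (a + of_real s * v) - f a - of_real s * D z0) <= 2 * eta * `|s|.
Proof.
move=> h.
have h1 (x : R) (x01 : 0 <= x <= 1) :
    is_dd f (of_real s * v) (a + of_real x * (of_real s * v))
       (of_real s * D (a + of_real x * (of_real s * v))).
  by apply: is_dd_scale; have [] := h x x01.
have [[x x01 ex] [y y01 ey]] := path_MVT (D := fun w => of_real s * D w) h1.
have [_ hx] := h x x01; have [_ hy] := h y y01.
have hx' := le_trans (nrm_re _) hx; have hy' := le_trans (nrm_im _) hy.
rewrite /nrm !partE; move: ex ey hx' hy'; rewrite !partE => -> ->.
rewrite !mul0r !subr0 !addr0 -!mulrBr !normrM => hx' hy'.
have -> : 2 * eta * `|s| = `|s| * eta + `|s| * eta by ring.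
by apply: lerD; apply: ler_wpM2l.
Qed.

Lemma nrm_scaled_le (x : R) z : 0 <= x <= 1 -> nrm (of_real x * z) <= nrm z.
Proof.
move=> /andP[x0 x1]; rewrite nrm_ofM ger0_norm //; have := nrm_ge0 z; nra.
Qed.

(** Go from a to b along a horizontal and then a vertical leg, each controlled by continuity of the
    partial derivatives. Letting both ends vary is what the inverse function theorem requires. *)
Lemma strict_diff U f z0 (e : R) : open U -> Ck 1 U f -> U z0 -> 0 < e ->
  exists2 r : R, 0 < r & forall a b, nrm (a - z0) < r -> nrm (b - z0) < r ->
    nrm (f b - f a - (of_real (part_re (b - a)) * dd 1 f z0 +
                      of_real (part_im (b - a)) * dd 'i f z0)) <= e * nrm (b - a).
Proof.
move=> oU hf Uz e0.
have [r1 r10 hU] : exists2 d : R, 0 < d & forall w, nrm (w - z0) < d -> U w.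
  by apply/near_nrm; exact: open_nbhs_nbhs.
have e20 : 0 < e / 2 by rewrite divr_gt0.
have /continuous_nrm/(_ _ e20)[r2 r20 h2] := Ck_continuous (Ck_dd 1 hf) Uz.
have /continuous_nrm/(_ _ e20)[r3 r30 h3] := Ck_continuous (Ck_dd 'i hf) Uz.
pose r := Order.min r1 (Order.min r2 r3).
have r0 : 0 < r by rewrite !lt_min r10 r20.
(* a is within r/3 of z0 and the two legs have total length below 2r/3, so the path stays within r,
   where the partial derivatives are controlled. *)
exists (r / 3) => [|a b ha hb]; first by rewrite divr_gt0.
set s := part_re (b - a); set t := part_im (b - a).
have hab : nrm (b - a) < 2 * (r / 3).
  have -> : b - a = (b - z0) - (a - z0) by rewrite opprB addrA subrK.
  by apply: le_lt_trans (nrmB _ _) _; lra.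
have hs : `|s| + `|t| < 2 * (r / 3) by exact: hab.
have hs0 : 0 <= `|s| by []. have ht0 : 0 <= `|t| by [].
have key w : nrm (w - z0) < r -> [/\ is_dd f 1 w (dd 1 f w),
    nrm (dd 1 f w - dd 1 f z0) <= e / 2, is_dd f 'i w (dd 'i f w) &
    nrm (dd 'i f w - dd 'i f z0) <= e / 2].
  rewrite !lt_min => /and3P[/hU Uw /h2/ltW ? /h3/ltW ?].
  by split=> //; exact: (Ck_is_dd _ hf).
have A1 : nrm (f (a + of_real s * 1) - f a - of_real s * dd 1 f z0) <= 2 * (e / 2) * `|s|.
  apply: leg_estimate => x x01; set w := a + _.
  have /key[] // : nrm (w - z0) < r.
  have -> : w - z0 = (a - z0) + of_real x * (of_real s * 1) by rewrite /w; ring.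
  apply: le_lt_trans (nrmD _ _) _; have := nrm_scaled_le (of_real s * 1) x01.
  rewrite mulr1 nrm_of; lra.
set m := a + of_real s * 1 in A1.
have A2 : nrm (f (m + of_real t * 'i) - f m - of_real t * dd 'i f z0) <= 2 * (e / 2) * `|t|.
  apply: leg_estimate => x x01; set w := m + _.
  have /key[] // : nrm (w - z0) < r.
  have -> : w - z0 = (a - z0) + (of_real s + of_real x * (of_real t * 'i)) by rewrite /w /m; ring.
  apply: le_lt_trans (nrmD _ _) _; have := nrm_scaled_le (of_real t * 'i) x01.
  have := nrmD (of_real s) (of_real x * (of_real t * 'i)).
  have -> : nrm (of_real t * 'i : C) = `|t| by rewrite nrm_ofM /nrm !partE normr0 normr1
      add0r mulr1.
  rewrite nrm_of; lra.
have eb : m + of_real t * 'i = b.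
  by rewrite /m mulr1 -addrA partsK addrC subrK.
rewrite eb in A2.
have -> : f b - f a - (of_real s * dd 1 f z0 + of_real t * dd 'i f z0) =
   (f b - f m - of_real t * dd 'i f z0) + (f m - f a - of_real s * dd 1 f z0) by ring.
apply: le_trans (nrmD _ _) _.
have -> : nrm (b - a) = `|s| + `|t| by [].
have e2 : 2 * (e / 2) = e by rewrite mulrCA mulfV ?mulr1 // pnatr_eq0.
rewrite e2 in A1 A2; rewrite (mulrDr e) (addrC (e * _)); exact: lerD.
Qed.

(** Chain rule with f differentiable only in the real sense, whence the two partial derivatives of f
    weighted by the parts of d. *)
Lemma is_dd_comp U f (G : C -> C) v z d : open U -> Ck 1 U f -> U (G z) ->
  is_dd G v z d ->
  is_dd (fun w => f (G w)) v z
    (of_real (part_re d) * dd 1 f (G z) + of_real (part_im d) * dd 'i f (G z)).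
Proof.
move=> oU hf Uz /is_ddP hG; apply/is_ddP => e e0.
set p := dd 1 f (G z); set q := dd 'i f (G z).
set M := nrm p + nrm q; have M0 : 0 <= M by rewrite addr_ge0 // nrm_ge0.
have nd0 := nrm_ge0 d.
have L w : nrm (of_real (part_re w) * p + of_real (part_im w) * q) <= M * nrm w.
  apply: le_trans (nrmD _ _) _; rewrite !nrm_ofM /M.
  have := nrm_ge0 p; have := nrm_ge0 q; have := normr_ge0 (part_re w).
  have := normr_ge0 (part_im w); rewrite /(nrm w); nra.
(* [e1] bounds the linearisation error of f and [e2] that of G; each is to contribute at most half
   of e. The minimum with 1 gives the increment of G the uniform bound (1 + |d|) |t|. *)
set e1 := e / (2 * (1 + nrm d)); set e2 := Order.min 1 (e / (2 * (M + 1))).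
have e10 : 0 < e1 by rewrite divr_gt0 // mulr_gt0 //; lra.
have e20 : 0 < e2 by rewrite lt_min ltr01 divr_gt0 // mulr_gt0 //; lra.
have [r r0 hr] := strict_diff oU hf Uz e10.
have [a a0 ha] := hG _ e20.
exists (Order.min a (r / (1 + nrm d))) => [|t].
  by rewrite lt_min a0 divr_gt0 //; lra.
rewrite lt_min => /andP[/ha h1]; rewrite ltr_pdivlMr ?ltr_wpDr // => h2.
set w := G (z + of_real t * v) in h1 *.
have t0 := normr_ge0 t.
have e21 : e2 <= 1 by rewrite ge_min lexx.
have e22 : e2 * (2 * (M + 1)) <= e.
  by rewrite -ler_pdivlMr ?ge_min ?lexx ?orbT // mulr_gt0 //; lra.
have hw : nrm (w - G z) <= (e2 + nrm d) * `|t|.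
  have -> : w - G z = (w - G z - of_real t * d) + of_real t * d by rewrite subrK.
  apply: le_trans (nrmD _ _) _; rewrite nrm_ofM; lra.
have hw1 : nrm (w - G z) <= (1 + nrm d) * `|t| by nra.
have hwr : nrm (w - G z) < r by rewrite (le_lt_trans hw1) // mulrC.
have hzr : nrm (G z - G z) < r by rewrite subrr nrm0.
have h3 := hr _ _ hzr hwr.
have h4 := L (w - G z - of_real t * d).
have -> : f w - f (G z) - of_real t * (of_real (part_re d) * p + of_real (part_im d) * q) =
  (f w - f (G z) - (of_real (part_re (w - G z)) * p + of_real (part_im (w - G z)) * q)) +
  (of_real (part_re (w - G z - of_real t * d)) * p +
   of_real (part_im (w - G z - of_real t * d)) * q).
  have hE b1 b2 : of_real (part_re (b1 - of_real t * b2)) = of_real (part_re b1) - of_real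
      t * of_real (part_re b2).
    by apply: part_ext; rewrite !partE; ring.
  have hE' b1 b2 : of_real (part_im (b1 - of_real t * b2)) = of_real (part_im b1) - of_real
      t * of_real (part_im b2).
    by apply: part_ext; rewrite !partE; ring.
  by rewrite hE hE'; ring.
apply: le_trans (nrmD _ _) _.
have h5 : M * nrm (w - G z - of_real t * d) <= M * (e2 * `|t|) by rewrite ler_wpM2l.
have h6 : e1 * nrm (w - G z) <= e1 * ((1 + nrm d) * `|t|) by rewrite ler_wpM2l // ltW.
have h7 : e1 * ((1 + nrm d) * `|t|) = e / 2 * `|t|.
  by rewrite /e1; field; lra.
have h8 : M * (e2 * `|t|) <= e / 2 * `|t|.
  rewrite mulrA ler_wpM2r //; nra.
have e2E : e / 2 * `|t| + e / 2 * `|t| = e * `|t| by field.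
lra.
Qed.

(** The chain rule expresses the derivatives by first partials of f composed with the same G, so the
    induction runs over f with G fixed. *)
Lemma Ck_comp k U W f (G : C -> C) : open U -> open W -> (forall z, W z -> U (G z)) ->
  Ck k U f -> Ck k W G -> Ck k W (fun z => f (G z)).
Proof.
move=> oU oW UW; elim: k f => [|k IH] f hf hG.
  move=> z Wz; apply: (@continuous_comp _ _ _ G f); first exact: (hG z Wz).
  exact: (hf _ (UW z Wz)).
have hf1 : Ck 1 U f.
  move: hf; clear; elim: k => // k IHk /Ck_pred; exact: IHk.
apply: (CkS_intro (D := fun v z => of_real (part_re (dd v G z)) * dd 1 f (G z) +
   of_real (part_im (dd v G z)) * dd 'i f (G z))) => // [z Wz|v z Wz|v].
- apply: (@continuous_comp _ _ _ G f); first exact: (Ck_continuous hG).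
  exact: (Ck_continuous hf (UW z Wz)).
- by apply: (is_dd_comp oU hf1 (UW z Wz)); exact: (Ck_is_dd _ hG).
- have hG' := Ck_pred hG; have hd := Ck_dd v hG.
  apply: CkD => //; apply: CkM => //.
  + exact: Ck_re.
  + by apply: IH => //; exact: Ck_dd.
  + exact: Ck_im.
  + by apply: IH => //; exact: Ck_dd.
Qed.

End SmoothFunctions.

(** * Holomorphic functions and the inverse function theorem *)

Section Holomorphic.
Variable R : realType.
Local Notation C := (Cplx R).
Local Notation Ck := (@Ck R (Cplx R)^o).
Local Notation dd := (@dir_deriv R (Cplx R)^o).
Implicit Types (f g : C -> C) (z v w : C) (U W : set C) (k : nat).

Lemma differentiable_is_dd f z : differentiable (f : C^o -> C^o) z ->
  exists l, forall v, is_dd f v z (v * l).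
Proof.
move=> /derivable1_diffP; rewrite /derivable => /cvg_ex[/= l hl]; exists l => v.
apply/is_ddP => e e0.
have n0 : 0 < nrm v + 1 by rewrite ltr_wpDl // nrm_ge0.
(* The 2 absorbs the factor lost in [nrm_le_norm]. *)
have e10 : (0 : C) < of_real (e / (2 * (nrm v + 1))).
  by rewrite -of_real0 lt_of_real divr_gt0 // mulr_gt0.
have /cvgrPdist_le/(_ _ e10) := hl.
rewrite near_withinE => /near_nrm[d d0 hd].
exists (d / (nrm v + 1)) => [|t]; first exact: divr_gt0.
rewrite ltr_pdivlMr // => ht.
have [tv|tv0] := eqVneq (of_real t * v) 0; last first.
  have htv : nrm (of_real t * v) <= `|t| * (nrm v + 1).
    by rewrite nrm_ofM ler_wpM2l //; lra.
  have hdt : nrm (of_real t * v - 0) < d by rewrite subr0; apply: le_lt_trans htv _.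
  have := hd _ hdt tv0; rewrite /= => h1.
  have -> : f (z + of_real t * v) - f z - of_real t * (v * l) =
    - (of_real t * v) * (l - (of_real t * v)^-1 *: (f ((of_real t * v) *: 1 + z) - f z)).
    rewrite /GRing.scale /= mulr1 (addrC _ z) mulNr mulrBr mulVKf //.
    by rewrite opprB mulrA.
  apply: le_trans (nrmM _ _) _; rewrite nrmN.
  have h2 := le_trans (nrm_le_norm _) (ler_wpM2l (ler0n _ 2) h1).
  have e3 : (2 : C) * of_real (e / (2 * (nrm v + 1))) = of_real (e / (nrm v + 1)).
    rewrite -of_real2.
    by rewrite -of_realM; congr of_real; field; lra.
  rewrite e3 lecR in h2.
  apply: le_trans (ler_pM (nrm_ge0 _) (nrm_ge0 _) htv h2) _.
  by rewrite le_eqVlt; apply/orP; left; apply/eqP; field; lra.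
have [->|t0] := eqVneq t 0.
  by rewrite of_real0 !mul0r subr0 addr0 subrr nrm0 normr0 mulr0.
have v0 : v = 0.
  move/eqP: tv; rewrite mulf_eq0 => /orP[/eqP h|/eqP//].
  by move/eqP: t0; case; rewrite -(part_re_of t) h.
by rewrite v0 !mul0r !mulr0 addr0 subrr subr0 nrm0 mulr_ge0 // ltW.
Qed.

(** Smoothness with the Cauchy-Riemann equation, a form of holomorphy that the directional calculus
    can both use and establish. *)
Definition hl U f : Prop :=
  (forall k, Ck k U f) /\ forall z, U z -> dd 'i f z = 'i * dd 1 f z.

Lemma holo_hl U f : holo (V := C^o) U f -> hl U f.
Proof.
move=> [h1 h2]; split=> // z /h2/differentiable_is_dd[l hl].
by rewrite (is_dd_dir_derivable (hl 'i)).2 (is_dd_dir_derivable (hl 1)).2 mul1r.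
Qed.

Lemma hl_sub U W f : W `<=` U -> hl U f -> hl W f.
Proof. by move=> WU [h1 h2]; split=> [k|z /WU/h2//]; exact: Ck_sub (h1 k). Qed.

(** Two applications of the mean value theorem: to w |-> f(w + tv) - f(w) along u, then to the
    derivative of f along u in the direction v. The intermediate points differ for the two parts. *)
Lemma second_difference U f u v z0 (r : R) : Ck 2 U f ->
  (forall w, nrm (w - z0) < r -> U w) ->
  forall t : R, nrm (of_real t * u) + nrm (of_real t * v) < r ->
  let D := f (z0 + of_real t * u + of_real t * v) - f (z0 + of_real t * u)
           - (f (z0 + of_real t * v) - f z0) in
  (exists2 z1, nrm (z1 - z0) <= nrm (of_real t * u) + nrm (of_real t * v) &
     part_re D = t * (t * part_re (dd v (dd u f) z1))) /\
  (exists2 z1, nrm (z1 - z0) <= nrm (of_real t * u) + nrm (of_real t * v) &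
     part_im D = t * (t * part_im (dd v (dd u f) z1))).
Proof.
move=> hf hU t ht D.
have near0 (x y : R) : 0 <= x <= 1 -> 0 <= y <= 1 ->
    nrm (z0 + of_real x * (of_real t * u) + of_real y * (of_real t * v) - z0) <=
      nrm (of_real t * u) + nrm (of_real t * v).
  move=> x01 y01.
  have -> : z0 + of_real x * (of_real t * u) + of_real y * (of_real t * v) - z0 =
    of_real x * (of_real t * u) + of_real y * (of_real t * v) by ring.
  apply: le_trans (nrmD _ _) _.
  by apply: lerD; exact: nrm_scaled_le.
have hUxy (x y : R) : 0 <= x <= 1 -> 0 <= y <= 1 ->
    U (z0 + of_real x * (of_real t * u) + of_real y * (of_real t * v)).
  by move=> x01 y01; apply: hU; apply: le_lt_trans ht; exact: near0.
have i0 : (0 : R) <= (0 : R) <= (1 : R) by apply/andP; split.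
have i1 : (0 : R) <= (1 : R) <= (1 : R) by apply/andP; split.
pose g w := f (w + of_real t * v) - f w.
have hg (x : R) : 0 <= x <= 1 -> is_dd g (of_real t * u) (z0 + of_real x * (of_real t * u))
    (of_real t * (dd u f (z0 + of_real x * (of_real t * u) + of_real t * v)
       - dd u f (z0 + of_real x * (of_real t * u)))).
  move=> x01; apply: is_dd_scale; rewrite /g.
  have Ux : U (z0 + of_real x * (of_real t * u)).
    by have := hUxy x 0 x01 i0; rewrite of_real0 mul0r addr0.
  have Ux' : U (z0 + of_real x * (of_real t * u) + of_real t * v).
    by have := hUxy x 1 x01 i1; rewrite of_real1 mul1r.
  have h1 := Ck_is_dd u hf Ux; have h2 := Ck_is_dd u hf Ux'.
  have h2' : is_dd (fun w => f (w + of_real t * v)) u (z0 + of_real x * (of_real t * u))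
     (dd u f (z0 + of_real x * (of_real t * u) + of_real t * v)).
    apply/is_ddP => e /(proj1 (is_ddP _ _ _ _) h2)[a a0 ha]; exists a => // s /ha.
    by rewrite (addrAC _ (of_real t * v)).
  have h3 := is_ddM (is_dd_cst (-1) u (z0 + of_real x * (of_real t * u))) h1.
  have := is_ddD h2' h3; rewrite mul0r add0r !mulN1r.
  by apply: is_dd_near; near=> w; rewrite mulN1r.
have hdu (x y : R) : 0 <= x <= 1 -> 0 <= y <= 1 ->
    is_dd (dd u f) (of_real t * v) (z0 + of_real x * (of_real t * u) + of_real y * (of_real
        t * v))
      (of_real t * dd v (dd u f) (z0 + of_real x * (of_real t * u) + of_real y * (of_real t
          * v))).
  move=> x01 y01; apply: is_dd_scale; exact: (Ck_is_dd _ (Ck_dd u hf) (hUxy _ _ x01 y01)).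
have [[x x01 ex] [x' x'01 ex']] := path_MVT (D := fun w =>
   of_real t * (dd u f (w + of_real t * v) - dd u f w)) hg.
have [[y y01 ey] _] := path_MVT (D := fun w => of_real t * dd v (dd u f) w) (hdu x ^~ x01).
have [_ [y' y'01 ey']] := path_MVT (D := fun w => of_real t * dd v (dd u f) w) (hdu x' ^~ x'01).
split.
  exists (z0 + of_real x * (of_real t * u) + of_real y * (of_real t * v)); first exact: near0.
  move: ex ey; rewrite /g /D; move: (dd v _ _) (dd u f _) (dd u f _) => A1 A2 A3.
  by rewrite !partE !mul0r !subr0 => -> ->; ring.
exists (z0 + of_real x' * (of_real t * u) + of_real y' * (of_real t * v)); first exact: near0.
move: ex' ey'; rewrite /g /D; move: (dd v _ _) (dd u f _) (dd u f _) => A1 A2 A3.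
by rewrite !partE !mul0r !addr0 => -> ->; ring.
Unshelve. all: by end_near. Qed.

Lemma nrm_eq_small z w : (forall e : R, 0 < e -> nrm (z - w) <= e) -> z = w.
Proof.
move=> h; apply/eqP; rewrite -subr_eq0; apply/eqP/nrm_eq0.
by apply/ler_addgt0Pl => e /h; rewrite addr0.
Qed.

(** Both mixed derivatives approximate the second difference divided by t^2, which is symmetric in u
    and v. *)
Lemma Schwarz U f u v z0 : open U -> Ck 2 U f -> U z0 ->
  dd v (dd u f) z0 = dd u (dd v f) z0.
Proof.
move=> oU hf Uz; apply: nrm_eq_small => e e0.
have [r r0 hU] : exists2 d : R, 0 < d & forall w, nrm (w - z0) < d -> U w.
  by apply/near_nrm; exact: open_nbhs_nbhs.
(* In each of the two parts, two intermediate values are compared with their limits, which makes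
   four errors. *)
have e40 : 0 < e / 4 by rewrite divr_gt0.
have /continuous_nrm/(_ _ e40)[r1 r10 h1] := Ck_continuous (Ck_dd v (Ck_dd u hf)) Uz.
have /continuous_nrm/(_ _ e40)[r2 r20 h2] := Ck_continuous (Ck_dd u (Ck_dd v hf)) Uz.
set m := Order.min r (Order.min r1 r2).
have m0 : 0 < m by rewrite !lt_min r0 r10.
have n0 : 0 < nrm u + nrm v + 1 by rewrite ltr_wpDl // addr_ge0 // nrm_ge0.
pose t := m / (nrm u + nrm v + 1).
have t0 : 0 < t by rewrite divr_gt0.
have ht : nrm (of_real t * u) + nrm (of_real t * v) < m.
  rewrite !nrm_ofM gtr0_norm // -mulrDr.
  have -> : m = t * (nrm u + nrm v + 1) by rewrite /t divfK // gt_eqF.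
  rewrite ltr_pM2l //; lra.
have htr : nrm (of_real t * u) + nrm (of_real t * v) < r.
  by apply: lt_le_trans ht _; rewrite ge_min lexx.
have htr' : nrm (of_real t * v) + nrm (of_real t * u) < r by rewrite addrC.
have hm z1 : nrm (z1 - z0) < m -> nrm (z1 - z0) < r1 /\ nrm (z1 - z0) < r2.
  by rewrite !lt_min => /and3P[].
have [[a ha ea] [b hb eb]] := second_difference hf hU htr.
have [[c hc ec] [d hd ed]] := second_difference hf hU htr'.
have eD : f (z0 + of_real t * u + of_real t * v) - f (z0 + of_real t * u)
           - (f (z0 + of_real t * v) - f z0) =
    f (z0 + of_real t * v + of_real t * u) - f (z0 + of_real t * v)
           - (f (z0 + of_real t * u) - f z0).
  by rewrite (addrAC z0); ring.
rewrite eD ec in ea; rewrite eD ed in eb.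
have ti := mulfI (lt0r_neq0 t0).
have {}ea := ti _ _ (ti _ _ ea); have {}eb := ti _ _ (ti _ _ eb).
have ht' : nrm (of_real t * v) + nrm (of_real t * u) < m by rewrite addrC.
have [/h1/ltW/(le_trans (nrm_re _)) ka _] := hm a (le_lt_trans ha ht).
have [/h1/ltW/(le_trans (nrm_im _)) kb _] := hm b (le_lt_trans hb ht).
have [_ /h2/ltW/(le_trans (nrm_re _)) kc] := hm c (le_lt_trans hc ht').
have [_ /h2/ltW/(le_trans (nrm_im _)) kd] := hm d (le_lt_trans hd ht').
move: ka kb kc kd ea eb; clear.
move: (dd v (dd u f) a) (dd v (dd u f) b) (dd u (dd v f) c) (dd u (dd v f) d).
move: (dd v (dd u f) z0) (dd u (dd v f) z0) => [x3 y3] [x2 y2] [? ?] [? ?] [x1 ?] [? y1].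
rewrite /nrm /= => + + + + e1 e2; rewrite -{}e1 -{}e2.
rewrite !ler_norml => /andP[? ?] /andP[? ?] /andP[? ?] /andP[? ?].
have : `|x3 - x2| <= e / 2 by rewrite ler_norml; apply/andP; split; lra.
have : `|y3 - y2| <= e / 2 by rewrite ler_norml; apply/andP; split; lra.
lra.
Qed.

Lemma continuous_real (m : C -> R) z :
  (forall e : R, 0 < e ->
    exists2 d : R, 0 < d & forall w, nrm (w - z) < d -> `|m w - m z| < e) ->
  {for z, continuous m}.
Proof.
move=> h B /nbhs_ballP[e e0 he]; have [d d0 hd] := h _ e0; apply/near_nrm.
by exists d => // w /hd hw; apply: he; rewrite /ball /= distrC.
Qed.

Lemma open_nrm (A : set C) :
  (forall z, A z -> exists2 d : R, 0 < d & forall w, nrm (w - z) < d -> A w) -> open A.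
Proof.
move=> h; rewrite openE => z /h hz; rewrite /interior; apply/near_nrm; exact: hz.
Qed.

Lemma open_ball_nrm z (r : R) : open [set w : C | nrm (w - z) < r].
Proof.
apply: open_nrm => w /= hw; exists (r - nrm (w - z)); first by rewrite subr_gt0.
move=> w' h; have -> : w' - z = (w' - w) + (w - z) by rewrite addrA subrK.
apply: le_lt_trans (nrmD _ _) _; lra.
Qed.

(** A closed subset of the continuous image of the square [-r, r]^2. *)
Lemma compact_nrm_ball z (r : R) : compact [set w : C | nrm (w - z) <= r].
Proof.
pose p (xy : R * R) : C := z + (of_real xy.1 + of_real xy.2 * 'i).
have cp : continuous p.
  move=> [x y] B /near_nrm[e e0 he]; have e20 : 0 < e / 2 by rewrite divr_gt0.
  exists (ball x (e / 2), ball y (e / 2)); first by split; exact: nbhsx_ballx.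
  move=> [x' y'] [/= hx hy]; apply: he; rewrite /p /=.
  move: hx hy; rewrite /ball /= => hx hy.
  rewrite opprD addrACA subrr add0r /nrm !partE ?(mul0r, mulr0, mulr1, subr0, addr0, add0r,
      oppr0).
  rewrite distrC in hx; rewrite distrC in hy.
  rewrite ?(mul0r, mulr0, mulr1, subr0, addr0, add0r, oppr0); lra.
have cK : compact (p @` (`[- r, r]%classic `*` `[- r, r]%classic)).
  apply: continuous_compact; first exact: continuous_subspaceT.
  by apply: compact_setX; exact: segment_compact.
apply: subclosed_compact cK _.
  rewrite -openC; apply: open_nrm => w /= /negP; rewrite -ltNge => hw.
  exists (nrm (w - z) - r); first by rewrite subr_gt0.
  move=> w' h /=; apply/negP; rewrite -ltNge.
  have : nrm (w - z) <= nrm (w - w') + nrm (w' - z).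
    by rewrite -{1}(subrK w' w) -addrA; exact: nrmD.
  rewrite nrmC in h; lra.
move=> w /= hw; exists (part_re (w - z), part_im (w - z)); last first.
  by rewrite /p /= partsK addrC subrK.
split; rewrite /= in_itv /= -ler_norml.
  exact: le_trans (nrm_re _) hw.
exact: le_trans (nrm_im _) hw.
Qed.

End Holomorphic.

Section InverseFunction.
Variable R : realType.
Local Notation C := (Cplx R).
Local Notation Ck := (@Ck R (Cplx R)^o).
Local Notation dd := (@dir_deriv R (Cplx R)^o).
Implicit Types (f g F G : C -> C) (z v w : C) (U W : set C) (k : nat).

(** The Cauchy-Riemann equation turns the real-linear approximation of [strict_diff] into
    multiplication by one complex number. *)
Lemma hl_strict_diff U F w0 (e : R) : open U -> hl U F -> U w0 -> 0 < e ->
  exists2 r : R, 0 < r & forall a b, nrm (a - w0) < r -> nrm (b - w0) < r ->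
    nrm (F b - F a - dd 1 F w0 * (b - a)) <= e * nrm (b - a).
Proof.
move=> oU hF Uw e0; have [r r0 hr] := strict_diff oU (hF.1 1%N) Uw e0.
exists r => // a b ha hb; have := hr a b ha hb; rewrite (hF.2 _ Uw).
move: (dd 1 F w0) => p.
have -> // : of_real (part_re (b - a)) * p + of_real (part_im (b - a)) * ('i * p) = p * (b - a).
by rewrite -{3}(partsK (b - a)); ring.
Qed.

(* The minimum over a compact ball of [nrm (F w / F'(w0) - zeta)] is 0, since a
   Newton step decreases it. *)
Lemma hl_locally_onto U F w0 : open U -> hl U F -> U w0 -> dd 1 F w0 != 0 ->
  exists (r s K : R), [/\ [/\ 0 < r, 0 < s & 0 < K],
    forall w, nrm (w - w0) < r -> U w /\ dd 1 F w != 0,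
    forall a b, nrm (a - w0) < r -> nrm (b - w0) < r ->
      nrm (b - a) <= K * nrm (F b - F a) &
    forall z, nrm (z - F w0) < s -> exists2 w, nrm (w - w0) < r & F w = z].
Proof.
move=> oU hF Uw p0; set p := dd 1 F w0 in p0 *.
have np : 0 < nrm p^-1 by rewrite nrm_gt0 // invr_eq0.
have [r1 r10 hU] : exists2 d : R, 0 < d & forall w, nrm (w - w0) < d -> U w.
  by apply/near_nrm; exact: open_nbhs_nbhs.
(* With this error bound, w |-> w - F w / p contracts distances by 1/2 near w0. *)
have e0 : 0 < (2 * nrm p^-1)^-1 by rewrite invr_gt0 mulr_gt0.
have [r2 r20 hr2] := hl_strict_diff oU hF Uw e0.
(* A derivative within distance |p| of p cannot vanish. *)
have hp : 0 < nrm p by exact: nrm_gt0.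
have /continuous_nrm/(_ _ hp)[r3 r30 h3] := Ck_continuous (Ck_dd 1 (hF.1 1%N)) Uw.
pose r := Order.min r1 (Order.min r2 r3); pose rho := r / 2.
have r0 : 0 < r by rewrite !lt_min r10 r20.
have rho0 : 0 < rho by rewrite divr_gt0.
have key a b : nrm (a - w0) < r -> nrm (b - w0) < r ->
    nrm (p^-1 * (F b - F a) - (b - a)) <= nrm (b - a) / 2.
  rewrite !lt_min => /and3P[_ ha _] /and3P[_ hb _]; have h := hr2 _ _ ha hb.
  have -> : p^-1 * (F b - F a) - (b - a) = p^-1 * (F b - F a - p * (b - a)).
    by rewrite [in RHS]mulrBr mulKf.
  apply: le_trans (nrmM _ _) _; apply: le_trans (ler_wpM2l (ltW np) h) _.
  by rewrite le_eqVlt; apply/orP; left; apply/eqP; field; rewrite gt_eqF.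
(* The contraction by 1/2 gives the Lipschitz constant 2 |p^-1| of the inverse. The bound on z makes
   |p^-1 (F w0 - z)| at most rho/2, so that a Newton step started in the closed ball of radius rho
   stays in it. *)
exists r, (rho / (2 * nrm p^-1)), (2 * nrm p^-1); split.
- by split=> //; rewrite ?divr_gt0 ?mulr_gt0.
- move=> w; rewrite !lt_min => /and3P[/hU Uw' _ /h3 h]; split; first exact: Uw'.
  apply: contraTN h => /eqP ->; rewrite sub0r nrmN; by rewrite ltxx.
- move=> a b ha hb; have h := key a b ha hb.
  have h1 := nrmB (p^-1 * (F b - F a)) (p^-1 * (F b - F a) - (b - a)).
  rewrite subKr in h1; have h2 := nrmM p^-1 (F b - F a); lra.
move=> z; rewrite ltr_pdivlMr ?mulr_gt0 // => hz.
pose m w : R := nrm (p^-1 * (F w - z)).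
have hball w : nrm (w - w0) <= rho -> nrm (w - w0) < r.
  move=> h; apply: le_lt_trans h _; rewrite /rho ltr_pdivrMr //; lra.
have cm w : nrm (w - w0) <= rho -> {for w, continuous m}.
  move=> /hball hw; have Uw' : U w by move: hw; rewrite !lt_min => /andP[/hU].
  apply: continuous_real => e e1.
  have e1' : 0 < e / nrm p^-1 by rewrite divr_gt0.
  have /continuous_nrm/(_ _ e1')[d d0 hd] := Ck_continuous (hF.1 0%N) Uw'.
  exists d => // w' /hd; rewrite ltr_pdivlMr // => h.
  have hsub (x y : C) : `|nrm x - nrm y| <= nrm (x - y).
    rewrite ler_norml; have := nrmD (x - y) y; have := nrmD (y - x) x.
    rewrite !subrK (nrmC y x) => ? ?; apply/andP; split; lra.
  rewrite /m; apply: (le_lt_trans (hsub _ _)); rewrite -mulrBr.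
  have -> : F w' - z - (F w - z) = F w' - F w by rewrite opprB addrA subrK.
  by apply: le_lt_trans (nrmM _ _) _; rewrite mulrC.
have [||w1 w1B hmin] := compact_EVT_min _ (@compact_nrm_ball R w0 rho) (f := m).
- by exists w0; rewrite /= subrr nrm0 ltW.
- by apply: continuous_in_subspaceT => w; rewrite inE => /cm.
rewrite inE /= in w1B.
pose w2 := w1 - p^-1 * (F w1 - z).
have hw0 : nrm (w0 - w0) < r by rewrite subrr nrm0.
have k1 := key w0 w1 hw0 (hball _ w1B).
have nz : nrm (p^-1 * (F w0 - z)) <= rho / 2.
  apply: le_trans (nrmM _ _) _; rewrite (nrmC (F w0)); lra.
have w2B : nrm (w2 - w0) <= rho.
  have -> : w2 - w0 = - (p^-1 * (F w1 - F w0) - (w1 - w0)) - p^-1 * (F w0 - z).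
    by rewrite /w2; ring.
  apply: le_trans (nrmB _ _) _; rewrite nrmN; lra.
have k2 := key w1 w2 (hball _ w1B) (hball _ w2B).
have : m w1 <= m w2 by apply: hmin; rewrite inE.
have m1 : nrm (w2 - w1) = m w1.
  by rewrite /w2 [w1 - _]addrC addrK nrmN.
have m2 : m w2 = nrm (p^-1 * (F w2 - F w1) - (w2 - w1)).
  by rewrite /m /w2; congr nrm; ring.
(* By contraction [m w2] is at most half of [m w1], while w1 is a minimum. *)
rewrite m2 => k3; have m0 : m w1 <= 0 by lra.
exists w1; first exact: hball.
have := nrm_eq0 m0; move/eqP; rewrite mulf_eq0 invr_eq0 (negPf p0) subr_eq0.
by move/eqP.
Qed.

(** The Lipschitz bound makes the inverse continuous, strict differentiability of F then gives G' =
    1/F'(G), and this formula raises the regularity of G one order at a time. *)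
Lemma hl_inverse U F w0 : open U -> hl U F -> U w0 -> dd 1 F w0 != 0 ->
  exists W G, [/\ open W, W (F w0), hl W G, G (F w0) = w0 &
    forall z, W z -> U (G z) /\ F (G z) = z].
Proof.
move=> oU hF Uw p0.
have [r [s [K [[r0 s0 K0] hr hinj honto]]]] := hl_locally_onto oU hF Uw p0.
pose G z := get [set w | nrm (w - w0) < r /\ F w = z].
pose W := [set z : C | nrm (z - F w0) < s].
have oW : open W by exact: open_ball_nrm.
have hG z : W z -> nrm (G z - w0) < r /\ F (G z) = z.
  move=> /honto[w hw e]; rewrite /G.
  by apply: (@getPex _ [set w | nrm (w - w0) < r /\ F w = z]); exists w.
have GK a b : W a -> W b -> nrm (G b - G a) <= K * nrm (b - a).
  move=> /hG[ha ea] /hG[hb eb]; have := hinj _ _ ha hb; by rewrite ea eb.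
have cG z : W z -> {for z, continuous G}.
  move=> Wz; have [d d0 hd] : exists2 d : R, 0 < d & forall w, nrm (w - z) < d -> W w.
    by apply/near_nrm; exact: open_nbhs_nbhs.
  apply/continuous_nrm => e e0.
  exists (Order.min d (e / K)) => [|w]; first by rewrite lt_min d0 divr_gt0.
  rewrite lt_min ltr_pdivlMr // => /andP[/hd Ww h].
  by apply: le_lt_trans (GK _ _ Wz Ww) _; rewrite mulrC.
have dG v z : W z -> is_dd G v z (v / dd 1 F (G z)).
  move=> Wz; have [hz ez] := hG _ Wz; have [Uz q0] := hr _ hz.
  set q := dd 1 F (G z) in q0 *; apply/is_ddP => e e0.
  (* M collects what multiplies the linearisation error of F: the factor 1/q and the Lipschitz bound
     on the increment of G. *)
  set M := nrm q^-1 * K * nrm v + 1.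
  have M0 : 0 < M by rewrite ltr_wpDl // !mulr_ge0 ?nrm_ge0 // ltW.
  have [d d0 hd] := hl_strict_diff oU hF Uz (divr_gt0 e0 M0).
  have nW : \forall w \near z, nrm (G w - G z) < d /\ W w.
    have /continuous_nrm/(_ _ d0)[d1 d10 hd1] := cG _ Wz.
    have [d2 d20 hd2] : exists2 d : R, 0 < d & forall w, nrm (w - z) < d -> W w.
      by apply/near_nrm; exact: open_nbhs_nbhs.
    apply/near_nrm; exists (Order.min d1 d2) => [|w]; first by rewrite lt_min d10.
    by rewrite lt_min => /andP[/hd1 ? /hd2].
  have [a a0 ha] := near_line v nW; exists a => // t /ha[hGd Wt].
  have [hb eb] := hG _ Wt; set b := G (z + of_real t * v) in hGd hb eb *.
  have hz' : nrm (G z - G z) < d by rewrite subrr nrm0.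
  have := hd _ _ hz' hGd; rewrite -/q eb ez.
  have -> : z + of_real t * v - z = of_real t * v by rewrite addrC addKr.
  move=> h.
  have -> : b - G z - of_real t * (v / q) =
     - (q^-1 * (of_real t * v - q * (b - G z))).
    by field.
  rewrite nrmN; apply: le_trans (nrmM _ _) _.
  apply: le_trans (ler_wpM2l (nrm_ge0 _) h) _.
  have h2 : nrm (b - G z) <= K * (`|t| * nrm v).
    by apply: le_trans (GK _ _ Wz Wt) _; rewrite (addrC z) addrK nrm_ofM.
  have h3 : nrm q^-1 * (e / M * nrm (b - G z)) <= nrm q^-1 * (e / M * (K * (`|t| * nrm v))).
    by rewrite ler_wpM2l ?nrm_ge0 // ler_wpM2l // ltW // divr_gt0.
  apply: le_trans h3 _.
  have -> : nrm q^-1 * (e / M * (K * (`|t| * nrm v))) =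
     (nrm q^-1 * K * nrm v) / M * (e * `|t|) by ring.
  rewrite -[leRHS]mul1r ler_wpM2r ?mulr_ge0 ?(ltW e0) //.
  by rewrite ler_pdivrMr // mul1r /M lerDl.
have UG z : W z -> U (G z) by move=> /hG[/hr[]].
have sG k : Ck k W G.
  elim: k => [|k IH]; first by move=> z; exact: cG.
  apply: (CkS_intro (D := fun v z => v * (dd 1 F (G z))^-1)) => // v.
  apply: (CkM oW (Ck_cst k v oW)).
  have q0 z : W z -> dd 1 F (G z) != 0 by move=> /hG[/hr[]].
  exact: (CkV oW q0 (Ck_comp oU oW UG (Ck_dd 1 (hF.1 k.+1)) IH)).
exists W, G; split=> //.
- by rewrite /W /= subrr nrm0.
- split=> // z Wz.
  rewrite (is_dd_dir_derivable (dG 'i z Wz)).2 (is_dd_dir_derivable (dG 1 z Wz)).2.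
  by rewrite mul1r.
- have Ww : W (F w0) by rewrite /W /= subrr nrm0.
  have [h e] := hG _ Ww; have h0 : nrm (w0 - w0) < r by rewrite subrr nrm0.
  have := hinj _ _ h0 h; rewrite e subrr nrm0 mulr0 => /nrm_eq0/eqP.
  by rewrite subr_eq0 => /eqP.
- by move=> z Wz; split; [exact: UG|have [] := hG _ Wz].
Qed.

End InverseFunction.

(* Unification would otherwise unfold derivatives into the sum of their parts. *)
Opaque dir_deriv.

(** * Wirtinger operators and stability of holomorphy *)

Section Wirtinger.
Variable R : realType.
Local Notation C := (Cplx R).
Local Notation Ck := (@Ck R (Cplx R)^o).
Local Notation dd := (@dir_deriv R (Cplx R)^o).
Implicit Types (f g G : C -> C) (a z v w : C) (U W : set C) (k : nat).

(** a = -i gives d' and a = i gives d'', so that each rule is proved once for both. *)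
Definition wirt a f z : C := 2^-1 * (dd 1 f z + a * dd 'i f z).

Lemma ddz_wirt f z : ddz f z = wirt (- 'i) f z.
Proof. by rewrite /ddz /wirt mulNr. Qed.

Lemma ddzbar_wirt f z : ddzbar f z = wirt 'i f z.
Proof. by []. Qed.

Lemma dd_near f g v z : (\forall w \near z, f w = g w) ->
  (exists d, is_dd f v z d) -> dd v g z = dd v f z.
Proof.
move=> fg [d hd]; rewrite (is_dd_dir_derivable hd).2.
exact: (is_dd_dir_derivable (is_dd_near fg hd)).2.
Qed.

Lemma dd_ext W f g v z : open W -> (forall w, W w -> f w = g w) -> W z ->
  Ck 1 W f -> dd v g z = dd v f z.
Proof.
move=> oW fg Wz hf; apply: dd_near; last by exists (dd v f z); exact: (Ck_is_dd _ hf).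
have : \forall w \near z, W w by apply: open_nbhs_nbhs.
by apply: filterS => w /fg.
Qed.

Lemma wirt_ext W f g a z : open W -> (forall w, W w -> f w = g w) -> W z ->
  Ck 1 W f -> wirt a g z = wirt a f z.
Proof. by move=> oW fg Wz hf; rewrite /wirt !(dd_ext _ oW fg Wz hf). Qed.

Lemma ddE_is_dd f v z d : is_dd f v z d -> dd v f z = d.
Proof. by move=> /is_dd_dir_derivable[]. Qed.

Lemma wirt_cst a (c : C) z : wirt a (fun=> c) z = 0.
Proof. by rewrite /wirt !(ddE_is_dd (is_dd_cst c _ z)) mulr0 addr0 mulr0. Qed.

Lemma wirt0 W f a z : open W -> (forall w, W w -> f w = 0) -> W z -> wirt a f z = 0.
Proof.
move=> oW f0 Wz; rewrite -[RHS](wirt_cst a 0 z).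
have e w : W w -> 0 = f w by move=> /f0.
exact: (wirt_ext a oW e Wz (Ck_cst 1 0 oW)).
Qed.

Lemma wirtD W f g a z : Ck 1 W f -> Ck 1 W g -> W z ->
  wirt a (fun w => f w + g w) z = wirt a f z + wirt a g z.
Proof.
move=> hf hg Wz; have h v := ddE_is_dd (is_ddD (Ck_is_dd v hf Wz) (Ck_is_dd v hg Wz)).
rewrite /wirt !h; move: (dd 1 f z) (dd 1 g z) (dd 'i f z) (dd 'i g z) => *; ring.
Qed.

Lemma wirtM W f g a z : Ck 1 W f -> Ck 1 W g -> W z ->
  wirt a (fun w => f w * g w) z = wirt a f z * g z + f z * wirt a g z.
Proof.
move=> hf hg Wz; have h v := ddE_is_dd (is_ddM (Ck_is_dd v hf Wz) (Ck_is_dd v hg Wz)).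
rewrite /wirt !h; move: (dd 1 f z) (dd 1 g z) (dd 'i f z) (dd 'i g z) => *; ring.
Qed.

Lemma wirt_sum W (I : Type) (r : seq I) (F : I -> C -> C) a z : open W ->
  (forall i, Ck 1 W (F i)) -> W z ->
  wirt a (fun w => \sum_(i <- r) F i w) z = \sum_(i <- r) wirt a (F i) z.
Proof.
move=> oW hF Wz; elim: r => [|i r IH].
  by rewrite big_nil; apply: (wirt0 _ oW _ Wz) => w _; rewrite big_nil.
have hs : Ck 1 W (fun w => \sum_(j <- r) F j w) by exact: (Ck_sum r xpredT oW hF).
have h : Ck 1 W (fun w => F i w + \sum_(j <- r) F j w) by exact: (CkD oW (hF i) hs).
rewrite big_cons -IH -(wirtD a (hF i) hs Wz).
suff e w : W w -> F i w + \sum_(j <- r) F j w = \sum_(j <- i :: r) F j w.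
  exact: (wirt_ext a oW e Wz h).
by move=> _; rewrite big_cons.
Qed.

Lemma wirt_conj W f a z : Ck 1 W f -> W z ->
  wirt a (fun w => (f w)^*) z = (wirt a^* f z)^*.
Proof.
move=> hf Wz; have h v := ddE_is_dd (is_dd_conj (Ck_is_dd v hf Wz)); rewrite /wirt !h.
move: (dd 1 f z) (dd 'i f z) => x y.
by rewrite !(rmorphM, rmorphD) /= conjCK fmorphV rmorph_nat.
Qed.

Lemma Ck_wirt k W f a : open W -> Ck k.+1 W f -> Ck k W (wirt a f).
Proof.
move=> oW hf; apply: CkM => //; first exact: Ck_cst.
apply: CkD => //; first exact: Ck_dd.
by apply: CkM => //; [exact: Ck_cst|exact: Ck_dd].
Qed.

Lemma hl_wirtbar W f z : hl W f -> W z -> wirt 'i f z = 0.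
Proof.
by move=> [_ h] Wz; rewrite /wirt h // mulrA -expr2 sqrCi mulN1r subrr mulr0.
Qed.

Lemma hl_wirt W f z : hl W f -> W z -> wirt (- 'i) f z = dd 1 f z.
Proof.
move=> [_ h] Wz; rewrite /wirt h // mulrA mulNr -expr2 sqrCi opprK mul1r.
by move: (dd 1 f z) => x; field.
Qed.

Lemma wirtbar_hl W f : (forall k, Ck k W f) -> (forall z, W z -> wirt 'i f z = 0) ->
  hl W f.
Proof.
move=> hf h; split=> // z /h/eqP; rewrite /wirt mulf_eq0 invr_eq0 pnatr_eq0 /=.
rewrite addr_eq0 => /eqP ->.
by rewrite mulrN mulrA -expr2 sqrCi mulN1r opprK.
Qed.

(** For holomorphic G the two operators do not mix: d' of the composite picks up G' and d'' its
    conjugate. *)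
Lemma wirt_comp U W f G a z : open U -> Ck 1 U f -> hl W G -> W z -> U (G z) ->
  a = 'i \/ a = - 'i ->
  wirt a (fun w => f (G w)) z =
    wirt a f (G z) * (if a == 'i then (dd 1 G z)^* else dd 1 G z).
Proof.
move=> oU hf hG Wz Uz ha; have hG1 v := Ck_is_dd v (hG.1 1%N) Wz.
rewrite /wirt !(ddE_is_dd (is_dd_comp oU hf Uz (hG1 _))) (hG.2 _ Wz).
have nii : (- 'i : C) == 'i = false.
  by rewrite eqNr (negPf (neq0Ci _)).
have sii : 'i * 'i = -1 :> C by rewrite -expr2 sqrCi.
move: (dd 1 G z) => d; rewrite !partE !mul0r !mul1r sub0r add0r.
have -> : of_real (- part_im d) = - of_real (part_im d) by apply: part_ext; rewrite !partE
    // oppr0.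
case: ha => ->; rewrite ?eqxx ?nii.
  have -> : d^* = of_real (part_re d) - of_real (part_im d) * 'i.
    by apply: part_ext; rewrite !partE; ring.
  move: (of_real (part_re d)) (of_real (part_im d)) (dd 1 f (G z)) (dd 'i f (G z)) => x y p q.
  have e : 'i * ('i * (q * y)) = - (q * y) by rewrite mulrA sii mulN1r.
  rewrite [LHS](_ : _ = 2^-1 * ((x - y * 'i) * p + ('i * x) * q + y * q)); last by ring.
  rewrite [RHS](_ : _ = 2^-1 * ((x - y * 'i) * p + ('i * x) * q - 'i * ('i * (q * y))));
      last by ring.
  by rewrite e; ring.
rewrite -{5}(partsK d).
move: (of_real (part_re d)) (of_real (part_im d)) (dd 1 f (G z)) (dd 'i f (G z)) => x y p q.
have e : 'i * ('i * (q * y)) = - (q * y) by rewrite mulrA sii mulN1r.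
rewrite [LHS](_ : _ = 2^-1 * ((x + y * 'i) * p - ('i * x) * q + y * q)); last by ring.
rewrite [RHS](_ : _ = 2^-1 * ((x + y * 'i) * p - ('i * x) * q - 'i * ('i * (q * y)))); last
    by ring.
by rewrite e; ring.
Qed.

Lemma wirt_comm W f a b z : open W -> Ck 2 W f -> W z ->
  wirt a (wirt b f) z = wirt b (wirt a f) z.
Proof.
move=> oW hf Wz.
have key c u : dd u (wirt c f) z = 2^-1 * (dd u (dd 1 f) z + c * dd u (dd 'i f) z).
  have h1 := Ck_is_dd u (Ck_dd 1 hf) Wz; have h2 := Ck_is_dd u (Ck_dd 'i hf) Wz.
  have := is_ddM (is_dd_cst 2^-1 u z) (is_ddD h1 (is_ddM (is_dd_cst c u z) h2)).
  by move=> /ddE_is_dd; rewrite /wirt => ->; rewrite !mul0r !add0r.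
have sw := Schwarz 1 'i oW hf Wz.
rewrite /(wirt a _ z) /(wirt b _ z) !key -sw.
move: (dd _ _ z) (dd _ _ z) (dd _ _ z) => x y t; ring.
Qed.

(** d''d'f = d'd''f = 0; the commutation is Schwarz's theorem. *)
Lemma hl_wirt_hl W f : open W -> hl W f -> hl W (wirt (- 'i) f).
Proof.
move=> oW hf; apply: wirtbar_hl => [k|z Wz]; first by apply: Ck_wirt => //; exact: hf.1.
rewrite (wirt_comm _ _ oW (hf.1 2%N) Wz).
apply: (wirt0 _ oW _ Wz) => w; exact: hl_wirtbar.
Qed.

Lemma hl_cst W (c : C) : open W -> hl W (fun=> c).
Proof.
by move=> oW; apply: wirtbar_hl => [k|z Wz]; [exact: Ck_cst|exact: wirt_cst].
Qed.

Lemma hlM W f g : open W -> hl W f -> hl W g -> hl W (fun z => f z * g z).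
Proof.
move=> oW hf hg; apply: wirtbar_hl => [k|z Wz]; first by apply: CkM => //; [apply:
    hf.1|apply: hg.1].
by rewrite (wirtM _ (hf.1 1%N) (hg.1 1%N) Wz) !(hl_wirtbar _ Wz) // mul0r mulr0 addr0.
Qed.

(** Apply d'' to f * f^-1 = 1. *)
Lemma hlV W f : open W -> (forall z, W z -> f z != 0) -> hl W f ->
  hl W (fun z => (f z)^-1).
Proof.
move=> oW f0 hf; have hV k : Ck k W (fun z => (f z)^-1) by apply: CkV => //; exact: hf.1.
apply: wirtbar_hl => [k|z Wz]; first exact: hV.
have := wirtM 'i (hf.1 1%N) (hV 1%N) Wz; rewrite (hl_wirtbar hf Wz) mul0r add0r.
rewrite (wirt_ext (f := fun=> 1) _ oW) //; last exact: Ck_cst.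
  by rewrite wirt_cst => /esym/eqP; rewrite mulf_eq0 (negPf (f0 _ Wz)) /= => /eqP.
by move=> w Ww; rewrite mulfV // f0.
Qed.

Lemma hl_comp U W f G : open U -> open W -> (forall z, W z -> U (G z)) ->
  hl U f -> hl W G -> hl W (fun z => f (G z)).
Proof.
move=> oU oW UW hf hG; apply: wirtbar_hl => [k|z Wz].
  by apply: (Ck_comp oU) => //; [exact: hf.1|exact: hG.1].
rewrite (wirt_comp oU (hf.1 1%N) hG Wz (UW _ Wz)); last by left.
by rewrite (hl_wirtbar hf) ?mul0r //; exact: UW.
Qed.

Lemma hl_comp_dd U W f G z : open U -> hl U f -> hl W G -> W z -> U (G z) ->
  dd 1 (fun w => f (G w)) z = dd 1 f (G z) * dd 1 G z.
Proof.
move=> oU hf hG Wz Uz.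
have h1 := Ck_is_dd 1 (hG.1 1%N) Wz.
rewrite (ddE_is_dd (is_dd_comp oU (hf.1 1%N) Uz h1)) (hf.2 _ Uz).
move: (dd 1 f (G z)) (dd 1 G z) => p d.
by rewrite -{3}(partsK d); ring.
Qed.

End Wirtinger.

(** * Conjugate transposes and change of frame for Gram matrices *)

Section ConjugateTranspose.
Variable C : numClosedFieldType.

Lemma mulmx1_invmx r (M N : 'M[C]_r) : M *m N = 1%:M -> invmx M = N.
Proof.
by move=> h; have [uM _] := mulmx1_unit h; rewrite -[RHS](mulKmx uM) h mulmx1.
Qed.

Lemma mulmx1_unitmx r (M N : 'M[C]_r) : M *m N = 1%:M -> M \in unitmx.
Proof. by move=> h; have [] := mulmx1_unit h. Qed.

Lemma trmxC_mul r s t (M : 'M[C]_(r, s)) (N : 'M[C]_(s, t)) : (M *m N)^t* = N^t* *m M^t*.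
Proof. by rewrite trmx_mul map_mxM. Qed.

Lemma trmxC_unit r (M : 'M[C]_r) : (M^t* \in unitmx) = (M \in unitmx).
Proof. by rewrite map_unitmx unitmx_tr. Qed.

Lemma trmxC_scale r s (t : C) (M : 'M[C]_(r, s)) : (t *: M)^t* = t^* *: M^t*.
Proof. by rewrite linearZ /= map_mxZ. Qed.

Lemma invmx_sandwich r (A K : 'M[C]_r) : A \in unitmx -> K \in unitmx ->
  invmx (A^t* *m K *m A) = invmx A *m invmx K *m invmx (A^t*).
Proof.
move=> uA uK; apply: mulmx1_invmx.
by rewrite !mulmxA mulmxK // mulmxK // mulmxV // trmxC_unit.
Qed.

Lemma mulmx_conj r (X Y P Q : 'M[C]_r) : Y *m X = 1%:M ->
  (X *m P *m Y) *m (X *m Q *m Y) = X *m (P *m Q) *m Y.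
Proof. by move=> h; rewrite !mulmxA -(mulmxA _ Y X) h mulmx1. Qed.

(** A is an isometry from the Gram matrix h to K and conjugates F to D, hence it also conjugates
    their adjoints. *)
Lemma intertwine_normal r (A K D F : 'M[C]_r) : A \in unitmx -> K \in unitmx ->
  A *m F = D *m A ->
  D *m (invmx K *m D^t* *m K) = invmx K *m D^t* *m K *m D ->
  let h := A^t* *m K *m A in
  F *m (invmx h *m F^t* *m h) = invmx h *m F^t* *m h *m F.
Proof.
move=> uA uK AF nD h.
have FE : F = invmx A *m D *m A by rewrite -mulmxA -AF mulKmx.
have uAC : A^t* \in unitmx by rewrite trmxC_unit.
have adE : invmx h *m F^t* *m h = invmx A *m (invmx K *m D^t* *m K) *m A.
  have FC : F^t* = A^t* *m D^t* *m invmx (A^t*).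
    by rewrite FE !trmxC_mul -map_invmx trmx_inv mulmxA.
  by rewrite /h (invmx_sandwich uA uK) FC !mulmxA !(mulmxKV uAC).
have AV : A *m invmx A = 1%:M by rewrite mulmxV.
by rewrite adE FE !(mulmx_conj _ _ AV) nD.
Qed.

End ConjugateTranspose.

(** * Flatness of matrix-valued metrics *)

Section SmoothMatrices.
Variable R : realType.
Local Notation C := (Cplx R).
Local Notation Ck := (@Ck R (Cplx R)^o).
Local Notation dd := (@dir_deriv R (Cplx R)^o).
Implicit Types (f g G : C -> C) (a z w : C) (U W : set C) (k : nat).

Definition Ckm r s k W (M : C -> 'M[C]_(r, s)) := forall i j, Ck k W (fun z => M z i j).
Definition hlm r s W (M : C -> 'M[C]_(r, s)) := forall i j, hl W (fun z => M z i j).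
Definition wmx r s a (M : C -> 'M[C]_(r, s)) z : 'M[C]_(r, s) :=
  \matrix_(i, j) wirt a (fun w => M w i j) z.
(** Vanishing curvature d''(M^-1 d'M) of the Chern connection, M being the Gram matrix in a
    holomorphic frame over a plane domain. *)
Definition flatmx r W (M : C -> 'M[C]_r) :=
  forall z, W z -> wmx 'i (fun w => invmx (M w) *m wmx (- 'i) M w) z = 0.

Lemma wmx_ext r s W (M N : C -> 'M[C]_(r, s)) a z : open W ->
  (forall w, W w -> M w = N w) -> W z -> Ckm 1 W M -> wmx a N z = wmx a M z.
Proof.
move=> oW MN Wz hM; apply/matrixP => i j; rewrite !mxE.
have e w : W w -> M w i j = N w i j by move=> /MN ->.
exact: (wirt_ext a oW e Wz (hM i j)).
Qed.

Lemma Ckm_ext r s k W (M N : C -> 'M[C]_(r, s)) : open W ->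
  (forall w, W w -> M w = N w) -> Ckm k W M -> Ckm k W N.
Proof.
move=> oW MN hM i j; apply: (Ck_ext oW _ (hM i j)) => w /MN ->; by [].
Qed.

Lemma CkmM r s t k W (M : C -> 'M[C]_(r, s)) (N : C -> 'M[C]_(s, t)) : open W ->
  Ckm k W M -> Ckm k W N -> Ckm k W (fun z => M z *m N z).
Proof.
move=> oW hM hN i j.
have e w : W w -> \sum_l M w i l * N w l j = (M w *m N w) i j by rewrite mxE.
apply: (Ck_ext oW e); apply: (Ck_sum _ _ (F := fun l w => M w i l * N w l j)) => // l.
exact: (CkM oW (hM i l) (hN l j)).
Qed.

Lemma CkmD r s k W (M N : C -> 'M[C]_(r, s)) : open W ->
  Ckm k W M -> Ckm k W N -> Ckm k W (fun z => M z + N z).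
Proof.
move=> oW hM hN i j.
have e w : W w -> M w i j + N w i j = (M w + N w) i j by rewrite mxE.
exact: (Ck_ext oW e (CkD oW (hM i j) (hN i j))).
Qed.

Lemma CkmZ r s k W f (M : C -> 'M[C]_(r, s)) : open W ->
  Ck k W f -> Ckm k W M -> Ckm k W (fun z => f z *: M z).
Proof.
move=> oW hf hM i j.
have e w : W w -> f w * M w i j = (f w *: M w) i j by rewrite mxE.
exact: (Ck_ext oW e (CkM oW hf (hM i j))).
Qed.

Lemma Ckm_ct r s k W (M : C -> 'M[C]_(r, s)) : open W ->
  Ckm k W M -> Ckm k W (fun z => (M z)^t*).
Proof.
move=> oW hM i j.
have e w : W w -> (M w j i)^* = ((M w)^t*) i j by rewrite !mxE.
exact: (Ck_ext oW e (Ck_conj oW (hM j i))).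
Qed.

Lemma Ckm_wmx r s k W a (M : C -> 'M[C]_(r, s)) : open W ->
  Ckm k.+1 W M -> Ckm k W (wmx a M).
Proof.
move=> oW hM i j.
have e w : W w -> wirt a (fun w => M w i j) w = wmx a M w i j by rewrite mxE.
exact: (Ck_ext oW e (Ck_wirt a oW (hM i j))).
Qed.

Lemma wmxM r s t W (M : C -> 'M[C]_(r, s)) (N : C -> 'M[C]_(s, t)) a z : open W ->
  Ckm 1 W M -> Ckm 1 W N -> W z ->
  wmx a (fun w => M w *m N w) z = wmx a M z *m N z + M z *m wmx a N z.
Proof.
move=> oW hM hN Wz; apply/matrixP => i j; rewrite !mxE.
have e w : W w -> \sum_l M w i l * N w l j = (M w *m N w) i j by rewrite mxE.
have h l : Ck 1 W (fun w => M w i l * N w l j) by exact: (CkM oW (hM i l) (hN l j)).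
rewrite (wirt_ext a oW e Wz); last first.
  by apply: (Ck_sum _ _ (F := fun l w => M w i l * N w l j)).
rewrite (wirt_sum _ (F := fun l w => M w i l * N w l j) _ oW h Wz) -big_split /=.
by apply: eq_bigr => l _; rewrite !mxE (wirtM a (hM i l) (hN l j) Wz).
Qed.

Lemma wmxD r s W (M N : C -> 'M[C]_(r, s)) a z : open W ->
  Ckm 1 W M -> Ckm 1 W N -> W z ->
  wmx a (fun w => M w + N w) z = wmx a M z + wmx a N z.
Proof.
move=> oW hM hN Wz; apply/matrixP => i j; rewrite !mxE.
have e w : W w -> M w i j + N w i j = (M w + N w) i j by rewrite mxE.
have h := CkD oW (hM i j) (hN i j).
by rewrite (wirt_ext a oW e Wz h) (wirtD a (hM i j) (hN i j) Wz).
Qed.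

Lemma wmxZ r s W f (M : C -> 'M[C]_(r, s)) a z : open W ->
  Ck 1 W f -> Ckm 1 W M -> W z ->
  wmx a (fun w => f w *: M w) z = wirt a f z *: M z + f z *: wmx a M z.
Proof.
move=> oW hf hM Wz; apply/matrixP => i j; rewrite !mxE.
have e w : W w -> f w * M w i j = (f w *: M w) i j by rewrite mxE.
by rewrite (wirt_ext a oW e Wz (CkM oW hf (hM i j))) (wirtM a hf (hM i j) Wz).
Qed.

Lemma wmx_cst r s a (M : 'M[C]_(r, s)) z : wmx a (fun=> M) z = 0.
Proof. by apply/matrixP => i j; rewrite !mxE wirt_cst. Qed.

Lemma Ckm_cst r s k W (M : 'M[C]_(r, s)) : open W -> Ckm k W (fun=> M).
Proof. by move=> oW i j; exact: Ck_cst. Qed.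

Lemma wmx_ct r s W (M : C -> 'M[C]_(r, s)) a z : open W -> Ckm 1 W M -> W z ->
  wmx a (fun w => (M w)^t*) z = (wmx a^* M z)^t*.
Proof.
move=> oW hM Wz; apply/matrixP => i j; rewrite !mxE.
have e w : W w -> (M w j i)^* = ((M w)^t*) i j by rewrite !mxE.
by rewrite (wirt_ext a oW e Wz (Ck_conj oW (hM j i))) (wirt_conj a (hM j i) Wz).
Qed.

Lemma wmx_hl r s W (M : C -> 'M[C]_(r, s)) z : hlm W M -> W z -> wmx 'i M z = 0.
Proof. by move=> hM Wz; apply/matrixP => i j; rewrite !mxE (hl_wirtbar (hM i j) Wz). Qed.

Lemma hlm_wmx r s W (M : C -> 'M[C]_(r, s)) : open W -> hlm W M -> hlm W (wmx (- 'i) M).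
Proof.
move=> oW hM i j; have := hl_wirt_hl oW (hM i j).
by congr (hl _ _); apply/funext => w; rewrite mxE.
Qed.

Lemma Ck_det r k W (M : C -> 'M[C]_r) : open W -> Ckm k W M -> Ck k W (fun z => \det (M z)).
Proof.
move=> oW hM; rewrite /determinant.
apply: (Ck_sum _ _ (F := fun (s : 'S_r) w => (-1) ^+ s * \prod_i M w i (s i))) => // s.
apply: CkM => //; first exact: Ck_cst.
by apply: (Ck_prod _ _ (F := fun i w => M w i (s i))).
Qed.

(** By Cramer's rule the entries are cofactors divided by the determinant. *)
Lemma Ckm_inv r k W (M : C -> 'M[C]_r) : open W -> (forall z, W z -> M z \in unitmx) ->
  Ckm k W M -> Ckm k W (fun z => invmx (M z)).
Proof.
move=> oW uM hM i j.
have e w : W w -> (\det (M w))^-1 *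
    ((-1) ^+ (j + i) * \det (row' j (col' i (M w)))) = (invmx (M w)) i j.
  by move=> /uM uw; rewrite /invmx uw !mxE.
have d0 z : W z -> \det (M z) != 0 by move=> /uM; rewrite unitmxE unitfE.
apply: (Ck_ext oW e); apply: (CkM oW (CkV oW d0 (Ck_det oW hM))).
apply: CkM => //; first exact: Ck_cst.
apply: Ck_det => // i' j'; have := hM (lift j i') (lift i j').
by congr (Defs.Ck _ _ _); apply/funext => w; rewrite !mxE.
Qed.

Lemma wmx_inv r W (M : C -> 'M[C]_r) a z : open W -> (forall z, W z -> M z \in unitmx) ->
  Ckm 1 W M -> W z ->
  wmx a (fun w => invmx (M w)) z = - (invmx (M z) *m wmx a M z *m invmx (M z)).
Proof.
move=> oW uM hM Wz; have hV := Ckm_inv oW uM hM; have uz := uM z Wz.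
have e w : W w -> 1%:M = M w *m invmx (M w) by move=> /uM uw; rewrite mulmxV.
have := wmxM a oW hM hV Wz; rewrite (wmx_ext a oW e Wz) ?wmx_cst; last exact: Ckm_cst.
move=> /esym/eqP; rewrite addrC addr_eq0 => /eqP h.
by have := mulKmx uz (wmx a (fun w => invmx (M w)) z); rewrite h mulmxN mulmxA => <-.
Qed.

(* [h^-1 dh = A^-1 (K^-1 dK) A + A^-1 dA] for holomorphic [A]. *)
Lemma flatmx_sandwich r W (A K : C -> 'M[C]_r) : open W ->
  hlm W A -> (forall z, W z -> A z \in unitmx) ->
  (forall k, Ckm k W K) -> (forall z, W z -> K z \in unitmx) ->
  flatmx W K -> flatmx W (fun w => (A w)^t* *m K w *m A w).
Proof.
move=> oW hA uA sK uK fK z Wz.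
have sA k : Ckm k W A by move=> i j; exact: (hA i j).1.
have sA' k : Ckm k W (fun w => (A w)^t*) by exact: (Ckm_ct oW (sA k)).
have sAV k : Ckm k W (fun w => invmx (A w)) by exact: (Ckm_inv oW uA (sA k)).
have sKV k : Ckm k W (fun w => invmx (K w)) by exact: (Ckm_inv oW uK (sK k)).
have sD k : Ckm k W (wmx (- 'i) A) by exact: (Ckm_wmx _ oW (sA k.+1)).
have sKK k : Ckm k W (fun w => invmx (K w) *m wmx (- 'i) K w).
  exact: (CkmM oW (sKV k) (Ckm_wmx _ oW (sK k.+1))).
have e w : W w ->
    invmx (A w) *m (invmx (K w) *m wmx (- 'i) K w) *m A w + invmx (A w) *m wmx (- 'i) A w =
    invmx ((A w)^t* *m K w *m A w) *m wmx (- 'i) (fun w => (A w)^t* *m K w *m A w) w.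
  move=> Ww; rewrite invmx_sandwich ?uA ?uK //.
  rewrite (wmxM _ oW (CkmM oW (sA' 1%N) (sK 1%N)) (sA 1%N) Ww).
  rewrite (wmxM _ oW (sA' 1%N) (sK 1%N) Ww) (wmx_ct _ oW (sA 1%N) Ww).
  (* d' of A^* is the adjoint of d''A, which vanishes as A is holomorphic. *)
  have -> : ((- 'i)^* : C) = 'i by rewrite rmorphN /= conjCi opprK.
  rewrite (wmx_hl hA Ww).
  have -> : (0 : 'M[C]_r)^t* = 0 by apply/matrixP => i j; rewrite !mxE conjC0.
  have uA' : (A w)^t* \in unitmx by rewrite trmxC_unit uA.
  rewrite mul0mx add0r mulmxDr; congr (_ + _).
    by rewrite -!mulmxA (mulKmx uA').
  by rewrite -!mulmxA (mulKmx uA') (mulKmx (uK _ Ww)).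
have sS : Ckm 1 W (fun w => invmx (A w) *m (invmx (K w) *m wmx (- 'i) K w)).
  exact: (CkmM oW (sAV 1%N) (sKK 1%N)).
have sT : Ckm 1 W (fun w => invmx (A w) *m wmx (- 'i) A w).
  exact: (CkmM oW (sAV 1%N) (sD 1%N)).
have sS' : Ckm 1 W (fun w => invmx (A w) *m (invmx (K w) *m wmx (- 'i) K w) *m A w).
  exact: (CkmM oW sS (sA 1%N)).
rewrite (wmx_ext 'i oW e Wz (CkmD oW sS' sT)) (wmxD _ oW sS' sT Wz).
have h1 := wmxM 'i oW sS (sA 1%N) Wz; have h2 := wmxM 'i oW (sAV 1%N) (sKK 1%N) Wz.
have h3 := wmxM 'i oW (sAV 1%N) (sD 1%N) Wz; have h4 := wmx_inv 'i oW uA (sA 1%N) Wz.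
rewrite h1 h2 h3 h4 (fK _ Wz) (wmx_hl hA Wz) (wmx_hl (hlm_wmx oW hA) Wz).
by rewrite !(mulmx0, mul0mx, oppr0, addr0).
Qed.

Lemma Ck_normV k W f : open W -> (forall z, W z -> f z != 0) -> Ck k W f ->
  Ck k W (fun z => `|f z|^-1).
Proof.
move=> oW f0 hf; apply: CkV => // [z /f0|]; first by rewrite normr_eq0.
exact: Ck_norm.
Qed.

(** This is d' log |f|^-1 = - (1/2) d' log f. It comes from differentiating |f|^-2 f f^* = 1, where
    d' kills the conjugate. *)
Lemma log_norm_wirt W f z : open W -> (forall z, W z -> f z != 0) -> hl W f -> W z ->
  `|f z| * wirt (- 'i) (fun w => `|f w|^-1) z = - 2^-1 * (wirt (- 'i) f z * (f z)^-1).
Proof.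
move=> oW f0 hf Wz; have fz := f0 _ Wz; have nz : `|f z| != 0 by rewrite normr_eq0.
pose r w := `|f w|^-1; have hr : Ck 1 W r by apply: Ck_normV => //; exact: hf.1.
have h1 := hf.1 1%N; have hc := Ck_conj oW h1.
have hrr := CkM oW hr hr; have hff := CkM oW h1 hc.
have e w : W w -> 1 = (r w * r w) * (f w * (f w)^*).
  move=> /f0 fw; rewrite /r -normCK -invfM -expr2 mulVf //.
  by rewrite expf_neq0 // normr_eq0.
have := wirtM (- 'i) hrr hff Wz.
rewrite (wirt_ext (- 'i) oW e Wz (Ck_cst 1 1 oW)) wirt_cst.
rewrite (wirtM _ hr hr Wz) (wirtM _ h1 hc Wz) (wirt_conj _ h1 Wz).
have -> : ((- 'i)^* : C) = 'i by rewrite rmorphN /= conjCi opprK.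
rewrite (hl_wirtbar hf Wz) conjC0 mulr0 addr0.
move: (wirt _ r z) (wirt _ f z) => dr df; rewrite /r.
have ->  : (f z)^* = `|f z| ^+ 2 / f z by rewrite normCK mulrC mulKf.
move: (`|f z|) nz => n nz; move: (f z) fz => x x0 h.
have {}h : (2 * (n * dr) + df / x) = 0.
  by rewrite [RHS]h; field; rewrite nz x0.
have -> : n * dr = 2^-1 * ((2 * (n * dr) + df / x) - df / x) by field.
by rewrite h sub0r mulrN mulNr.
Qed.

(** The weight adds to the connection matrix the scalar of [log_norm_wirt], which is holomorphic and
    so has no curvature. *)
Lemma flatmx_twist r W f (N : C -> 'M[C]_r) : open W -> (forall z, W z -> f z != 0) ->
  hl W f -> (forall k, Ckm k W N) -> (forall z, W z -> N z \in unitmx) ->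
  flatmx W N -> flatmx W (fun w => `|f w|^-1 *: N w).
Proof.
move=> oW f0 hf sN uN fN z Wz.
have sr k : Ck k W (fun w => `|f w|^-1) by apply: Ck_normV => //; exact: hf.1.
have sV k : Ckm k W (fun w => invmx (N w)) by exact: (Ckm_inv oW uN (sN k)).
pose q w := - 2^-1 * (wirt (- 'i) f w * (f w)^-1).
have hq : hl W q.
  apply: hlM => //; first exact: hl_cst.
  by apply: hlM => //; [exact: hl_wirt_hl|exact: hlV].
have e w : W w -> q w *: 1%:M + invmx (N w) *m wmx (- 'i) N w =
    invmx (`|f w|^-1 *: N w) *m wmx (- 'i) (fun w => `|f w|^-1 *: N w) w.
  move=> Ww; have n0 : `|f w| != 0 by rewrite normr_eq0 f0.
  rewrite (wmxZ _ oW (sr 1%N) (sN 1%N) Ww) mulmxDr /q -(log_norm_wirt oW f0 hf Ww).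
  have -> : invmx (`|f w|^-1 *: N w) = `|f w| *: invmx (N w).
    apply: mulmx1_invmx; rewrite -scalemxAl -scalemxAr scalerA mulVf // scale1r.
    by rewrite mulmxV // uN.
  rewrite -!scalemxAl -!scalemxAr !scalerA mulfV // scale1r; congr (_ + _).
  by rewrite mulVmx // uN.
have s1 : Ckm 1 W (fun w => q w *: (1%:M : 'M[C]_r)).
  exact: (CkmZ oW (hq.1 1%N) (Ckm_cst 1 _ oW)).
have s2 : Ckm 1 W (fun w => invmx (N w) *m wmx (- 'i) N w).
  exact: (CkmM oW (sV 1%N) (Ckm_wmx _ oW (sN 2%N))).
rewrite (wmx_ext 'i oW e Wz (CkmD oW s1 s2)) (wmxD _ oW s1 s2 Wz) fN // addr0.
rewrite (wmxZ _ oW (hq.1 1%N) _ Wz); last exact: Ckm_cst.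
by rewrite wmx_cst scaler0 addr0 (hl_wirtbar hq Wz) scale0r.
Qed.

Lemma Ckm_comp r s k U W (N : C -> 'M[C]_(r, s)) G : open U -> open W ->
  (forall z, W z -> U (G z)) -> Ckm k U N -> Ck k W G -> Ckm k W (fun w => N (G w)).
Proof.
move=> oU oW UW sN sG i j.
exact: (Ck_comp (f := fun w => N w i j) oU oW UW (sN i j) sG).
Qed.

(** The connection matrix pulls back to G' times its composite with G. G' is holomorphic, and d'' of
    the composite is a multiple of the curvature at G. *)
Lemma flatmx_comp r U W (N : C -> 'M[C]_r) G : open U -> open W ->
  (forall z, W z -> U (G z)) -> hl W G -> (forall k, Ckm k U N) ->
  (forall z, U z -> N z \in unitmx) ->
  flatmx U N -> flatmx W (fun w => N (G w)).
Proof.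
move=> oU oW UW hG sN uN fN z Wz.
have sV k : Ckm k U (fun w => invmx (N w)) by exact: (Ckm_inv oU uN (sN k)).
pose P w := invmx (N w) *m wmx (- 'i) N w.
have sP k : Ckm k U P by exact: (CkmM oU (sV k) (Ckm_wmx _ oU (sN k.+1))).
have nii : ((- 'i : C) == 'i) = false by rewrite eqNr (negPf (neq0Ci _)).
have hd : hl W (wirt (- 'i) G) by exact: hl_wirt_hl.
have e w : W w -> wirt (- 'i) G w *: P (G w) =
    invmx (N (G w)) *m wmx (- 'i) (fun w => N (G w)) w.
  move=> Ww; rewrite /P scalemxAr; congr (_ *m _); apply/matrixP => i j; rewrite !mxE.
  rewrite (wirt_comp (f := fun w => N w i j) oU (sN 1%N i j) hG Ww (UW _ Ww)); last by right.
  by rewrite nii (hl_wirt hG Ww) mulrC.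
have sPG k : Ckm k W (fun w => P (G w)) by exact: (Ckm_comp oU oW UW (sP k) (hG.1 k)).
rewrite (wmx_ext 'i oW e Wz (CkmZ oW (hd.1 1%N) (sPG 1%N))).
rewrite (wmxZ _ oW (hd.1 1%N) (sPG 1%N) Wz) (hl_wirtbar hd Wz) scale0r add0r.
suff -> : wmx 'i (fun w => P (G w)) z = 0 by rewrite scaler0.
apply/matrixP => i j; rewrite !mxE.
rewrite (wirt_comp (f := fun w => P w i j) oU (sP 1%N i j) hG Wz (UW _ Wz)); last by left.
have := fN _ (UW _ Wz) => /matrixP/(_ i j); rewrite !mxE => ->.
by rewrite mul0r.
Qed.

End SmoothMatrices.

(** * Block-diagonal forms *)

Section Blocks.
Variable R : realType.
Local Notation C := (Cplx R).
Variable n : nat.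

(* The coordinate [i] of C^(n+n) is the coordinate [bpos i] of the [blk i]-th
   copy of C^2; this matches the block form of [std_symplectic]. *)
Definition blk (i : 'I_(n + n)) : 'I_n := match fintype.split i with inl k => k | inr k => k end.
Definition bpos (i : 'I_(n + n)) : 'I_(1 + 1) :=
  match fintype.split i with inl _ => lshift 1 ord0 | inr _ => rshift 1 ord0 end.

Lemma blk_lshift k : blk (lshift n k) = k.
Proof. by rewrite /blk (unsplitK (inl k)). Qed.
Lemma blk_rshift k : blk (rshift n k) = k.
Proof. by rewrite /blk (unsplitK (inr k)). Qed.
Lemma bpos_lshift k : bpos (lshift n k) = lshift 1 ord0.
Proof. by rewrite /bpos (unsplitK (inl k)). Qed.
Lemma bpos_rshift k : bpos (rshift n k) = rshift 1 ord0.
Proof. by rewrite /bpos (unsplitK (inr k)). Qed.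
Definition blkE := (blk_lshift, blk_rshift, bpos_lshift, bpos_rshift).

Lemma blk_inj i j : blk i = blk j -> bpos i = bpos j -> i = j.
Proof.
by rewrite -(splitK i) -(splitK j); case: (fintype.split i) => k; case: (fintype.split j) => l /=;
  rewrite !blkE // => ->.
Qed.

Lemma sum_blk (F : 'I_n -> 'I_(1 + 1) -> C) :
  \sum_i F (blk i) (bpos i) = \sum_k \sum_e F k e.
Proof.
rewrite big_split_ord /= -big_split /=; apply: eq_bigr => k _.
by rewrite !blkE big_split_ord !big_ord1.
Qed.

(** The matrix of v |-> (A_k v)_k into n copies of C^2. With A_k = [eps] at the k-th point of a
    fibre it compares E_x with the sum of the fibres of E_2. *)
Definition stk m (A : 'I_n -> 'M[C]_(1 + 1, m)) : 'M[C]_(n + n, m) :=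
  \matrix_(i, j) A (blk i) (bpos i) j.
Definition bdiag (P : 'I_n -> 'M[C]_(1 + 1)) : 'M[C]_(n + n) :=
  \matrix_(i, j) if blk i == blk j then P (blk i) (bpos i) (bpos j) else 0.

Lemma bdiag_stk m P (A : 'I_n -> 'M[C]_(1 + 1, m)) :
  bdiag P *m stk A = stk (fun k => P k *m A k).
Proof.
apply/matrixP => i j; rewrite !mxE.
transitivity (\sum_k \sum_e (if blk i == k then P (blk i) (bpos i) e else 0) * A k e j).
  by rewrite -(sum_blk (fun k e => (if blk i == k then P (blk i) (bpos i) e else 0) * A k e j));
    apply: eq_bigr => l _; rewrite !mxE.
rewrite (bigD1 (blk i)) //= [X in _ + X]big1 ?addr0 => [|k ki].
  by apply: eq_bigr => e _; rewrite eqxx.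
by apply: big1 => e _; rewrite eq_sym (negPf ki) mul0r.
Qed.

Lemma bdiagE P : bdiag P =
  stk (fun k => \matrix_(e, j) if k == blk j then P k e (bpos j) else 0).
Proof. by apply/matrixP => i j; rewrite !mxE. Qed.

Lemma bdiagM P Q : bdiag P *m bdiag Q = bdiag (fun k => P k *m Q k).
Proof.
rewrite [bdiag Q]bdiagE bdiag_stk bdiagE; congr stk; apply/funext => k.
apply/matrixP => e j; rewrite !mxE; case: eqP => h.
  by apply: eq_bigr => l _; rewrite mxE h eqxx.
by apply: big1 => l _; rewrite mxE; case: eqP => // _; rewrite mulr0.
Qed.

Lemma stk_tr m p (A : 'I_n -> 'M[C]_(1 + 1, m)) (B : 'I_n -> 'M[C]_(1 + 1, p)) :
  (stk A)^T *m stk B = \sum_k (A k)^T *m B k.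
Proof.
apply/matrixP => i j; rewrite mxE summxE.
transitivity (\sum_k \sum_e A k e i * B k e j).
  by rewrite -(sum_blk (fun k e => A k e i * B k e j)); apply: eq_bigr => l _; rewrite !mxE.
by apply: eq_bigr => k _; rewrite mxE; apply: eq_bigr => e _; rewrite mxE.
Qed.

Lemma stk_trC m p (A : 'I_n -> 'M[C]_(1 + 1, m)) (B : 'I_n -> 'M[C]_(1 + 1, p)) :
  (stk A)^t* *m stk B = \sum_k (A k)^t* *m B k.
Proof.
have -> : (stk A)^t* = (stk (fun k => map_mx Num.conj (A k)))^T.
  by apply/matrixP => i j; rewrite !mxE.
by rewrite stk_tr; apply: eq_bigr => k _; rewrite map_trmx.
Qed.

Lemma bdiag1 : bdiag (fun=> 1%:M) = 1%:M.
Proof.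
apply/matrixP => i j; rewrite !mxE; case: eqP => h.
  by congr ((_ : bool)%:R); apply/eqP/eqP => [/(blk_inj h)//|-> //].
by case: (i =P j) => // ij; case: h; rewrite ij.
Qed.

Lemma bdiag_tr P : (bdiag P)^T = bdiag (fun k => (P k)^T).
Proof. by apply/matrixP => i j; rewrite !mxE eq_sym; case: eqP => // ->. Qed.

Lemma bdiag_trC P : (bdiag P)^t* = bdiag (fun k => (P k)^t*).
Proof.
apply/matrixP => i j; rewrite !mxE eq_sym; case: eqP => [->//|_]; exact: conjC0.
Qed.

Lemma bdiag_inv P : (forall k, P k \in unitmx) ->
  bdiag P \in unitmx /\ invmx (bdiag P) = bdiag (fun k => invmx (P k)).
Proof.
move=> uP; have h : bdiag P *m bdiag (fun k => invmx (P k)) = 1%:M.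
  by rewrite bdiagM -bdiag1; congr bdiag; apply/funext => k; rewrite mulmxV.
by split; [exact: mulmx1_unitmx h|exact: mulmx1_invmx].
Qed.

End Blocks.

Section BlockSymplectic.
Variable R : realType.
Local Notation C := (Cplx R).

Lemma std_symplecticE n (i j : 'I_(n + n)) : std_symplectic R n i j =
  (if blk i == blk j then std_symplectic R 1 (bpos i) (bpos j) else 0) :> C.
Proof.
rewrite -(splitK i) -(splitK j); case: (fintype.split i) => k; case: (fintype.split j) => l /=;
  rewrite !blkE /std_symplectic !(block_mxEul, block_mxEur, block_mxEdl, block_mxEdr) !mxE
    ?eqxx; by case: eqP => //= _; rewrite ?mulr0n ?oppr0.
Qed.

Lemma bdiag_std n : bdiag (fun _ : 'I_n => std_symplectic R 1) = std_symplectic R n :>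
    'M[C]_(n + n).
Proof. by apply/matrixP => i j; rewrite [RHS]std_symplecticE [LHS]mxE. Qed.

Variable n : nat.
Variables (a : 'I_n -> 'M[C]_(1 + 1, n + n)).
Let A := stk a.

Lemma stk_form (K : 'I_n -> 'M[C]_(1 + 1)) :
  \sum_k (a k)^T *m K k *m a k = A^T *m bdiag K *m A.
Proof.
by rewrite -mulmxA bdiag_stk stk_tr; apply: eq_bigr => k _; rewrite mulmxA.
Qed.

Lemma stk_formC (K : 'I_n -> 'M[C]_(1 + 1)) :
  \sum_k (a k)^t* *m K k *m a k = A^t* *m bdiag K *m A.
Proof.
by rewrite -mulmxA bdiag_stk stk_trC; apply: eq_bigr => k _; rewrite mulmxA.
Qed.

Hypothesis uA : A \in unitmx.

(** Each term is nonnegative, and injectivity of A provides a k with a_k v nonzero. *)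
Lemma stk_positive (K : 'I_n -> 'M[C]_(1 + 1)) :
  (forall k (v : 'cV[C]_(1 + 1)), v != 0 -> 0 < (v^t* *m K k *m v) 0 0) ->
  forall v : 'cV[C]_(n + n), v != 0 -> 0 < (v^t* *m (\sum_k (a k)^t* *m K k *m a k) *m v) 0 0.
Proof.
move=> posK v v0.
have K0 k (w : 'cV[C]_(1 + 1)) : 0 <= (w^t* *m K k *m w) 0 0.
  have [->|/posK/ltW//] := eqVneq w 0; by rewrite mulmx0 mxE.
have -> : (v^t* *m (\sum_k (a k)^t* *m K k *m a k) *m v) 0 0 =
    \sum_k ((a k *m v)^t* *m K k *m (a k *m v)) 0 0.
  rewrite mulmx_sumr mulmx_suml summxE; apply: eq_bigr => k _.
  by rewrite trmxC_mul !mulmxA.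
have [k ak0] : exists k, a k *m v != 0.
  apply: contrapT => h; move/eqP: v0; apply.
  have : A *m v = 0.
    apply/matrixP => i j; rewrite [RHS]mxE.
    have : a (blk i) *m v = 0 by apply: contrapT => h'; apply: h; exists (blk i); apply/eqP.
    move/matrixP/(_ (bpos i) j); rewrite !mxE => h'; rewrite -[RHS]h'.
    by apply: eq_bigr => l _; rewrite mxE.
  by move=> h'; rewrite -[v](mulKmx uA) h' mulmx0.
rewrite (bigD1 k) //= ltr_wpDr //; last exact: posK.
by apply: sumr_ge0 => l _; exact: K0.
Qed.

Lemma mulmx_cancel r s (X Y : 'M[C]_r) (Z : 'M[C]_(r, s)) : X *m Y = 1%:M -> X *m (Y *m Z) = Z.
Proof. by move=> h; rewrite mulmxA h mul1mx. Qed.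

(** One square root s of d serves both structures: s^2/d = 1 for the symplectic form and |s|^2/|d| =
    1 for the metric. This is why the metric carries the modulus of the weight of the form. A^-1
    carries the frame back. *)
Lemma stk_darboux (om K B : 'I_n -> 'M[C]_(1 + 1)) (d : 'I_n -> C) :
  (forall k, d k != 0) ->
  (forall k, (B k)^T *m om k *m B k = std_symplectic R 1) ->
  (forall k, (B k)^t* *m K k *m B k = 1%:M) ->
  exists M : 'M[C]_(n + n),
    M^T *m (\sum_k (a k)^T *m ((d k)^-1 *: om k) *m a k) *m M = std_symplectic R n /\
    M^t* *m (\sum_k (a k)^t* *m (`|d k|^-1 *: K k) *m a k) *m M = 1%:M.
Proof.
move=> d0 h1 h2; pose s k := sqrtC (d k).
have s2 k : s k * s k = d k by rewrite -expr2 sqrtCK.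
have s0 k : s k != 0 by rewrite sqrtC_eq0.
exists (invmx A *m bdiag (fun k => s k *: B k)); split.
  rewrite stk_form trmx_mul !mulmxA (mulmxK uA) -!mulmxA.
  have eA : (invmx A)^T *m A^T = 1%:M by rewrite -trmx_mul mulmxV // trmx1.
  rewrite (mulmx_cancel _ eA).
  rewrite bdiag_tr !bdiagM -bdiag_std; congr bdiag; apply/funext => k.
  rewrite -(h1 k) linearZ /= -!scalemxAl -!scalemxAr !scalerA.
  rewrite [X in X *: _](_ : _ = 1) ?scale1r ?mulmxA //; rewrite -(s2 k); field; exact: s0.
rewrite stk_formC trmxC_mul !mulmxA (mulmxK uA) -!mulmxA.
have eA : (invmx A)^t* *m A^t* = 1%:M.
  by rewrite -trmxC_mul mulmxV // trmx1 map_mx1.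
rewrite (mulmx_cancel _ eA).
rewrite bdiag_trC !bdiagM -bdiag1; congr bdiag; apply/funext => k.
rewrite trmxC_scale.
rewrite -(h2 k) -!scalemxAl -!scalemxAr !scalerA.
rewrite [X in X *: _](_ : _ = 1) ?scale1r ?mulmxA //.
rewrite -(s2 k) normrM -expr2 normCK; field.
by rewrite conjC_eq0 s0.
Qed.

Lemma stk_normal (K D : 'I_n -> 'M[C]_(1 + 1)) (F : 'M[C]_(n + n)) :
  (forall k, K k \in unitmx) -> (forall k, a k *m F = D k *m a k) ->
  (forall k, D k *m adjoint_wrt (K k) (D k) = adjoint_wrt (K k) (D k) *m D k) ->
  let h := \sum_k (a k)^t* *m K k *m a k in
  F *m adjoint_wrt h F = adjoint_wrt h F *m F.
Proof.
move=> uK aF nD h; rewrite /h stk_formC.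
have [ubK eK] := bdiag_inv uK.
have AF : A *m F = bdiag D *m A.
  rewrite bdiag_stk; apply/matrixP => i j.
  have /matrixP/(_ (bpos i) j) := aF (blk i); rewrite !mxE => <-.
  by apply: eq_bigr => l _; rewrite mxE.
apply: (intertwine_normal uA ubK AF).
rewrite eK bdiag_trC !bdiagM; congr bdiag; apply/funext => k; exact: nD.
Qed.

End BlockSymplectic.

(** * Characteristic polynomials of infinitesimally symplectic maps *)

Section SpectralAlgebra.
Variable C : fieldType.

Lemma char_poly_hornerE n (A : 'M[C]_n) t : (char_poly A).[t] = \det (t%:M - A).
Proof.
rewrite /char_poly -[LHS]/(horner_eval t _) -det_map_mx; congr (\det _).
apply/matrixP => i j; rewrite !mxE /= /horner_eval !hornerE.
by case: (i == j); rewrite ?mulr1n ?mulr0n ?hornerX ?horner0.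
Qed.

(** Skewness gives (t - A)^T W = W (t + A), hence det(t - A) = det(t + A). The sign between t + A
    and -t - A is (-1)^(2n). *)
Lemma char_poly_skew_even n (A W : 'M[C]_(n + n)) t : W \in unitmx ->
  A^T *m W = - (W *m A) -> (char_poly A).[- t] = (char_poly A).[t].
Proof.
move=> uW h; rewrite !char_poly_hornerE -[RHS]det_tr.
have e : (t%:M - A)^T *m W = W *m (t%:M + A).
  by rewrite linearB /= tr_scalar_mx mulmxBl h opprK mulmxDr scalar_mxC.
have : \det ((t%:M - A)^T) * \det W = \det W * \det (t%:M + A).
  by rewrite -!det_mulmx e.
rewrite mulrC => /(mulfI _) ->; last by rewrite -unitfE -unitmxE.
have -> : (- t)%:M - A = - (t%:M + A) by rewrite opprD raddfN.
rewrite -scaleN1r detZ; have -> : (-1) ^+ (n + n) = 1 :> C; last by rewrite mul1r.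
by rewrite addnn -signr_odd odd_double.
Qed.

Lemma char_poly_root_conj n (A B T : 'M[C]_n) l : T \in unitmx -> A *m T = T *m B ->
  root (char_poly A) l -> root (char_poly B) l.
Proof.
rewrite unitmxE unitfE /root !char_poly_hornerE => uT h /eqP e.
have : \det (l%:M - A) * \det T = \det T * \det (l%:M - B).
  by rewrite -!det_mulmx mulmxBl mulmxBr h scalar_mxC.
by rewrite e mul0r => /esym/eqP; rewrite mulf_eq0 (negPf uT).
Qed.

(** Adding p(l) and p(-l) cancels the odd part and leaves twice the even part at l^2. *)
Lemma root_even_poly (p : {poly C}) l : (2 : C) != 0 -> p.[- l] = p.[l] -> root p l ->
  root (even_poly p) (l ^+ 2).
Proof.
move=> two e /eqP pl; have := e; rewrite pl.
rewrite -[in LHS](poly_even_odd p) => h.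
have := pl; rewrite -{1}(poly_even_odd p).
move: h; rewrite !hornerE !horner_comp !hornerE sqrrN => h1 h2.
apply/rootP; apply: (mulfI two); rewrite mulr0.
have -> : 2 * (even_poly p).[l ^+ 2] =
  ((even_poly p).[l ^+ 2] + (odd_poly p).[l ^+ 2] * l)
   + ((even_poly p).[l ^+ 2] + (odd_poly p).[l ^+ 2] * - l) by ring.
by rewrite h1 h2 addr0.
Qed.

(** Coefficient n of the even part is the leading coefficient 1 of the characteristic polynomial, so
    the even part is nonzero, and its degree is at most n. *)
Lemma even_char_poly_roots n (A : 'M[C]_(n + n)) (rs : seq C) :
  uniq rs -> (forall x, x \in rs -> root (even_poly (char_poly A)) x) -> (size rs <= n)%N.
Proof.
move=> urs hrs; set p := char_poly A; set q := even_poly p.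
have sp : size p = (n + n).+1 by rewrite size_char_poly.
have qn : q`_n = 1.
  rewrite /q coef_even_poly -addnn; have := char_poly_monic A.
  by rewrite monicE lead_coefE -/p sp => /eqP.
have q0 : q != 0 by apply/eqP => h; move/eqP: qn; rewrite h coef0 eq_sym oner_eq0.
have sq : (size q <= n.+1)%N.
  apply/leq_sizeP => j hj; rewrite /q coef_even_poly nth_default // sp -addnn -addSn.
  by apply: leq_add => //; exact: ltnW.
have := max_poly_roots q0 _ urs; move/(_ (introT allP hrs)) => h.
by have := leq_trans h sq; rewrite ltnS.
Qed.

(** Each term factors through a space of dimension m, and only those with nonzero weight count. *)
Lemma rank_weighted_sum (T : eqType) n m (ys : seq T) (c : T -> C)
    (E : T -> 'M[C]_(m, n)) (W : T -> 'M[C]_m) :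
  (\rank (\sum_(y <- ys) c y *: ((E y)^T *m W y *m E y))%R
    <= m * count (fun y => c y != 0%R) ys)%N.
Proof.
elim: ys => [|y ys IH]; first by rewrite big_nil mxrank0.
rewrite big_cons /= mulnDr; apply: leq_trans (mxrank_add _ _) _; apply: leq_add => //.
have [->|c0] := eqVneq (c y) 0; first by rewrite scale0r mxrank0.
rewrite /= muln1; apply: leq_trans (mxrank_scale _ _) _.
by apply: leq_trans (mxrankM_maxr _ _) _; exact: rank_leq_row.
Qed.

End SpectralAlgebra.

(** * Calculus on Riemann surfaces *)

Section SurfaceCalculus.
Variables (R : realType) (X : riemann_surface R).
Local Notation C := (Cplx R).
Local Notation Ck := (@Ck R (Cplx R)^o).
Local Notation dd := (@dir_deriv R (Cplx R)^o).
Implicit Types (c d : rs_ix X) (x : X) (U V : set X).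

Lemma paramK c z : (coord c @` dom c) z -> coord c (param c z) = z /\ dom c (param c z).
Proof.
by move=> [x cx <-]; rewrite /param /coord (cmapK cx).
Qed.

Lemma coordK c x : dom c x -> param c (coord c x) = x.
Proof. exact: cmapK. Qed.

Lemma dom_open c : open (dom c).
Proof. exact: cdom_open. Qed.

Lemma coord_image_sub c U : coord c @` (U `&` dom c) `<=` coord c @` dom c.
Proof. by move=> z [x [_ cx] <-]; exists x. Qed.

Lemma coord_image_open c U : open U -> open (coord c @` (U `&` dom c)).
Proof.
move=> oU; apply: open_nrm => z [x [Ux cx] ez].
have h1 : nbhs z (coord c @` dom c).
  by apply: open_nbhs_nbhs; split; [exact: cimg_open|exists x].
have h2 : nbhs (coord c x) (param c @^-1` U).
  apply: (cinv_continuous cx); rewrite (cmapK cx).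
  exact: open_nbhs_nbhs.
rewrite ez in h2.
have /near_nrm[r1 r10 hr1] := h1; have /near_nrm[r2 r20 hr2] := h2.
exists (Order.min r1 r2) => [|w]; first by rewrite lt_min r10.
rewrite lt_min => /andP[/hr1/paramK[e dw] /hr2 Uw].
by exists (param c w).
Qed.

Lemma hol_on_hl c U (f : X -> C) : hol_on U f -> hl (coord c @` (U `&` dom c)) (f \o param c).
Proof. by move=> /(_ c)/holo_hl. Qed.

Lemma hol_on_sub U V (f : X -> C) c : V `<=` U -> hol_on U f ->
  hl (coord c @` (V `&` dom c)) (f \o param c).
Proof.
move=> VU /(hol_on_hl c); apply: hl_sub => z [x [Vx cx] <-].
by exists x => //; split => //; exact: VU.
Qed.

Lemma hol_on_neq0_open U (f : X -> C) : open U -> hol_on U f -> open (U `&` [set x | f x != 0]).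
Proof.
move=> oU hf; rewrite openE => x [Ux fx]; have [c cx] := rs_cover x.
have zU : (coord c @` (U `&` dom c)) (coord c x) by exists x.
have h := Ck_continuous ((hol_on_hl c hf).1 0%N) zU.
have f0 : 0 < nrm (f x) by exact: nrm_gt0.
have /continuous_nrm/(_ _ f0)[r r0 hr] := h.
rewrite /= (coordK cx) in hr.
have n1 : nbhs x (coord c @^-1` [set w : C | nrm (w - coord c x) < r]).
  apply: (cmap_continuous cx); apply: open_nbhs_nbhs; split; first exact: open_ball_nrm.
  by rewrite /= subrr nrm0.
have n2 : nbhs x U by apply: open_nbhs_nbhs.
have n3 : nbhs x (dom c) by apply: open_nbhs_nbhs; split=> //; exact: dom_open.
rewrite /interior; apply: filterS (filterI n1 (filterI n2 n3)) => y [/= ny [Uy cy]].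
split=> //; have := hr _ ny; rewrite (coordK cy).
by apply: contraTneq => ->; rewrite sub0r nrmN ltxx.
Qed.

Lemma cder_dd c U (f : X -> C) x : hol_on U f -> U x -> dom c x ->
  cder c f x = dd 1 (f \o param c) (coord c x).
Proof.
move=> hf Ux cx; rewrite /cder ddz_wirt.
by apply: (hl_wirt (hol_on_hl c hf)); exists x.
Qed.

Lemma hl_transition c d : hl (coord c @` (dom c `&` dom d)) (coord d \o param c).
Proof. exact: holo_hl (@rs_trans _ X c d). Qed.

Lemma transition_open c d : open (coord c @` (dom c `&` dom d)).
Proof. by rewrite setIC; apply: coord_image_open; exact: dom_open. Qed.

(** The two transition maps are mutually inverse, so the chain rule makes the product of their
    derivatives 1. *)
Lemma cder_coord_neq0 c d x : dom c x -> dom d x -> cder c (coord d) x != 0.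
Proof.
move=> cx dx; have hU : (coord c @` (dom c `&` dom d)) (coord c x) by exists x.
have hV : (coord d @` (dom d `&` dom c)) (coord d x) by exists x.
have oU := @transition_open c d; have oV := @transition_open d c.
rewrite /cder ddz_wirt (hl_wirt (@hl_transition c d) hU).
have hG : (coord d @` (dom d `&` dom c)) ((coord d \o param c) (coord c x)).
  by rewrite /= (coordK cx).
have := hl_comp_dd oV (@hl_transition d c) (@hl_transition c d) hU hG.
have e w : (coord c @` (dom c `&` dom d)) w ->
    id w = (coord c \o param d) ((coord d \o param c) w).
  by move=> [y [cy dy] <-]; rewrite /= (coordK cy) (coordK dy).
rewrite (dd_ext 1 oU e hU (Ck_id 1 oU)) (ddE_is_dd (is_dd_id 1 _)) => h.
by apply/eqP => h0; move: h; rewrite h0 mulr0 => /eqP; rewrite oner_eq0.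
Qed.

Lemma cder_coord_id c x : dom c x -> cder c (coord c) x = 1.
Proof.
move=> cx; have hU : (coord c @` (dom c `&` dom c)) (coord c x) by exists x.
rewrite /cder ddz_wirt (hl_wirt (@hl_transition c c) hU).
have e w : (coord c @` (dom c `&` dom c)) w -> id w = (coord c \o param c) w.
  by move=> [y [cy dy] <-]; rewrite /= (coordK cy).
have oU := @transition_open c c.
by rewrite (dd_ext 1 oU e hU (Ck_id 1 oU)) (ddE_is_dd (is_dd_id 1 _)).
Qed.

(** Bridge from curvature on the surface to [flatmx]. The inner derivative is taken at
    [coord c (param c w)], which is w only in the image of the chart, so the two connection matrices
    are compared on the open set W alone. *)
Lemma curvature_flatmx r c (h : X -> 'M[C]_r) (W : set C) (z : C) :
  open W -> W `<=` coord c @` dom c -> W z ->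
  (forall k, Ckm k W (fun w => h (param c w))) ->
  (forall w, W w -> h (param c w) \in unitmx) ->
  forall a b,
  cderbar c (fun y => (invmx (h y) *m \matrix_(k, l) cder c (fun z => h z k l) y) a b)
     (param c z) =
  wmx 'i (fun w => invmx (h (param c w)) *m wmx (- 'i) (fun w => h (param c w)) w) z a b.
Proof.
move=> oW WD Wz sh uh a b.
have [ez _] := paramK (WD _ Wz); rewrite /cderbar ez mxE ddzbar_wirt.
pose M w := h (param c w).
have sM k : Ckm k W (fun w => invmx (M w) *m wmx (- 'i) M w).
  exact: (CkmM oW (Ckm_inv oW uh (sh k)) (Ckm_wmx _ oW (sh k.+1))).
have e w : W w -> (invmx (M w) *m wmx (- 'i) M w) a b =
   ((fun y => (invmx (h y) *m \matrix_(k, l) cder c (fun z => h z k l) y) a b) \o param c) w.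
  move=> /WD/paramK[ew _] /=; congr ((_ *m _) a b).
  by apply/matrixP => k l; rewrite !mxE /cder ew ddz_wirt.
exact: (wirt_ext 'i oW e Wz (sM 1%N a b)).
Qed.

End SurfaceCalculus.

Section HolomorphicMaps.
Variables (R : realType) (Y X : riemann_surface R) (pi : Y -> X).
Local Notation C := (Cplx R).
Local Notation Ck := (@Ck R (Cplx R)^o).
Hypothesis hpi : holomorphic_map pi.

Lemma preimage_open (U : set X) : open U -> open (pi @^-1` U).
Proof. by move=> oU; apply: open_comp => // y _; exact: hpi.1. Qed.

(** The inverse function theorem for [pi] read in charts. V is free so that the section can be kept
    in a prescribed neighbourhood of y0. *)
Lemma local_section (c : rs_ix X) (d : rs_ix Y) (y0 : Y) (V : set Y) :
  dom c (pi y0) -> dom d y0 -> open V -> V y0 -> cder d (coord c \o pi) y0 != 0 ->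
  exists (W : set C) (G : C -> C),
    [/\ open W, W (coord c (pi y0)), hl W G, param d (G (coord c (pi y0))) = y0 &
      forall z, W z -> [/\ V (param d (G z)), dom d (param d (G z)),
        coord d (param d (G z)) = G z & dom c (pi (param d (G z))) /\ pi (param d (G z)) =
            param c z]].
Proof.
move=> cy dy oV Vy; have hF := hpi.2 c.
rewrite (cder_dd hF cy dy) => F0.
pose V' := V `&` (pi @^-1` dom c).
have oV' : open V' by apply: openI => //; apply: preimage_open; exact: dom_open.
have hF' : hl (coord d @` (V' `&` dom d)) ((coord c \o pi) \o param d).
  by apply: (hol_on_sub _ _ hF) => y [].
have z0 : (coord d @` (V' `&` dom d)) (coord d y0) by exists y0.
have [W [G [oW Ww hG Gw hW]]] := hl_inverse (coord_image_open (c := d) oV') hF' z0 F0.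
have e0 : (coord c \o pi \o param d) (coord d y0) = coord c (pi y0).
  by rewrite /= (coordK dy).
rewrite e0 in Ww Gw; exists W, G; split=> //; first by rewrite Gw (coordK dy).
move=> z /hW[[y [[Vy' cy'] dy'] <-] /= <-]; rewrite (coordK dy').
by split=> //; split=> //; rewrite (coordK cy').
Qed.

End HolomorphicMaps.

(** A duplicate-free list in A of maximal length exhausts A, since a missing point could be added to
    it. *)
Lemma set_of_bounded_seqs (T : choiceType) (A : set T) n :
  (forall ys : seq T, uniq ys -> (forall y, y \in ys -> A y) -> (size ys <= n)%N) ->
  exists2 ys : seq T, uniq ys & A = [set` ys].
Proof.
move=> h; pose P m := `[< exists ys : seq T, [/\ uniq ys, forall y, y \in ys -> A y & size
    ys = m] >].
have P0 : exists m, P m by exists 0%N; apply/asboolP; exists [::].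
have Pn m : P m -> (m <= n)%N by move=> /asboolP[ys [u a <-]]; exact: h.
have [m /asboolP[ys [u a sz]] hmax] := ex_maxnP P0 Pn.
exists ys => //; apply/seteqP; split=> [y Ay|y /= /a//] /=.
apply: contrapT => /negP hy.
have : P m.+1.
  apply/asboolP; exists (y :: ys); split=> [|z|] /=; first by rewrite hy.
    by rewrite inE => /orP[/eqP ->|/a].
  by rewrite sz.
by move=> /hmax; rewrite ltnn.
Qed.

(** * Transition matrices and the points of Sigma/sigma over X *)

Section Bundles.
Variables (R : realType) (X : riemann_surface R).
Local Notation C := (Cplx R).

Lemma bundle_unit r (E : cocycle X r) i j x : is_bundle E ->
  bdom (c := E) i x -> bdom (c := E) j x -> btr i j x \in unitmx.
Proof.
move=> [_ _ _ hid hco] ix jx; have := hco i j i x ix jx ix; rewrite hid // => h.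
exact: mulmx1_unitmx h.
Qed.

Lemma canonical_btrE (c d : rs_ix X) x :
  @btr R X 1 (canonical_bundle X) c d x 0 0 = cder c (coord d) x.
Proof. by rewrite /= mxE mulr1n. Qed.

Lemma twist_btrE r (E : cocycle X r) N m (a b : bix E * bix N) x :
  @btr R X r (twist E N m) a b x = (btr a.2 b.2 x 0 0) ^+ m *: btr a.1 b.1 x.
Proof. by []. Qed.

End Bundles.

Section Spectrum.
Variables (R : realType) (X : riemann_surface R) (n : nat).
Local Notation C := (Cplx R).
Variable H : higgs (canonical_bundle X) n.
Hypothesis H_sp : sp_higgs H.
Implicit Types (i j : bix (hE H)) (c d : rs_ix X) (x : X).

Lemma spec_poly_root_indep i j c x l : bdom i x -> bdom j x -> dom c x ->
  root (spec_poly i c x) l -> root (spec_poly j c x) l.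
Proof.
have [hEb hPhi _ _ _] := H_sp => ix jx cx.
pose tw k := (k, c) : bix (twist (hE H) (canonical_bundle X) 1).
have := hPhi.2 (tw i) (tw j) i j x (conj ix cx) (conj jx cx) ix jx.
rewrite (twist_btrE 1 (tw i) (tw j)) (canonical_btrE c c) (cder_coord_id cx) expr1n scale1r.
apply: char_poly_root_conj; exact: bundle_unit.
Qed.

Lemma sigma_quot_root i c x l : bdom i x -> on_sigma H c x l ->
  root (quot_poly i c x) (l ^+ 2).
Proof.
move=> ix [cx [j [jx hl]]]; have {hl} := spec_poly_root_indep jx ix cx hl.
have [_ _ _ _ /(_ i x ix)[_ uO /(_ c cx) hO]] := H_sp.
apply: root_even_poly; first by rewrite pnatr_eq0.
exact: char_poly_skew_even uO hO.
Qed.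

Variables (Y : riemann_surface R) (pi : Y -> X) (b2 : rs_ix X -> Y -> C).
Hypothesis Y_quotient : quotient_curve H pi b2.

Lemma fibre_sigma c y : dom c (pi y) -> exists2 l, on_sigma H c (pi y) l & b2 c y = - l ^+ 2.
Proof.
move=> cy; have [_ _ _ /(_ c (pi y) (b2 c y) cy)[h _] _] := Y_quotient.
by have [|l [? ?]] := h; [exists y|exists l].
Qed.

(** The injection into roots is [- b2]: the sign undoes b2 = - lambda^2, so its values are the roots
    lambda^2 of [quot_poly]. *)
Lemma fibre_size x (ys : seq Y) : uniq ys -> (forall y, y \in ys -> pi y = x) ->
  (size ys <= n)%N.
Proof.
move=> u hys; have [hE _ _ _ _] := H_sp; have [_ /(_ x)[i ix] _ _ _] := hE.
have [c cx] := rs_cover x; have [_ _ inj _ _] := Y_quotient.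
rewrite -(size_map (fun y => - b2 c y)).
apply: (even_char_poly_roots (A := hPhi (h := H) (i, c) i x)).
  rewrite map_inj_in_uniq // => y y' /hys yx /hys y'x /oppr_inj; apply: inj.
    by rewrite yx.
  by rewrite yx y'x.
move=> _ /mapP[y /hys yx ->]; rewrite -yx in cx ix *.
have [l hl ->] := fibre_sigma cx; rewrite opprK.
exact: (sigma_quot_root ix hl).
Qed.

(** b2 = 0 means lambda = 0, so 0 is a root of [quot_poly] and the factor a_2n of the discriminant
    vanishes. *)
Lemma fibre_b2_neq0 c y : ~ disc_zero H (pi y) -> dom c (pi y) -> b2 c y != 0.
Proof.
move=> nd cy; have [hE _ _ _ _] := H_sp; have [_ /(_ (pi y))[i iy] _ _ _] := hE.
have [l hl ->] := fibre_sigma cy; rewrite oppr_eq0; apply/eqP => l0.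
apply: nd; exists i, c; split=> //.
have := sigma_quot_root iy hl; rewrite l0 /root horner_coef0 => /eqP e.
by rewrite /disc_at e mul0r.
Qed.

Lemma b2_zero_chart c y : dom c (pi y) -> b2 c y != 0 -> ~ b2_zero pi b2 y.
Proof.
move=> cy b0 [d [dy b0']]; have [_ hb _ _ _] := Y_quotient.
have := hb.2 c d y cy dy; rewrite b0' mulr0 => e.
by rewrite e eqxx in b0.
Qed.

End Spectrum.

(** The value at p is nonzero exactly when the order is 0: for any other exponent, negative ones
    included, 0 ^ m is 0. Applied to [del] and the derivative of [pi], it turns nonvanishing of
    [del] into unramifiedness. *)
Lemma vanish_order_neq0 (R : realType) (X : riemann_surface R) (f g : X -> Cplx R) p m :
  vanish_order_fun f p m -> vanish_order_fun g p m -> f p != 0 -> g p != 0.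
Proof.
have key (u : X -> Cplx R) : vanish_order_fun u p m -> (u p != 0) = (m == 0).
  move=> [c [V [v [[_ Vp _ _ v0] /(_ p Vp)]]]]; rewrite subrr exp0rz.
  case: eqP => _ /=; last first.
    rewrite scale0r => /matrixP/(_ 0 0); rewrite !mxE mulr1n => ->.
    by rewrite eqxx.
  rewrite scale1r => e; apply/eqP => u0; move: v0; rewrite -e u0 raddf0.
  by rewrite eqxx.
by move=> /key hf /key hg; rewrite hf hg.
Qed.

(** * The pushforward metric *)

Section Pushforward.
Variables (R : realType) (X : riemann_surface R) (n : nat).
Local Notation C := (Cplx R).
Local Notation K := (canonical_bundle X).
Variables (H : higgs K n) (Y : riemann_surface R) (pi : Y -> X).
Local Notation N := (pullback pi K).
Variables (b2 : rs_ix X -> Y -> C) (del : rs_ix X -> Y -> C) (H2 : higgs N 1).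
Variable eps : bix (twist (hE H2) N (n - 1)) -> bix (pullback pi (hE H)) -> Y ->
  'M[C]_(1 + 1, n + n).
Variable h2 : bix (hE H2) -> Y -> 'M[C]_(1 + 1).
Hypothesis H_sp : sp_higgs H.
Hypothesis Y_quotient : quotient_curve H pi b2.
Hypothesis del_ram : ramification_section n pi del.
Hypothesis H2_push : pushforward_model del eps.
Hypothesis h2_solution : decoupled_hitchin (~` b2_zero pi b2) h2.
Implicit Types (i j : bix (hE H)) (c : rs_ix X) (x : X) (y : Y) (a : bix (hE H2)).

Variables (tr : Y -> bix (hE H2)) (tr_dom : forall y, bdom (tr y) y).

Lemma fibre_enum i c x : ~ disc_zero H x -> bdom i x -> dom c x ->
  exists yk : 'I_n -> Y,
    [/\ injective yk, forall k, pi (yk k) = x, forall y, pi y = x -> exists k, y = yk k,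
        forall k, del c (yk k) != 0 &
        stk (fun k => eps (tr (yk k), c) i (yk k)) \in unitmx].
Proof.
move=> nd ix cx.
have [ys u fibE] : exists2 ys : seq Y, uniq ys & pi @^-1` [set x] = [set` ys].
  by apply: (@set_of_bounded_seqs _ _ n) => ys u hys; exact: (fibre_size H_sp Y_quotient u hys).
have hys y : y \in ys -> pi y = x.
  move=> yy; have : [set` ys] y by [].
  by rewrite -fibE.
have sz := fibre_size H_sp Y_quotient u hys.
have [_ _ /(_ tr tr_dom i c x nd ix cx)] := H2_push; rewrite fibE -fsbig_seq // => hO.
have [_ _ _ _ /(_ i x ix)[_ uO _]] := H_sp.
pose E y := eps (tr y, c) i y.
have hr := rank_weighted_sum ys (fun y => (del c y)^-1) E (fun y => hOmega (h := H2) (tr y) y).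
rewrite -hO mxrank_unit // in hr.
(* As 0^-1 = 0, points where [del] vanishes have weight 0 in omega, so the rank bound counts only
   points with [del] nonzero. *)
have cnt : (n <= count (fun y => ((del c y)^-1 != 0)%R) ys)%N.
  have e m : ((1 + 1) * m = m + m)%N by rewrite mulnDl mul1n.
  by move: hr; rewrite e !addnn leq_double.
have szn : size ys == n.
  by rewrite eqn_leq sz (leq_trans cnt) // count_size.
have alld : all (fun y => (del c y)^-1 != 0) ys.
  by rewrite all_count eqn_leq count_size (eqP szn).
pose yk k := tnth (Tuple szn) k.
have mem k : yk k \in ys by exact: (mem_tnth k (Tuple szn)).
exists yk; split.
- move=> k l; rewrite /yk !(tnth_nth (yk k)) /= => /eqP.
  by rewrite nth_uniq ?(eqP szn) // => /eqP/val_inj.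
- by move=> k; apply: hys.
- move=> y yx; have : (pi @^-1` [set x]) y by [].
  rewrite fibE => yy; have /tnthP[k ->] : y \in Tuple szn by exact: yy.
  by exists k.
- by move=> k; have := allP alld _ (mem k); rewrite invr_eq0.
have hO' : hOmega i x = \sum_k (E (yk k))^T *m
    ((del c (yk k))^-1 *: hOmega (h := H2) (tr (yk k)) (yk k)) *m E (yk k).
  rewrite hO; transitivity (\sum_(y <- Tuple szn)
     (del c y)^-1 *: ((E y)^T *m hOmega (h := H2) (tr y) y *m E y)) => //.
  rewrite big_tuple; apply: eq_bigr => k _.
  by rewrite -scalemxAr -scalemxAl.
(* omega is A^T times a block matrix times A, so its invertibility forces that of A. *)
move: uO; rewrite hO' (stk_form (fun k => E (yk k))) unitmx_mul.
by case/andP.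
Qed.

Lemma fibre_sum (V : nmodType) (f : Y -> V) x (yk : 'I_n -> Y) :
  injective yk -> (forall k, pi (yk k) = x) -> (forall y, pi y = x -> exists k, y = yk k) ->
  \sum_(y \in pi @^-1` [set x]) f y = \sum_k f (yk k).
Proof.
move=> inj hyk hx; have -> : pi @^-1` [set x] = [set` codom yk].
  apply/seteqP; split=> y /=; first by move=> /hx[k ->]; exact: codom_f.
  by move=> /codomP[k ->]; exact: hyk.
rewrite -fsbig_seq; last by rewrite map_inj_uniq // enum_uniq.
by rewrite big_map big_enum.
Qed.

Definition push_summand i c a y : 'M[C]_(n + n) :=
  `|del c y|^-1 *: ((eps (a, c) i y)^t* *m h2 a y *m eps (a, c) i y).

Lemma eps_change i j a b c d y : bdom i (pi y) -> bdom j (pi y) -> bdom a y -> bdom b y ->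
  dom c (pi y) -> dom d (pi y) ->
  eps (a, c) i y *m btr i j (pi y) =
    (cder c (coord d) (pi y) ^+ (n - 1) *: btr a b y) *m eps (b, d) j y.
Proof.
move=> iy jy ay by' cy dy; have [[heps _] _ _] := H2_push.
have := heps.2 (a, c) (b, d) i j y (conj ay cy) (conj by' dy) iy jy.
rewrite (@twist_btrE _ _ _ (hE H2) N (n - 1) (a, c) (b, d)).
by rewrite (_ : @btr R Y 1 N c d y 0 0 = cder c (coord d) (pi y)) //; exact: canonical_btrE.
Qed.

(** [eps] contributes |g^(n-1)|^2 and |del|^-1 contributes |g^(2n-2)|^-1, which cancel. The
    transition matrices of E_2 are absorbed by h2, leaving only those of E. *)
Lemma summand_change i j a b c d y : bdom i (pi y) -> bdom j (pi y) ->
  bdom a y -> bdom b y -> dom c (pi y) -> dom d (pi y) -> ~ b2_zero pi b2 y ->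
  push_summand j d b y = (btr i j (pi y))^t* *m push_summand i c a y *m btr i j (pi y).
Proof.
move=> iy jy ay by' cy dy nb.
have e := eps_change iy jy ay by' cy dy.
have g0 := cder_coord_neq0 cy dy; set g := cder c (coord d) (pi y) in e g0.
have [[_ /(_ a b y nb ay by') eh _ _] _ _ _] := h2_solution.
have ed : del c y = g ^+ (2 * n - 2) * del d y.
  have := del_ram.1.2 c d y cy dy.
  by rewrite (_ : @btr R Y 1 N c d y 0 0 = g) //; exact: canonical_btrE.
rewrite /push_summand -scalemxAr -scalemxAl.
have -> : (btr i j (pi y))^t* *m ((eps (a, c) i y)^t* *m h2 a y *m eps (a, c) i y) *m btr i
    j (pi y)
  = (eps (a, c) i y *m btr i j (pi y))^t* *m h2 a y *m (eps (a, c) i y *m btr i j (pi y)).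
  by rewrite trmxC_mul !mulmxA.
rewrite e trmxC_mul eh.
set q := g ^+ (n - 1); set T := btr a b y; set P := eps (b, d) j y.
rewrite trmxC_scale.
rewrite -!(scalemxAl, scalemxAr) !scalerA !mulmxA; congr (_ *: _).
rewrite ed (_ : (2 * n - 2 = (n - 1) * 2)%N); last by rewrite mulnBl mul1n mulnC.
rewrite exprM normrM normrX -/q normCK invfM.
have q0 : q != 0 by rewrite expf_neq0.
rewrite [X in _ = X](_ : _ = `|del d y|^-1 * (q * q^*)^-1 * (q * q^*)).
  by rewrite divfK // mulf_neq0 // conjC_eq0.
by rewrite invfM; ring.
Qed.

End Pushforward.

Lemma posdef_unit (R : realType) r (M : 'M[Cplx R]_r) :
  (forall v : 'cV_r, v != 0 -> 0 < (v^t* *m M *m v) 0 0) -> M \in unitmx.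
Proof.
move=> pM; rewrite -unitmx_tr unitmxE unitfE; apply/negP => /det0P[v v0 vM].
have : v^T != 0 by apply: contraNneq v0 => e; rewrite -[v]trmxK e trmx0.
move=> /pM; rewrite -mulmxA.
have -> : M *m v^T = 0 by rewrite -[LHS]trmxK trmx_mul trmxK vM trmx0.
by rewrite mulmx0 mxE ltxx.
Qed.

(** Normality for h2 is thus the same as normality for |del|^-1 h2. *)
Lemma adjoint_wrtZ (R : realType) r (t : Cplx R) (h A : 'M[Cplx R]_r) : t != 0 ->
  h \in unitmx -> adjoint_wrt (t *: h) A = adjoint_wrt h A.
Proof.
move=> t0 uh; rewrite /adjoint_wrt -scalemxAr invmxZ; last by rewrite unitmxZ // unitfE.
by rewrite -!scalemxAl scalerA mulfV // scale1r.
Qed.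

Lemma common_ball (R : realType) (I : finType) (P : I -> Cplx R -> Prop) z :
  (forall k, exists2 r : R, 0 < r & forall w, nrm (w - z) < r -> P k w) ->
  exists2 r : R, 0 < r & forall k w, nrm (w - z) < r -> P k w.
Proof.
move=> h; have /boolp.choice[r hr] : forall k, exists r : R, 0 < r /\ forall w, nrm (w - z)
    < r -> P k w.
  by move=> k; have [r r0 hr] := h k; exists r.
exists (\big[Order.min/1]_k r k).
  by apply: lt_bigmin => // k _; have [] := hr k.
move=> k w wr; have [_] := hr k; apply; apply: lt_le_trans wr _.
exact: bigmin_le_cond.
Qed.

Lemma open_ball_in (R : realType) (W : set (Cplx R)) z : open W -> W z ->
  exists2 r : R, 0 < r & forall w, nrm (w - z) < r -> W w.
Proof. by move=> oW Wz; apply/near_nrm; exact: open_nbhs_nbhs. Qed.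

Lemma neq0_ball (R : realType) (W : set (Cplx R)) (f : Cplx R -> Cplx R) z :
  Ck (V := (Cplx R)^o) 0 W f -> W z -> f z != 0 ->
  exists2 r : R, 0 < r & forall w, nrm (w - z) < r -> f w != 0.
Proof.
move=> hf Wz fz; have f0 : 0 < nrm (f z) by exact: nrm_gt0.
have /continuous_nrm/(_ _ f0)[r r0 hr] := Ck_continuous hf Wz.
exists r => // w /hr; apply: contraTneq => ->.
by rewrite sub0r nrmN ltxx.
Qed.

Lemma Ckm_bdiag (R : realType) n (W : set (Cplx R)) k (K : 'I_n -> Cplx R -> 'M[Cplx R]_(1 + 1)) :
  open W -> (forall l, Ckm k W (K l)) -> Ckm k W (fun w => bdiag (fun l => K l w)).
Proof.
move=> oW sK i j.
have e w : W w -> (if blk i == blk j then K (blk i) w (bpos i) (bpos j) else 0)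
    = bdiag (fun l => K l w) i j by rewrite [RHS]mxE.
apply: (Ck_ext oW e); case: (blk i == blk j); last exact: Ck_cst.
exact: sK.
Qed.

Lemma flatmx_ext (R : realType) r (W : set (Cplx R)) (M P : Cplx R -> 'M[Cplx R]_r) :
  open W -> (forall k, Ckm k W M) -> (forall z, W z -> M z \in unitmx) ->
  (forall z, W z -> M z = P z) -> flatmx W M -> flatmx W P.
Proof.
move=> oW sM uM MP fM z Wz; rewrite -[RHS](fM z Wz).
have e w : W w -> invmx (M w) *m wmx (- 'i) M w = invmx (P w) *m wmx (- 'i) P w.
  by move=> Ww; rewrite (wmx_ext (- 'i) oW MP Ww (sM 1%N)) MP.
exact: (wmx_ext 'i oW e Wz (CkmM oW (Ckm_inv oW uM (sM 1%N)) (Ckm_wmx _ oW (sM 2%N)))).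
Qed.

Lemma flatmx_bdiag (R : realType) n (W : set (Cplx R)) (K : 'I_n -> Cplx R -> 'M[Cplx R]_(1
    + 1)) :
  open W -> (forall k m, Ckm m W (K k)) -> (forall k z, W z -> K k z \in unitmx) ->
  (forall k, flatmx W (K k)) -> flatmx W (fun w => bdiag (fun k => K k w)).
Proof.
move=> oW sK uK fK z Wz.
have wb a (P : 'I_n -> Cplx R -> 'M[Cplx R]_(1 + 1)) w :
    wmx a (fun w => bdiag (fun k => P k w)) w = bdiag (fun k => wmx a (P k) w).
  apply/matrixP => i j; rewrite [LHS]mxE [RHS]mxE.
  have -> : (fun w => bdiag (fun k => P k w) i j) =
      (fun w => if blk i == blk j then P (blk i) w (bpos i) (bpos j) else 0).
    by apply/funext => y; rewrite mxE.
  by case: (blk i == blk j); [rewrite mxE|exact: wirt_cst].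
pose Q k w := invmx (K k w) *m wmx (- 'i) (K k) w.
have sQ k m : Ckm m W (Q k).
  exact: (CkmM oW (Ckm_inv oW (uK k) (sK k m)) (Ckm_wmx _ oW (sK k m.+1))).
have e w : W w -> bdiag (fun k => Q k w) =
    invmx (bdiag (fun k => K k w)) *m wmx (- 'i) (fun w => bdiag (fun k => K k w)) w.
  by move=> Ww; rewrite wb (bdiag_inv (fun k => uK k w Ww)).2 bdiagM.
have sb := Ckm_bdiag oW (sQ ^~ 1%N).
rewrite (wmx_ext 'i oW e Wz sb) wb; apply/matrixP => i j; rewrite [LHS]mxE [RHS]mxE.
by case: (blk i == blk j) => //; rewrite (fK (blk i) z Wz) mxE.
Qed.

(** * Local frames and the decoupled Hitchin equation for the pushforward *)

Section Solution.
Variables (R : realType) (X : riemann_surface R) (n : nat).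
Local Notation C := (Cplx R).
Local Notation K := (canonical_bundle X).
Variables (H : higgs K n) (Y : riemann_surface R) (pi : Y -> X).
Local Notation N := (pullback pi K).
Variables (b2 : rs_ix X -> Y -> C) (del : rs_ix X -> Y -> C) (H2 : higgs N 1).
Variable eps : bix (twist (hE H2) N (n - 1)) -> bix (pullback pi (hE H)) -> Y ->
  'M[C]_(1 + 1, n + n).
Variable h2 : bix (hE H2) -> Y -> 'M[C]_(1 + 1).
Hypothesis H_sp : sp_higgs H.
Hypothesis H2_sp : sp_higgs H2.
Hypothesis Y_quotient : quotient_curve H pi b2.
Hypothesis del_ram : ramification_section n pi del.
Hypothesis H2_push : pushforward_model del eps.
Hypothesis h2_solution : decoupled_hitchin (~` b2_zero pi b2) h2.
Implicit Types (i j : bix (hE H)) (c : rs_ix X) (x : X) (y : Y) (a : bix (hE H2)).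

Variables (tr : Y -> bix (hE H2)) (tr_dom : forall y, bdom (tr y) y).
Variables (ch : X -> rs_ix X) (ch_dom : forall x, dom (ch x) x).
Local Notation summand := (push_summand del eps h2).

(** A metric must be a function of i and x alone, hence the choice of a trivialisation of E_2 at
    each y and of a chart at each x. These choices vary without any continuity; [summand_indep]
    allows replacing them by locally constant ones. *)
Definition pushed_metric i x : 'M[C]_(n + n) :=
  \sum_(y \in pi @^-1` [set x]) summand i (ch x) (tr y) y.

Lemma summand_indep i a b c d y : bdom i (pi y) -> bdom a y -> bdom b y ->
  dom c (pi y) -> dom d (pi y) -> ~ b2_zero pi b2 y -> summand i d b y = summand i c a y.
Proof.
move=> iy ay by' cy dy nb; have [[_ _ _ h1 _] _ _ _ _] := H_sp.
rewrite (summand_change del_ram H2_push h2_solution iy iy ay by' cy dy nb) h1 //.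
by rewrite trmx1 map_mx1 mul1mx mulmx1.
Qed.

Lemma pushed_metric_fibre i c x (a : 'I_n -> bix (hE H2)) (yk : 'I_n -> Y) :
  bdom i x -> dom c x -> injective yk -> (forall k, pi (yk k) = x) ->
  (forall y, pi y = x -> exists k, y = yk k) -> (forall k, bdom (a k) (yk k)) ->
  (forall k, ~ b2_zero pi b2 (yk k)) ->
  pushed_metric i x = \sum_k summand i c (a k) (yk k).
Proof.
move=> ix cx inj hyk hx ha nb; rewrite /pushed_metric (fibre_sum _ inj hyk hx).
apply: eq_bigr => k _; have := hyk k => e.
by apply: summand_indep; rewrite ?e.
Qed.

Lemma pushed_metric_push : pushforward_metric del eps h2 pushed_metric.
Proof.
move=> triv triv_dom i c x nd ix cx; apply: eq_fsbigr => y; rewrite inE /= => yx.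
rewrite -yx in nd ix cx *; have b0 := fibre_b2_neq0 H_sp Y_quotient nd cx.
exact: summand_indep (b2_zero_chart Y_quotient cx b0).
Qed.

Lemma summandE i c a y :
  summand i c a y = (eps (a, c) i y)^t* *m (`|del c y|^-1 *: h2 a y) *m eps (a, c) i y.
Proof. by rewrite /push_summand -scalemxAr -scalemxAl. Qed.

(** A stacks [eps] along the n local sections of [pi] through the fibre, and [F k] is |del|^-1 h2
    along the k-th. The trivialisations [a k] are those of the central points, kept fixed along the
    sections. *)
Lemma local_frame i c x : ~ disc_zero H x -> bdom i x -> dom c x ->
  exists (W : set C) (A : C -> 'M[C]_(n + n)) (F : 'I_n -> C -> 'M[C]_(1 + 1)),
    [/\ open W /\ W (coord c x), W `<=` coord c @` dom c, hlm W A &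
        forall z, W z -> A z \in unitmx] /\
    [/\ forall k m, Ckm m W (F k), forall k z, W z -> F k z \in unitmx,
        forall k, flatmx W (F k) &
        forall z, W z -> pushed_metric i (param c z) =
          (A z)^t* *m bdiag (fun k => F k z) *m A z].
Proof.
move=> nd ix cx; have [yk [inj hyk hfib del0 uA]] := fibre_enum H_sp Y_quotient H2_push
    tr_dom nd ix cx.
have [[_ hpi] hb2 b2inj _ _] := Y_quotient; have [hdel hram] := del_ram.
have [[heps _] _ _] := H2_push; have [[odomE _ _ _ _] _ _ _ _] := H_sp.
have [[odomE2 _ _ _ _] _ _ _ _] := H2_sp.
have [[h2s _ _ h2p] _ h2f _] := h2_solution.
have [ck hck] := boolp.choice (fun k => rs_cover (yk k)).
pose a k := tr (yk k).
have cyk k : dom c (pi (yk k)) by rewrite hyk.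
have nk k : ~ disc_zero H (pi (yk k)) by rewrite hyk.
pose D := pi @^-1` dom c; have oD : open D by apply: (preimage_open hpi); exact: dom_open.
(* All the open conditions needed along the k-th section: trivialisations and chart are defined, b2
   is nonzero so that h2 is a metric, and del is nonzero. *)
pose V k := (bdom (a k) `&` pi @^-1` bdom i) `&`
   ((D `&` [set y | b2 c y != 0]) `&` (D `&` [set y | del c y != 0])).
have oV k : open (V k).
  apply: openI; first by apply: openI => //; apply: (preimage_open hpi).
  by apply: openI; apply: hol_on_neq0_open => //; [exact: (hb2.1 c)|exact: (hdel.1 c)].
have Vyk k : V k (yk k).
  split; first by split; [exact: tr_dom|rewrite /= hyk].
  split; split; [exact: cyk| |exact: cyk|exact: del0].
  exact: (fibre_b2_neq0 H_sp Y_quotient (nk k) (cyk k)).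
(* [del] and the derivative of [pi] vanish to the same order. *)
have F0 k : cder (ck k) (coord c \o pi) (yk k) != 0.
  have [m [h1 h3]] := hram c (ck k) (yk k) (cyk k) (hck k).
  exact: vanish_order_neq0 h1 h3 (del0 k).
have loc k := local_section hpi (cyk k) (hck k) (oV k) (Vyk k) (F0 k).
have {loc} /boolp.choice[WG hWG] : forall k, exists WG : set C * (C -> C),
    [/\ open WG.1, WG.1 (coord c x), hl WG.1 WG.2, param (ck k) (WG.2 (coord c x)) = yk k &
      forall z, WG.1 z -> [/\ V k (param (ck k) (WG.2 z)), dom (ck k) (param (ck k) (WG.2 z)),
        coord (ck k) (param (ck k) (WG.2 z)) = WG.2 z &
        dom c (pi (param (ck k) (WG.2 z))) /\ pi (param (ck k) (WG.2 z)) = param c z]].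
  by move=> k; have [W [G hW]] := loc k; rewrite hyk in hW; exists (W, G).
pose G k := (WG k).2; pose s k z := param (ck k) (G k z).
pose z0 := coord c x.
have [r1 r10 hr1] : exists2 r : R, 0 < r & forall k w, nrm (w - z0) < r -> (WG k).1 w.
  apply: common_ball => k; have [oW Ww _ _ _] := hWG k; exact: open_ball_in.
pose W1 := [set w : C | nrm (w - z0) < r1].
have oW1 : open W1 by exact: open_ball_nrm.
have W1z : W1 z0 by rewrite /W1 /= subrr nrm0.
have hG k : hl W1 (G k).
  by have [_ _ h _ _] := hWG k; apply: hl_sub h => w; exact: hr1.
have hs k z : W1 z -> [/\ V k (s k z), dom (ck k) (s k z), coord (ck k) (s k z) = G k z &
        dom c (pi (s k z)) /\ pi (s k z) = param c z].
  by move=> Wz; have [_ _ _ _] := hWG k; apply; exact: hr1.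
have s0 k : s k z0 = yk k by have [_ _ _ h _] := hWG k.
pose U k := coord (ck k) @` (V k `&` dom (ck k)).
have oU k : open (U k) by exact: coord_image_open.
have GU k z : W1 z -> U k (G k z).
  by move=> /(hs k)[v d e _]; exists (s k z).
have hols (B : set Y) (f : Y -> C) k : V k `<=` B -> hol_on B f -> hl W1 (fun z => f (s k z)).
  move=> VB hf; exact: (hl_comp (oU k) oW1 (GU k) (hol_on_sub (ck k) VB hf) (hG k)).
have VD k : V k `<=` D by move=> y [_ [[]]].
have hb k : hl W1 (fun z => b2 c (s k z)) by exact: (hols _ _ _ (VD k) (hb2.1 c)).
have hd k : hl W1 (fun z => del c (s k z)) by exact: (hols _ _ _ (VD k) (hdel.1 c)).
pose A z := stk (fun k => eps (a k, c) i (s k z)).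
have hA : hlm W1 A.
  move=> p q; have := hols _ _ (blk p) _ (heps.1 (a (blk p), c) i (bpos p) q).
  have VB : V (blk p) `<=` bdom (c := twist (hE H2) N (n - 1)) (a (blk p), c) `&`
     bdom (c := pullback pi (hE H)) i.
    by move=> y [[y1 y2] [[y3 _] _]].
  move=> /(_ VB); congr (hl _ _); apply/funext => z; by rewrite mxE.
have detA0 : \det (A z0) != 0.
  suff -> : A z0 = stk (fun k => eps (tr (yk k), c) i (yk k)) by rewrite -unitfE -unitmxE.
  by congr stk; apply/funext => k; rewrite s0.
have [r2 r20 hr2] := neq0_ball (Ck_det oW1 (fun p q => (hA p q).1 0%N)) W1z detA0.
(* [b2] separates the points of the central fibre, so by continuity the sections stay pairwise
   distinct. *)
have [r3 r30 hr3] : exists2 r : R, 0 < r & forall (kl : 'I_n * 'I_n) w, nrm (w - z0) < r ->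
    kl.1 <> kl.2 -> b2 c (s kl.1 w) - b2 c (s kl.2 w) != 0.
  apply: common_ball => -[k l] /=; have [->|kl] := eqVneq k l; first by exists 1.
  have hkl : Ck (V := C^o) 0 W1 (fun w => b2 c (s k w) + - b2 c (s l w)).
    exact: (CkD oW1 ((hb k).1 0%N) (CkN oW1 ((hb l).1 0%N))).
  have [|r r0 hr] := neq0_ball hkl W1z; last by exists r => // w /hr.
  rewrite !s0 subr_eq0; apply: contraNneq kl => e; apply/eqP/inj.
  by apply: (b2inj c) => //; rewrite !hyk.
have [r4 r40 hr4] : exists2 r : R, 0 < r &
    forall w, nrm (w - z0) < r -> (coord c @` (bdom i `&` dom c)) w.
  by apply: open_ball_in; [exact: coord_image_open|exists x].
pose W := [set w : C | nrm (w - z0) < Order.min (Order.min r1 r4) (Order.min r2 r3)].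
have hW z : W z -> [/\ W1 z, (coord c @` (bdom i `&` dom c)) z, \det (A z) != 0 &
    forall k l, k <> l -> b2 c (s k z) - b2 c (s l z) != 0].
  rewrite /W /= !lt_min => /andP[/andP[h1 /hr4 h2'] /andP[/hr2 h3 h4]].
  by split=> // k l kl; exact: (hr3 (k, l) z h4 kl).
have WW1 : W `<=` W1 by move=> z /hW[].
have oW : open W by exact: open_ball_nrm.
pose F k z := `|del c (s k z)|^-1 *: h2 (a k) (s k z).
have VZ k y : V k y -> ~ b2_zero pi b2 y.
  by move=> [_ [[cy b0] _]]; exact: (b2_zero_chart Y_quotient cy b0).
have sN k m : Ckm m (U k) (fun w => h2 (a k) (param (ck k) w)).
  move=> p q; apply: Ck_sub (h2s (a k) p q (ck k) m) => _ [y [Vy dy] <-].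
  by exists y => //; split=> //; split; [exact: (VZ k)|have [[]] := Vy].
have uN k w : U k w -> h2 (a k) (param (ck k) w) \in unitmx.
  move=> [y [Vy dy] <-]; rewrite coordK //; apply: posdef_unit.
  by apply: h2p; [exact: (VZ k)|have [[]] := Vy].
have fN k : flatmx (U k) (fun w => h2 (a k) (param (ck k) w)).
  move=> w Uw; apply/matrixP => p q.
  have Usub : U k `<=` coord (ck k) @` dom (ck k) by exact: coord_image_sub.
  rewrite -(curvature_flatmx (oU k) Usub Uw (sN k) (uN k)) [RHS]mxE.
  move: Uw => [y [Vy dy] <-]; rewrite coordK //.
  by apply: h2f => //; [exact: (VZ k)|have [[]] := Vy].
have GUW k z : W z -> U k (G k z) by move=> /WW1; exact: GU.
have hGW k : hl W (G k) by exact: hl_sub WW1 (hG k).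
have hdW k : hl W (fun z => del c (s k z)) by exact: hl_sub WW1 (hd k).
have d0 k z : W z -> del c (s k z) != 0.
  by move=> /WW1/(hs k)[[_ [_ [_ ?]]]].
have sNG k m : Ckm m W (fun z => h2 (a k) (s k z)).
  exact: (Ckm_comp (oU k) oW (GUW k) (sN k m) ((hGW k).1 m)).
have uNG k z : W z -> h2 (a k) (s k z) \in unitmx by move=> /(GUW k)/(uN k).
(* Pulling back by the holomorphic [G k] moves flatness of h2 from a chart of Y to the chart c of
   X. *)
have fNG k : flatmx W (fun z => h2 (a k) (s k z)).
  exact: (flatmx_comp (oU k) oW (GUW k) (hGW k) (sN k) (uN k) (fN k)).
exists W, A, F; split; split.
- by split=> //; rewrite /W /= subrr nrm0 !lt_min r10 r20 r30 r40.
- by move=> z /hW[_ h _ _]; exact: coord_image_sub h.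
- by move=> p q; exact: hl_sub WW1 (hA p q).
- by move=> z /hW[_ _ h _]; rewrite unitmxE unitfE.
- move=> k m; exact: (CkmZ oW (Ck_normV oW (d0 k) ((hdW k).1 m)) (sNG k m)).
- by move=> k z Wz; rewrite unitmxZ ?uNG // unitfE invr_eq0 normr_eq0 d0.
- move=> k; exact: (flatmx_twist oW (d0 k) (hdW k) (sNG k) (uNG k) (fNG k)).
move=> z Wz; have [W1z' [x' [ix' cx'] ez] _ hbz] := hW z Wz.
have ex' : param c z = x' by rewrite -ez coordK.
have hpiz k : pi (s k z) = x' by have [_ _ _ [_ ->]] := hs k z W1z'.
have injz : injective (fun k => s k z).
  move=> k l e; apply: contrapT => kl; have := hbz k l kl.
  by rewrite e subrr eqxx.
(* A further point would give n + 1 distinct points in a fibre. *)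
have fibz y : pi y = x' -> exists k, y = s k z.
  move=> yx; apply: contrapT => ny.
  have uy : uniq (y :: [seq s k z | k <- enum 'I_n]).
    rewrite /= map_inj_uniq // enum_uniq andbT.
    by apply/negP => /mapP[k _ ek]; apply: ny; exists k.
  have := fibre_size H_sp Y_quotient (x := x') uy.
  rewrite /= size_map size_enum_ord ltnn => h; suff : false by [].
  apply: h => y'; rewrite inE => /orP[/eqP -> //|/mapP[k _ ->]]; exact: hpiz.
have Vz k : V k (s k z) by have [] := hs k z W1z'.
rewrite ex' (pushed_metric_fibre (c := c) (a := a) ix' cx' injz hpiz fibz); first last.
- by move=> k; exact: VZ (Vz k).
- by move=> k; have [[]] := Vz k.
rewrite -(stk_formC (fun k => eps (a k, c) i (s k z))).
by apply: eq_bigr => k _; rewrite summandE.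
Qed.

(** The pointwise form suffices for change of trivialisation, Hermitian symmetry, positivity,
    symplectic compatibility and normality; smoothness and flatness use [local_frame]. *)
Lemma pushed_metric_at i c x : ~ disc_zero H x -> bdom i x -> dom c x ->
  exists yk : 'I_n -> Y,
    [/\ injective yk, forall k, pi (yk k) = x, forall y, pi y = x -> exists k, y = yk k,
        (forall k, del c (yk k) != 0) /\ (forall k, ~ b2_zero pi b2 (yk k)) &
        stk (fun k => eps (tr (yk k), c) i (yk k)) \in unitmx] /\
    pushed_metric i x = \sum_k (eps (tr (yk k), c) i (yk k))^t* *m
       (`|del c (yk k)|^-1 *: h2 (tr (yk k)) (yk k)) *m eps (tr (yk k), c) i (yk k).
Proof.
move=> nd ix cx; have [yk [inj hyk hfib del0 uA]] := fibre_enum H_sp Y_quotient H2_push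
    tr_dom nd ix cx.
have cyk k : dom c (pi (yk k)) by rewrite hyk.
have nk k : ~ disc_zero H (pi (yk k)) by rewrite hyk.
have nb k : ~ b2_zero pi b2 (yk k).
  exact: (b2_zero_chart Y_quotient (cyk k) (fibre_b2_neq0 H_sp Y_quotient (nk k) (cyk k))).
exists yk; split; first by split.
rewrite (pushed_metric_fibre (a := fun k => tr (yk k)) ix cx inj hyk hfib) //.
by apply: eq_bigr => k _; rewrite summandE.
Qed.

Lemma sum_mulmx_conj (I : finType) r s (A : 'M[C]_(s, r)) (F : I -> 'M[C]_r) (B : 'M[C]_(r, s)) :
  A *m (\sum_k F k) *m B = \sum_k A *m F k *m B.
Proof. by rewrite mulmx_sumr mulmx_suml. Qed.

Lemma pushed_metric_change i j x : ~ disc_zero H x -> bdom i x -> bdom j x ->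
  pushed_metric j x = (btr i j x)^t* *m pushed_metric i x *m btr i j x.
Proof.
move=> nd ix jx; have [c cx] := rs_cover x.
have [yk [[inj hyk hfib [_ nb] _] _]] := pushed_metric_at nd ix cx.
have trk k : bdom (tr (yk k)) (yk k) by exact: tr_dom.
rewrite (pushed_metric_fibre ix cx inj hyk hfib trk nb).
rewrite (pushed_metric_fibre jx cx inj hyk hfib trk nb) sum_mulmx_conj.
apply: eq_bigr => k _; have e := hyk k.
by rewrite (summand_change (i := i) (a := tr (yk k)) (c := c) del_ram H2_push h2_solution) ?e.
Qed.

Lemma pushed_metric_smooth i p q :
  smooth_on (~` disc_zero H `&` bdom i) (fun x => pushed_metric i x p q).
Proof.
move=> c k; apply: Ck_local => z [x [[nd ix] cx] <-].
have [W [A [F [[[oW Wz] _ hA _] [sF _ _ e]]]]] := local_frame nd ix cx; exists W => //.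
have sA : Ckm k W A by move=> a b; exact: (hA a b).1.
have e' w : W w -> ((A w)^t* *m bdiag (fun k => F k w) *m A w) p q =
    ((fun x => pushed_metric i x p q) \o param c) w by move=> /e /= ->.
exact: (Ck_ext oW e' (CkmM oW (CkmM oW (Ckm_ct oW sA) (Ckm_bdiag oW (sF ^~ k))) sA p q)).
Qed.

Lemma pushed_metric_flat : chern_flat (~` disc_zero H) pushed_metric.
Proof.
move=> i c x nd ix cx p q.
have [W [A [F [[[oW Wz] WD hA uA] [sF uF fF e]]]]] := local_frame nd ix cx.
pose M w := (A w)^t* *m bdiag (fun k => F k w) *m A w.
have sb k : Ckm k W (fun w => bdiag (fun l => F l w)) by exact: Ckm_bdiag oW (sF ^~ k).
have ub w : W w -> bdiag (fun l => F l w) \in unitmx.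
  by move=> Ww; exact: (bdiag_inv (fun k => uF k w Ww)).1.
have fM : flatmx W M by exact: (flatmx_sandwich oW hA uA sb ub (flatmx_bdiag oW sF uF fF)).
have sM k : Ckm k W M.
  have sA : Ckm k W A by move=> a b; exact: (hA a b).1.
  exact: (CkmM oW (CkmM oW (Ckm_ct oW sA) (sb k)) sA).
have uM w : W w -> M w \in unitmx.
  by move=> Ww; rewrite !unitmx_mul trmxC_unit uA // ub.
have eM w : W w -> M w = pushed_metric i (param c w) by move=> /e ->.
have sP k : Ckm k W (fun w => pushed_metric i (param c w)) by exact: (Ckm_ext oW eM (sM k)).
have uP w : W w -> pushed_metric i (param c w) \in unitmx by move=> Ww; rewrite -eM // uM.
have := curvature_flatmx oW WD Wz sP uP p q; rewrite (coordK cx) => ->.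
by rewrite (flatmx_ext oW sM uM eM fM Wz) mxE.
Qed.

Lemma pushed_metric_solution : decoupled_hitchin (~` disc_zero H) pushed_metric.
Proof.
have [[_ _ h2h h2p] h2sp _ h2n] := h2_solution.
have [_ hPhi _] := H2_push.
split; [split| |exact: pushed_metric_flat|].
- exact: pushed_metric_smooth.
- by move=> i j x nd ix jx; exact: pushed_metric_change.
- move=> i x nd ix; have [c cx] := rs_cover x.
  have [yk [[_ _ _ [_ nb] _] ->]] := pushed_metric_at nd ix cx.
  rewrite stk_formC !trmxC_mul bdiag_trC.
  have -> : ((stk (fun k => eps (tr (yk k), c) i (yk k)))^t*)^t* =
      stk (fun k => eps (tr (yk k), c) i (yk k)) by rewrite trmxCK.
  rewrite mulmxA; congr (_ *m bdiag _ *m _); apply/funext => k.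
  rewrite trmxC_scale.
  rewrite (h2h (tr (yk k)) (yk k) (nb k) (tr_dom _)); congr (_ *: _).
  by rewrite fmorphV; congr (_^-1); exact: (CrealP (normr_real _)).
- move=> i x nd ix v v0; have [c cx] := rs_cover x.
  have [yk [[_ _ _ [del0 nb] uA] ->]] := pushed_metric_at nd ix cx.
  apply: (stk_positive uA) => // k w w0.
  rewrite -scalemxAr -scalemxAl mxE mulr_gt0 //; first by rewrite invr_gt0 normr_gt0.
  exact: (h2p (tr (yk k)) (yk k) (nb k) (tr_dom _) w w0).
- move=> i x nd ix; have [c cx] := rs_cover x.
  have [yk [[inj hyk hfib [del0 nb] uA] ->]] := pushed_metric_at nd ix cx.
  have /boolp.choice[B hB] : forall k, exists B : 'M[C]_(1 + 1),
      B^T *m hOmega (h := H2) (tr (yk k)) (yk k) *m B = std_symplectic R 1 /\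
      B^t* *m h2 (tr (yk k)) (yk k) *m B = 1%:M.
    by move=> k; exact: (h2sp (tr (yk k)) (yk k) (nb k) (tr_dom _)).
  have [M [hM1 hM2]] := stk_darboux uA del0 (fun k => (hB k).1) (fun k => (hB k).2).
  (* The form that [stk_darboux] assembles from del^-1 times that of E_2 is omega itself, by the
     pushforward model. *)
  exists M; split=> //; rewrite -hM1; congr (_ *m _ *m _).
  have [_ _ /(_ tr tr_dom i c x nd ix cx) ->] := H2_push.
  rewrite (fibre_sum _ inj hyk hfib); apply: eq_bigr => k _.
  by rewrite -scalemxAr -scalemxAl.
- move=> i c x nd ix cx.
  have [yk [[inj hyk hfib [del0 nb] uA] ->]] := pushed_metric_at nd ix cx.
  have cyk k : dom c (pi (yk k)) by rewrite hyk.
  have iyk k : bdom i (pi (yk k)) by rewrite hyk.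
  pose D k := Defs.hPhi (h := H2) (tr (yk k), c) (tr (yk k)) (yk k).
  have d0 k : `|del c (yk k)|^-1 != 0 by rewrite invr_eq0 normr_eq0.
  have uh k : h2 (tr (yk k)) (yk k) \in unitmx.
    by apply: posdef_unit => v v0; exact: (h2p _ _ (nb k) (tr_dom _) v v0).
  apply: (stk_normal (D := D) uA).
  + by move=> k; rewrite unitmxZ ?uh // unitfE d0.
  + by move=> k; have := hPhi (tr (yk k)) c i (yk k) (tr_dom _) (cyk k) (iyk k); rewrite hyk.
  move=> k; rewrite (adjoint_wrtZ _ (d0 k) (uh k)).
  exact: (h2n (tr (yk k)) c (yk k) (nb k) (tr_dom _) (cyk k)).
Qed.

End Solution.

Theorem theorem5p8 (R : realType) (X : riemann_surface R) (g n : nat)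
    (* X compact of genus g >= 2, n >= 1 *)
    (X_compact : compact [set: X]) (X_genus : genus X g)
    (g_ge2 : (2 <= g)%N) (n_ge1 : (1 <= n)%N)
    (* (E, Phi, omega), with spectral curve Sigma *)
    (H : higgs (canonical_bundle X) n) (H_moduli : in_moduli H)
    (Sigma_irreducible : sigma_irreducible H)
    (Sigma_reduced : sigma_reduced H) (Sigma_sl2 : sl2_type H)
    (* pi : Y = Sigma/sigma -> X and b_2 *)
    (Y : riemann_surface R) (pi : Y -> X) (b2 : rs_ix X -> Y -> Cplx R)
    (Y_quotient : quotient_curve H pi b2)
    (* del = the section of pi^*K^(2n-2) with divisor div(d pi) *)
    (del : rs_ix X -> Y -> Cplx R) (del_ram : ramification_section n pi del)
    (* (E_2, Phi_2) corresponding to (E, Phi, omega) *)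
    (H2 : higgs (pullback pi (canonical_bundle X)) 1)
    (H2_moduli : in_moduli H2)
    (iota : bix (twist (pullback pi (hE H))
                       (pullback pi (canonical_bundle X)) (n - 1)) ->
            bix (hE H2) -> Y -> 'M[Cplx R]_(n + n, 1 + 1))
    (H2_kernel : kernel_model b2 iota)
    (eps : bix (twist (hE H2) (pullback pi (canonical_bundle X)) (n - 1)) ->
           bix (pullback pi (hE H)) -> Y -> 'M[Cplx R]_(1 + 1, n + n))
    (H2_push : pushforward_model del eps)
    (* the normalisation S of Sigma, its map to Y and its involution *)
    (S : riemann_surface R) (q : S -> X) (lam : rs_ix X -> S -> Cplx R)
    (S_normalisation : normalisation H q lam)
    (p2 : S -> Y) (sig : S -> S)
    (S_maps : normalisation_maps pi b2 q lam p2 sig)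
    (* the solution h_2 constructed from the eigen line bundle *)
    (h2 : bix (hE H2) -> Y -> 'M[Cplx R]_(1 + 1))
    (h2_eigen : eigen_line_metric b2 q lam p2 sig h2)
    (h2_solution : decoupled_hitchin (~` b2_zero pi b2) h2) :
  exists hdc : bix (hE H) -> X -> 'M[Cplx R]_(n + n),
    pushforward_metric del eps h2 hdc /\
    decoupled_hitchin (~` disc_zero H) hdc.
Proof.
have [H_sp _] := H_moduli; have [H2_sp _] := H2_moduli.
have [[_ cov _ _ _] _ _ _ _] := H2_sp.
have [tr tr_dom] := boolp.choice cov.
have [ch ch_dom] := boolp.choice (@rs_cover _ X).
exists (pushed_metric del eps h2 tr ch); split.
  exact (pushed_metric_push H_sp Y_quotient del_ram H2_push h2_solution tr_dom ch_dom).
exact (pushed_metric_solution H_sp H2_sp Y_quotient del_ram H2_push h2_solution tr_dom ch_dom).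
Qed.
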